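(* For every positive integer $r$, the degree of the complex symplectic group $\mathrm{Sp}(r)$ is given by $$\deg \mathrm{Sp}(r) =\det\left(\binom{2i + 2j - 2}{2i-1}\right)_{1\leq i,j\leq r}.$$
   Context: $\mathrm{Sp}(r)=\mathrm{Sp}(r,\mathbb{C})=\{M\in \mathrm{Mat}_{2r,2r}(\mathbb{C}) : M^T\Omega M=\Omega\}$, where $\Omega=\begin{pmatrix}0 & I_r\\ -I_r & 0\end{pmatrix}$ and $I_r$ is the $r\times r$ identity matrix; it is viewed as an affine complex variety in $\mathrm{Mat}_{2r,2r}(\mathbb{C})\cong\mathbb{C}^{4r^2}$. The degree of a complex variety $X$ embedded in affine space is the number of intersection points of $X$ with a generic (affine) linear space of complementary dimension. *)

(* Defs.v *)
From mathcomp Require Import all_boot all_order all_algebra.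
From mathcomp Require Import mpoly complex.
From mathcomp Require Import classical_sets cardinality reals.

Set Implicit Arguments.
Unset Strict Implicit.
Unset Printing Implicit Defensive.

Import Order.TTheory GRing.Theory Num.Theory.
Local Open Scope classical_set_scope.
Local Open Scope ring_scope.

Section AffineDegree.

Variable F : fieldType.

(* F is meant to be infinite: the polynomial P then cuts out a nonempty basic
   Zariski-open subset of F^N, on which Q is required to hold. *)
Definition generically N (Q : 'rV[F]_N -> Prop) : Prop :=
  exists2 P : {mpoly F[N]}, P != 0 & forall x : 'rV[F]_N, P.@[x 0] != 0 -> Q x.

(* The restrictions to X of the polynomials f_0, ..., f_(d-1) are algebraically
   independent elements of the coordinate ring F[X]. *)
Definition alg_indep_on n (X : set 'rV[F]_n) d (f : 'I_d -> {mpoly F[n]}) :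
    Prop :=
  forall P : {mpoly F[d]},
    (forall x, X x -> P.@[fun i => (f i).@[x 0]] = 0) -> P = 0.

(* Dimension as a transcendence degree: the largest number of algebraically
   independent regular functions on X. The empty set has no dimension. *)
Definition has_dim n (X : set 'rV[F]_n) (d : nat) : Prop :=
  (exists f : 'I_d -> {mpoly F[n]}, alg_indep_on X f) /\
  (forall e (f : 'I_e -> {mpoly F[n]}), alg_indep_on X f -> (e <= d)%N).

Definition affine_space n d (A : 'M[F]_(n, d)) (b : 'rV[F]_d) : set 'rV[F]_n :=
  [set x | x *m A = b].

(* An affine space of dimension n - d is given by d independent equations
   x *m A = b, so that "generic" refers to the n * d + d entries of (A, b).
   Intersection points are counted as a set, without multiplicity. *)
Definition has_degree n (X : set 'rV[F]_n) (D : nat) : Prop :=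
  exists2 d, has_dim X d &
    generically (fun p : 'rV[F]_(n * d + d) =>
      let A := vec_mx (lsubmx p) in
      let b := rsubmx p in
      \rank A = d /\ (X `&` affine_space A b #= `I_D)%card).

End AffineDegree.

Definition symp_form (F : fieldType) r : 'M[F]_(r + r) :=
  block_mx 0 1%:M (- 1%:M) 0.

Definition Sp (F : fieldType) r : set 'M[F]_(r + r) :=
  [set M | M^T *m symp_form F r *m M = symp_form F r].
Arguments Sp : clear implicits.

Definition Sp_variety (F : fieldType) r : set 'rV[F]_((r + r) * (r + r)) :=
  [set mxvec M | M in Sp F r].
Arguments Sp_variety : clear implicits.

(* Main.v *)
(* Put N = r (2r + 1).  Let b = x A and T = x c be N + 1 generic linear forms on
   a variety X.  If the monomials of degree <= d span a space of dimension at
   most D 'C(d, N) + O(d^(N-1)) of functions on X, these forms satisfy a relation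
   P(A, b, c; T) = 0 of degree D in T; differentiating it in c_j yields
   x_j = - (dP/dc_j) / (dP/dT), so that, when no relation has smaller degree, the
   D roots of P(A, b, c; .) correspond to the points of X on x A = b, for generic
   A, b and c.

   For X = Sp(r), list rows and columns as l_0, r_0, l_1, r_1, ... along the
   symplectic pairs.  Since the rows and the columns of a symplectic matrix are
   isotropic up to constants, any product of k + 1 entries that increases
   strictly in both directions within the first 2k rows, or columns, is a
   combination of lower monomials.  The supports of the remaining monomials are
   the faces of a complex whose facets are the unions of r disjoint lattice
   paths, the l-th one from (2l, 2r - 1) to (2r - 1, 2l); D is their number,
   which a row by row recursion turns into the determinant.

   Conversely, rescaling the entries by powers of a parameter degenerates Sp(r),
   in two steps, to a set containing the generic points of all coordinate
   subspaces spanned by facets.  A relation P degenerates to a nonzero relation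
   whose degree in T is no larger, and which has D distinct roots, one for each
   of these subspaces. *)

Require Import Defs.
From mathcomp Require Import all_boot all_order all_algebra.
From mathcomp Require Import mpoly complex.
From mathcomp Require Import classical_sets cardinality reals.
From mathcomp Require Import separable perm boolp zify ring.

Set Implicit Arguments.
Unset Strict Implicit.
Unset Printing Implicit Defensive.

Import Order.TTheory GRing.Theory Num.Theory.
Local Open Scope ring_scope.

(** * Polynomial functions *)

(** Relations between generic forms replace Hilbert polynomials, Bezout and dimension theory, so the
    degree comes from two bounds on relations that meet. A relation of degree D exists by counting:
    the products T^e b^m with e <= D and [mdeg m <= d - D] number about (D + 1) d^N / N!, more than
    the functions of degree <= d on X. A shortest relation has distinct roots because the scalars
    have characteristic 0: a repeated factor could be removed, giving a shorter relation. Every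
    other relation is a multiple of it up to its leading coefficient, so identities valid on X can
    be read off at its roots; this is what produces points of X from roots. On the combinatorial
    side only upper bounds are proved, for the number of facets and for the span of the face
    monomials; the degenerations supply the lower bound. Two degenerations occur because symplectic
    matrices factor into block triangular matrices subject to symmetry conditions. The first scaling
    removes these conditions and leaves sums of r rank-one matrices, the l-th one living in rows and
    columns from 2l on. The second bends each rank-one term onto its own lattice path. *)

Lemma poly_vanishing (F : numDomainType) (p : {poly F}) :
  (forall x, x != 0 -> p.[x] = 0) -> p = 0.
Proof.
move=> p0; apply/eqP/negPn/negP => pN0.
have := max_poly_roots pN0 (rs := [seq (i.+1)%:R | i <- iota 0 (size p)]).
rewrite size_map size_iota ltnn => H; suff: false by []; apply: H.
  by apply/allP=> x /mapP[i _ ->]; rewrite /root p0 ?pnatr_eq0.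
by rewrite map_inj_uniq ?iota_uniq // => i j /eqP; rewrite eqr_nat => /eqP[].
Qed.

Lemma mpoly_vanishing (F : numDomainType) n (p : {mpoly F[n]}) :
  (forall v : 'I_n -> F, p.@[v] = 0) -> p = 0.
Proof.
elim: n p => [|n IHn] p p0.
  rewrite (nvar0_mpolyC p); move: (p0 (fun=> 0)).
  by rewrite {1}(nvar0_mpolyC p) mevalC => ->; rewrite mpolyC0.
(* [muni] sorts the monomials by their exponent in the last variable. As [tr m] and that exponent
   determine [m], no two coefficients of [p] merge. *)
suff up0: muni p = 0.
  apply/mpolyP => m; rewrite mcoeff0.
  pose tr (m : 'X_{1..n.+1}) : 'X_{1..n} :=
    [multinom m (widen_ord (leqnSn n) i) | i < n].
  have trI m1 m2 : tr m1 = tr m2 -> m1 ord_max = m2 ord_max -> m1 = m2.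
    move=> /mnmP e1 e2; apply/mnmP => i.
    case: (unliftP ord_max i) => [j ->|-> //].
    have := e1 j; rewrite !mnmE.
    by have -> : widen_ord (leqnSn n) j = lift ord_max j
      by apply/val_inj; rewrite /= /bump leqNgt ltn_ord.
  have: (muni p)`_(m ord_max)@_(tr m) = 0 by rewrite up0 coef0 mcoeff0.
  rewrite muniE coef_sum raddf_sum /=.
  have E m' : ((p@_m' *: 'X_[tr m']) *: 'X^(m' ord_max))`_(m ord_max)@_(tr m)
      = if m' == m then p@_m else 0.
    rewrite coefZ coefXn; case: (eqVneq m' m) => [->|ne].
      by rewrite eqxx mulr1 mcoeffZ mcoeffX eqxx mulr1.
    case: eqP => [e1|]; rewrite ?mulr0 ?mcoeff0 // mulr1 mcoeffZ mcoeffX.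
    case: eqP => [e2|]; rewrite ?mulr0 //.
    by case/eqP: ne; apply: trI.
  under eq_bigr do rewrite E.
  case: (boolP (m \in msupp p)) => [mp|]; last by move/memN_msupp_eq0.
  by rewrite (bigD1_seq m) ?msupp_uniq //= eqxx big1 ?addr0 // => i /negPf ->.
apply/polyP => k; rewrite coef0; apply: IHn => v.
pose q := map_poly (meval v) (muni p).
suff -> : ((muni p)`_k).@[v] = q`_k.
  rewrite (_ : q = 0) ?coef0 //; apply: poly_vanishing => t _.
  pose w i : F := if unlift ord_max i is Some j then v j else t.
  rewrite -(p0 w) mevalE /q muniE raddf_sum /= horner_sum.
  apply: eq_bigr => m _.
  rewrite linearZ /= map_polyXn hornerZ hornerXn mevalZ mevalX -mulrA.
  congr (_ * _); rewrite big_ord_recr /=; congr (_ * _).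
    apply: eq_bigr => i _; rewrite mnmE /w.
    have -> : widen_ord (leqnSn n) i = lift ord_max i
      by apply/val_inj; rewrite /= /bump leqNgt ltn_ord.
    by rewrite liftK.
  by rewrite /w unlift_none.
by rewrite coef_map.
Qed.

Lemma mpoly_nonvanishing (F : numDomainType) n (p : {mpoly F[n]}) :
  p != 0 -> exists v : 'rV[F]_n, p.@[v 0] != 0.
Proof.
move=> /eqP pN0; apply: contrapT => H; apply: pN0; apply: mpoly_vanishing => v.
apply: contrapT => /eqP pv; apply: H; exists (\row_i v i).
by rewrite (@meval_eq _ _ _ v) // => i; rewrite mxE.
Qed.

Section PolynomialFunctions.
Variables (F : numFieldType) (k : nat).
Implicit Types f g : 'rV[F]_k -> F.

Definition polyfun f := exists P : {mpoly F[k]}, forall v, f v = P.@[v 0].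

Lemma polyfun_meval (P : {mpoly F[k]}) : polyfun (fun v => P.@[v 0]).
Proof. by exists P. Qed.

Lemma polyfun_cst c : polyfun (fun=> c).
Proof. by exists c%:MP => v; rewrite mevalC. Qed.

Lemma polyfun_coord i : polyfun (fun v => v 0 i).
Proof. by exists 'X_i => v; rewrite mevalXU. Qed.

Lemma polyfunD f g : polyfun f -> polyfun g -> polyfun (fun v => f v + g v).
Proof. by move=> [P fP] [Q gQ]; exists (P + Q) => v; rewrite mevalD fP gQ. Qed.

Lemma polyfunM f g : polyfun f -> polyfun g -> polyfun (fun v => f v * g v).
Proof. by move=> [P fP] [Q gQ]; exists (P * Q) => v; rewrite mevalM fP gQ. Qed.

Lemma polyfunN f : polyfun f -> polyfun (fun v => - f v).
Proof. by move=> [P fP]; exists (- P) => v; rewrite mevalN fP. Qed.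

Lemma eq_polyfun f g : f =1 g -> polyfun f -> polyfun g.
Proof. by move=> fg [P fP]; exists P => v; rewrite -fg fP. Qed.

Lemma polyfun_sum I (s : seq I) (p : pred I) (f : I -> 'rV[F]_k -> F) :
  (forall i, polyfun (f i)) -> polyfun (fun v => \sum_(i <- s | p i) f i v).
Proof.
move=> pf; elim: s => [|i s IHs].
  by apply: eq_polyfun (polyfun_cst 0) => v; rewrite big_nil.
have [pi|/negPf pi] := boolP (p i); last first.
  by apply: eq_polyfun IHs => v; rewrite big_cons pi.
by apply: eq_polyfun (polyfunD (pf i) IHs) => v; rewrite big_cons pi.
Qed.

Lemma polyfun_prod I (s : seq I) (p : pred I) (f : I -> 'rV[F]_k -> F) :
  (forall i, polyfun (f i)) -> polyfun (fun v => \prod_(i <- s | p i) f i v).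
Proof.
move=> pf; elim: s => [|i s IHs].
  by apply: eq_polyfun (polyfun_cst 1) => v; rewrite big_nil.
have [pi|/negPf pi] := boolP (p i); last first.
  by apply: eq_polyfun IHs => v; rewrite big_cons pi.
by apply: eq_polyfun (polyfunM (pf i) IHs) => v; rewrite big_cons pi.
Qed.

Lemma polyfun_det n (A : 'rV[F]_k -> 'M[F]_n) :
  (forall i j, polyfun (fun v => A v i j)) -> polyfun (fun v => \det (A v)).
Proof.
by move=> pA; apply: polyfun_sum => s; apply: polyfunM (polyfun_cst _) _;
   apply: polyfun_prod => i.
Qed.

Lemma polyfun_mulmx n m p (A : 'rV[F]_k -> 'M[F]_(n, m))
    (B : 'rV[F]_k -> 'M[F]_(m, p)) :
  (forall i j, polyfun (fun v => A v i j)) ->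
  (forall i j, polyfun (fun v => B v i j)) ->
  forall i j, polyfun (fun v => (A v *m B v) i j).
Proof.
move=> pA pB i j; apply: (@eq_polyfun (fun v => \sum_l A v i l * B v l j)).
  by move=> v; rewrite mxE.
by apply: polyfun_sum => l; apply: polyfunM.
Qed.

Lemma polyfun_adj n (A : 'rV[F]_k -> 'M[F]_n) :
  (forall i j, polyfun (fun v => A v i j)) ->
  forall i j, polyfun (fun v => (\adj (A v)) i j).
Proof.
move=> pA i j.
apply: (@eq_polyfun (fun v => (-1) ^+ (j + i) * \det (row' j (col' i (A v))))).
  by move=> v; rewrite mxE.
apply: polyfunM (polyfun_cst _) _; apply: polyfun_det => x y.
by apply: (@eq_polyfun (fun v => A v (lift j x) (lift i y))) => // v; rewrite !mxE.
Qed.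

Lemma polyfun_avoid I (s : seq I) (f : I -> 'rV[F]_k -> F) :
  (forall i, polyfun (f i)) -> (forall i, exists v : 'rV[F]_k, f i v != 0) ->
  exists2 P : {mpoly F[k]}, P != 0 &
    forall v : 'rV[F]_k, P.@[v 0] = \prod_(i <- s) f i v.
Proof.
move=> pf nzf; elim: s => [|i s [P PN0 PE]].
  by exists 1 => [|v]; rewrite ?oner_neq0 // meval1 big_nil.
have [Q QE] := pf i; have [v fv] := nzf i.
have QN0 : Q != 0.
  by apply/eqP => Q0; case/eqP: fv; rewrite QE Q0 meval0.
by exists (Q * P) => [|w]; rewrite ?mulf_neq0 // mevalM big_cons QE PE.
Qed.

Lemma polyfun_avoid_fin (I : finType) (f : I -> 'rV[F]_k -> F) :
  (forall i, polyfun (f i)) -> (forall i, exists v : 'rV[F]_k, f i v != 0) ->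
  exists v : 'rV[F]_k, forall i, f i v != 0.
Proof.
move=> pf nzf; have [P PN0 PE] := polyfun_avoid (index_enum I) pf nzf.
have [v Pv] := mpoly_nonvanishing PN0; exists v => i.
by move: Pv; rewrite PE (bigD1 i) //= mulf_eq0 negb_or => /andP[].
Qed.

End PolynomialFunctions.

Lemma polyfun_comp (F : numFieldType) k l (f : 'rV[F]_l -> F)
    (g : 'rV[F]_k -> 'rV[F]_l) :
  polyfun f -> (forall j, polyfun (fun v => g v 0 j)) -> polyfun (fun v => f (g v)).
Proof.
move=> [P fP] /choice[Q QE]; exists (P \mPo [tuple Q j | j < l]) => v.
by rewrite comp_mpoly_meval fP; apply: meval_eq => j; rewrite tnth_mktuple.
Qed.

Lemma frac_denK (R : idomainType) (x : {fraction R}) :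
  x * FracField.tofrac \d_(repr x) = FracField.tofrac \n_(repr x).
Proof.
rewrite -{1}[x]reprK; move: (repr x) => y.
unlock FracField.tofrac; rewrite -[LHS]FracField.pi_mul.
apply/eqmodP; rewrite /= FracField.equivfE /FracField.mulf.
by rewrite !numden_Ratio ?mulr1 ?mulf_neq0 ?oner_neq0 ?denom_ratioP // mulrC.
Qed.

(** The rank argument runs over the fraction field; a nonzero kernel row is then multiplied by the
    product of its denominators. *)
Lemma left_kernel_idomain (R : idomainType) m n (E : 'M[R]_(m, n)) :
  (n < m)%N -> exists2 z : 'rV[R]_m, z != 0 & z *m E = 0.
Proof.
move=> ltnm.
have [tf tfI] : exists2 f : {rmorphism R -> {fraction R}}, injective f &
    forall x : {fraction R}, x * f \d_(repr x) = f \n_(repr x).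
  exists (@FracField.tofrac R); last exact: frac_denK.
  by move=> x y /eqP; rewrite tofrac_eq => /eqP.
move=> denK.
pose K := kermx (map_mx tf E).
have KN0 : K != 0.
  rewrite -mxrank_eq0 mxrank_ker subn_eq0 -ltnNge.
  by apply: leq_ltn_trans ltnm; apply: rank_leq_col.
have [i rN0] : exists i, row i K != 0.
  apply/existsP; apply: contraNT KN0; rewrite negb_exists => /forallP H.
  by apply/eqP/row_matrixP => i; rewrite row0; have := H i; rewrite negbK => /eqP.
pose w := row i K.
have wE : w *m map_mx tf E = 0 by rewrite -row_mul mulmx_ker row0.
pose d (j : 'I_m) : R := \d_(repr (w 0 j)).
pose a (j : 'I_m) : R := \n_(repr (w 0 j)).
have dN0 j : d j != 0 by apply: denom_ratioP.
have wd j : w 0 j * tf (d j) = tf (a j) by exact: denK.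
pose D := \prod_j d j.
have DN0 : D != 0 by apply/prodf_neq0 => j _.
pose z : 'rV[R]_m := \row_j (a j * \prod_(l | l != j) d l).
have zE : map_mx tf z = tf D *: w.
  apply/rowP => j; rewrite [LHS]mxE [in LHS]mxE rmorphM /= -wd.
  by rewrite [RHS]mxE /D [in RHS](bigD1 j) //= rmorphM /=; ring.
exists z.
  apply/eqP => z0; move: zE; rewrite z0 map_mx0 => /esym/eqP.
  by rewrite scaler_eq0 (negPf rN0) orbF -(rmorph0 tf) (inj_eq tfI) (negPf DN0).
apply/matrixP => u v; apply: tfI; move/matrixP/(_ u v): (map_mxM tf z E).
by rewrite zE -scalemxAl wE scaler0 !mxE rmorph0.
Qed.

(** * Relations between generic linear forms *)

Section LinearRelation.
Variables (C : numFieldType) (n : nat) (X : set 'rV[C]_n).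

Definition spanned d (S : seq 'X_{1..n}) :=
  forall m, (mdeg m <= d)%N -> exists r : 'X_{1..n} -> C, forall x, X x ->
    'X_[m].@[x 0] = \sum_(s <- S) r s * 'X_[s].@[x 0].

(** On X each [G i] has [size S] coordinates over [R], so more than [size S] of them are dependent.
    Taking [R] rather than the scalars lets the coefficients be generic: one dependence [z] serves
    every specialization [e] that fixes the scalars. *)
Lemma linear_relation (R : idomainType) (iota : {rmorphism C -> R}) d S M
    (G : 'I_M -> {mpoly R[n]}) :
  spanned d S -> (forall i, msize (G i) <= d.+1)%N -> (size S < M)%N ->
  exists2 z : 'rV[R]_M, z != 0 &
    forall e : {rmorphism R -> C}, (forall a, e (iota a) = a) ->
    forall x, X x -> \sum_i e (z 0 i) * mmap e (x 0) (G i) = 0.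
Proof.
move=> sp szG ltSM.
have /choice[r rP] : forall m : 'X_{1..n}, exists r : 'X_{1..n} -> C,
    (mdeg m <= d)%N -> forall x, X x ->
    'X_[m].@[x 0] = \sum_(s <- S) r s * 'X_[s].@[x 0].
  move=> m; have [/sp[r rP]|_] := boolP (mdeg m <= d)%N; first by exists r.
  by exists (fun=> 0).
pose E := \matrix_(i < M, s < size S)
  \sum_(m <- msupp (G i)) (G i)@_m * iota (r m (nth 0%MM S s)).
have [z zN0 zE] := left_kernel_idomain E ltSM.
exists z => // e eK x Xx.
have GE i : mmap e (x 0) (G i) =
    \sum_(s < size S) e (E i s) * 'X_[nth 0%MM S s].@[x 0].
  rewrite /mmap; under [RHS]eq_bigr do rewrite mxE rmorph_sum /= mulr_suml.
  rewrite [RHS]exchange_big /=; apply: eq_big_seq => m mG.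
  under [RHS]eq_bigr do rewrite rmorphM /= eK -mulrA.
  rewrite -mulr_sumr; congr (_ * _).
  have := rP m _ x Xx; rewrite mevalX (big_nth 0%MM) big_mkord; apply.
  by rewrite -ltnS; apply: leq_trans (szG i); apply: msize_mdeg_lt.
under eq_bigr do rewrite GE mulr_sumr.
rewrite exchange_big /= big1 // => s _.
under eq_bigr do rewrite mulrA -rmorphM /=.
rewrite -mulr_suml -rmorph_sum /=.
by have /rowP/(_ s) := zE; rewrite !mxE => ->; rewrite rmorph0 mul0r.
Qed.

End LinearRelation.

Lemma card_bmnm n d : #|{: 'X_{1..n < d.+1}}| = 'C(n + d, n).
Proof.
rewrite -[LHS]cardsT.
rewrite -(card_partial_ord_partitions n d).
pose f (m : 'X_{1..n < d.+1}) : n.-tuple 'I_d.+1 := [tuple inord (m i) | i < n].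
have mi (m : 'X_{1..n < d.+1}) i : (m i < d.+1)%N.
  apply: leq_ltn_trans (bmdeg m); rewrite mdegE (bigD1 i) //=; exact: leq_addr.
have fI : injective f.
  move=> m1 m2 /(congr1 (fun t => tnth t)) E; apply/val_inj/mnmP => i.
  have := congr1 (fun g => val (g i)) E.
  by rewrite !tnth_mktuple /= !inordK.
rewrite -(card_imset _ fI); apply: eq_card => t; rewrite !inE.
apply/imsetP/idP => [[m _ ->]|].
  rewrite big_tuple; under eq_bigr do rewrite tnth_mktuple inordK //.
  by rewrite -mdegE -ltnS bmdeg.
rewrite big_tuple => tP.
have tP' : (mdeg [multinom (tnth t i : nat) | i < n] < d.+1)%N.
  by rewrite mdegE; under eq_bigr do rewrite mnmE.
exists (BMultinom tP') => //; apply: eq_from_tnth => i.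
by rewrite tnth_mktuple /= mnmE inord_val.
Qed.

Lemma horner_map_horner (R S : comNzRingType) (f : {additive R -> {poly S}})
    (P : {poly R}) (t : {poly S}) s :
  (map_poly f P).[t].[s] = (map_poly (fun a => (f a).[s]) P).[t.[s]].
Proof.
rewrite -[LHS]/(horner_eval s _) -horner_map; congr (_.[_]).
by rewrite -map_poly_comp.
Qed.

Lemma map_polyMXaddC (R S : nzRingType) (f : {additive R -> S}) (P : {poly R}) a :
  map_poly f (P * 'X + a%:P) = map_poly f P * 'X + (f a)%:P.
Proof.
apply/polyP => e; rewrite coef_map /= !coefD !coefMX !coefC coef_map /=.
by case: e => [|e]; rewrite raddfD /= ?raddf0.
Qed.

(** The chain rule at s = 0 for P_s(T + s x): [Phi] moves the coefficients of [P] with s, and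
    [delta] is the velocity of this motion. *)
Lemma deriv_along_line (R S : comNzRingType) (Phi : {rmorphism R -> {poly S}})
    (delta : {additive R -> R}) (e : {rmorphism R -> S}) (P : {poly R}) T x :
  (forall a, (Phi a).[0] = e a) -> (forall a, (Phi a)^`().[0] = e (delta a)) ->
  (map_poly Phi P).[T%:P + x *: 'X]^`().[0] =
  (map_poly e (map_poly delta P)).[T] + x * (map_poly e P^`()).[T].
Proof.
move=> Phi0 Phi1; elim/poly_ind: P => [|P a IHP].
  by rewrite deriv0 !map_poly0 !horner0 derivC horner0 mulr0 addr0.
have H0 : ((map_poly Phi P).[T%:P + x *: 'X]).[0] = (map_poly e P).[T].
  rewrite horner_map_horner hornerD hornerC hornerZ hornerX mulr0 addr0.
  by congr (_.[_]); apply: eq_map_poly => b; rewrite Phi0.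
rewrite !map_polyMXaddC !hornerMXaddC derivD derivM !hornerD !hornerM IHP H0 Phi1.
rewrite !derivE rmorphD rmorphM /= map_polyX !hornerD !hornerM !hornerE.
by rewrite /=; ring.
Qed.

Section GenericSection.
Variables (C : numClosedFieldType) (n N : nat).
Local Notation k := (n * N + N + n)%N.
Local Notation MP := {mpoly C[k]}.
Implicit Types (X : set 'rV[C]_n) (P Q : {poly MP}) (v : 'rV[C]_k).

Definition pt (T : Type) (A : 'M[T]_(n, N)) (b : 'rV[T]_N) (c : 'rV[T]_n) : 'rV[T]_k :=
  row_mx (row_mx (mxvec A) b) c.

Definition idxA (i : 'I_n) (j : 'I_N) : 'I_k :=
  lshift n (lshift N (mxvec_index i j)).
Definition idxb (j : 'I_N) : 'I_k := lshift n (rshift (n * N) j).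
Definition idxc (i : 'I_n) : 'I_k := rshift (n * N + N) i.

Lemma ptA T A b c i j : @pt T A b c 0 (idxA i j) = A i j.
Proof. by rewrite /pt !row_mxEl mxvecE. Qed.
Lemma ptb T A b c j : @pt T A b c 0 (idxb j) = b 0 j.
Proof. by rewrite /pt row_mxEl row_mxEr. Qed.
Lemma ptc T A b c j : @pt T A b c 0 (idxc j) = c 0 j.
Proof. by rewrite /pt row_mxEr. Qed.

Lemma ptE T (v : 'rV[T]_k) : exists A b c, v = pt A b c.
Proof.
exists (vec_mx (lsubmx (lsubmx v))), (rsubmx (lsubmx v)), (rsubmx v).
by rewrite /pt vec_mxK !hsubmxK.
Qed.

Definition ev v P : {poly C} := map_poly (meval (v 0)) P.

(* P(A, b, c; T) vanishes at b = x A, T = x c for x in X and all A, c: a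
   relation satisfied by N + 1 generic linear forms restricted to X. *)
Definition Rel X P := forall A x c, X x ->
  (ev (pt A (x *m A) c) P).[(x *m c^T) 0 0] = 0.

Lemma evM v P Q : ev v (P * Q) = ev v P * ev v Q.
Proof. exact: rmorphM. Qed.
Lemma evD v P Q : ev v (P + Q) = ev v P + ev v Q.
Proof. exact: rmorphD. Qed.
Lemma evN v P : ev v (- P) = - ev v P.
Proof. exact: rmorphN. Qed.
Lemma evC v a : ev v a%:P = (a.@[v 0])%:P.
Proof. by rewrite /ev map_polyC. Qed.
Lemma evZ v a P : ev v (a *: P) = a.@[v 0] *: ev v P.
Proof. by rewrite /ev map_polyZ. Qed.
Lemma ev_deriv v P : ev v P^`() = (ev v P)^`().
Proof. by rewrite /ev deriv_map. Qed.
Lemma evX v : ev v 'X = 'X.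
Proof. exact: map_polyX. Qed.
Lemma ev_exp v P i : ev v (P ^+ i) = ev v P ^+ i.
Proof. exact: rmorphXn. Qed.
Lemma ev_sum v I (s : seq I) (p : pred I) (F : I -> {poly MP}) :
  ev v (\sum_(i <- s | p i) F i) = \sum_(i <- s | p i) ev v (F i).
Proof. exact: raddf_sum. Qed.
Lemma ev_prod v I (s : seq I) (p : pred I) (F : I -> {poly MP}) :
  ev v (\prod_(i <- s | p i) F i) = \prod_(i <- s | p i) ev v (F i).
Proof. exact: rmorph_prod. Qed.

Definition dcoef (i : 'I_n) P : {poly MP} := map_poly (mderiv (idxc i)) P.

Lemma mpoly_ring_ind (R : comNzRingType) l (Q : {mpoly R[l]} -> Prop) :
  (forall a, Q a%:MP) -> (forall i, Q 'X_i) ->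
  (forall a b, Q a -> Q b -> Q (a + b)) ->
  (forall a b, Q a -> Q b -> Q (a * b)) -> forall a, Q a.
Proof.
move=> QC QX QD QM a; rewrite [a]mpolyE.
have Q0 : Q 0 by rewrite -mpolyC0.
apply: big_ind => // m _; rewrite -mul_mpolyC; apply: (QM) => //.
have Q1 : Q 1 by rewrite -mpolyC1.
rewrite mpolyXE_id; apply: big_ind => [//|p q|i _]; first exact: QM.
elim: (m i) => [|e IHe]; first by rewrite expr0.
by rewrite exprS; apply: QM.
Qed.

Lemma Rel_dcoef X P (i : 'I_n) A x c : Rel X P -> X x ->
  (ev (pt A (x *m A) c) (dcoef i P)).[(x *m c^T) 0 0] =
  - (x 0 i * (ev (pt A (x *m A) c) P^`()).[(x *m c^T) 0 0]).
Proof.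
move=> RP Xx; set v := pt _ _ _; set T := (x *m c^T) 0 0.
pose u j : {poly C} := (v 0 j)%:P + (j == idxc i)%:R *: 'X.
pose t : {poly C} := T%:P + x 0 i *: 'X.
pose Phi := mmap polyC u.
have PhiS s a : (Phi a).[s] = a.@[fun j => (u j).[s]].
  elim/mpoly_ring_ind: a => [a|j|a b IHa IHb|a b IHa IHb].
  - by rewrite /Phi mmapC mevalC hornerC.
  - by rewrite /Phi mmapX mmap1U mevalXU.
  - by rewrite /Phi mmapD hornerD mevalD -IHa -IHb.
  - by rewrite /Phi rmorphM /= hornerM mevalM -IHa -IHb.
have u0 : (fun j => (u j).[0]) =1 v 0.
  by move=> j; rewrite /u hornerD hornerC hornerZ hornerX mulr0 addr0.
have Phi0 a : (Phi a).[0] = a.@[v 0] by rewrite PhiS; apply: meval_eq.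
have Phi1 a : (Phi a)^`().[0] = (mderiv (idxc i) a).@[v 0].
  elim/mpoly_ring_ind: a => [a|j|a b IHa IHb|a b IHa IHb].
  - by rewrite /Phi mmapC mderivC derivC horner0 meval0.
  - rewrite /Phi mmapX mmap1U mderivX mnm1E mevalZ derivD derivC add0r derivZ.
    rewrite derivX alg_polyC hornerC; case: eqP => [->|]; last by rewrite mul0r.
    by rewrite -{1}[(U_(_))%MM]add0m addmK mpolyX0 meval1 mulr1.
  - by rewrite /Phi mmapD derivD hornerD mderivD mevalD -IHa -IHb.
  - rewrite /Phi rmorphM /= derivM hornerD !hornerM mderivM mevalD !mevalM.
    by rewrite -IHa -IHb -!Phi0.
(* [q] is the relation along the line c + s e_i, where T = x c + s x_i. Since b = x A does not
   involve c, the relation holds for all s. *)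
pose q := (map_poly Phi P).[t].
have q0 : q = 0.
  apply: poly_vanishing => s _.
  rewrite /q horner_map_horner.
  pose c' : 'rV[C]_n := c + s *: delta_mx 0 i.
  have tE : t.[s] = (x *m c'^T) 0 0.
    rewrite /t hornerD hornerC hornerZ hornerX /c' linearD linearZ /= mulmxDr.
    rewrite -scalemxAr trmx_delta -colE [RHS]mxE -/T; congr (_ + _).
    by rewrite [RHS]mxE [col _ _ _ _]mxE mulrC.
  rewrite tE -[RHS](RP A x c' Xx); congr (_.[_]).
  apply: eq_map_poly => a; rewrite PhiS; apply: meval_eq => j.
  rewrite /u hornerD hornerC hornerZ hornerX /v /pt ![row_mx _ _ _ _]mxE.
  case: split_ordP => j' ->; first by rewrite /idxc eq_lrshift mul0r addr0.
  by rewrite /idxc eq_rshift /c' !mxE eqxx /= mulrC.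
have : q^`().[0] = (ev v (dcoef i P)).[T] + x 0 i * (ev v P^`()).[T].
  exact: (deriv_along_line (e := meval (v 0)) P T (x 0 i) Phi0 Phi1).
rewrite q0 derivC horner0 => /esym/eqP; rewrite addr_eq0 => /eqP; exact.
Qed.
End GenericSection.

(** * Distinct roots and the points of a fibre *)

Lemma gcd_deriv_dichotomy (R : idomainType) (mu : {poly R}) : mu != 0 ->
  (exists u w, exists2 a, a != 0 & u * mu + w * mu^`() = a%:P) \/
  (exists f g h, exists2 a, a != 0 &
    [/\ a *: mu = g * f, a *: mu^`() = h * f & (g != 0) && (size g < size mu)%N]).
Proof.
move=> muN0; have [cop|ncop] := boolP (coprimep mu mu^`()).
  left; have /Pdiv.Idomain.Bezout_coprimepP[[u w] /= /eqp_size] := cop.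
  by rewrite size_poly1 => /eqP/size_poly1P[a aN0 E]; exists u, w, a.
right; pose f := gcdp mu mu^`().
have /Pdiv.Idomain.dvdpP[[a g] /= aN0 gE] : (f %| mu)%R by apply: dvdp_gcdl.
have /Pdiv.Idomain.dvdpP[[b h] /= bN0 hE] : (f %| mu^`())%R by apply: dvdp_gcdr.
exists f, (b *: g), (a *: h), (a * b); first by rewrite mulf_neq0.
have gN0 : g != 0.
  apply/eqP => g0; move/eqP: gE; rewrite g0 mul0r scale_poly_eq0.
  by rewrite (negPf aN0) (negPf muN0).
have fN0 : f != 0.
  apply/eqP => f0; move/eqP: gE; rewrite f0 mulr0 scale_poly_eq0.
  by rewrite (negPf aN0) (negPf muN0).
split; first by rewrite -scalerAl -gE scalerA mulrC.
  by rewrite -scalerAl -hE scalerA.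
rewrite scale_poly_eq0 negb_or bN0 gN0 size_scale //=.
have := congr1 (fun p : {poly R} => size p) gE.
rewrite size_scale // size_mul // => ->.
have: (1 < size f)%N.
  rewrite ltn_neqAle eq_sym -coprimep_def ncop.
  by rewrite size_poly_gt0 fN0.
by move: (size f) => [|[|m]] // _; rewrite !addnS /= ltnS leq_addr.
Qed.

(** A root of multiplicity m + 1 of [p] has multiplicity exactly m in the derivative, so a common
    factor [f] cannot absorb its full power. [f] is only assumed to be a common factor because
    specialization need not preserve gcds. *)
Lemma root_cofactor_gcd_deriv (C : numFieldType) (p f g h : {poly C}) a t :
  a != 0 -> p != 0 -> a *: p = g * f -> a *: p^`() = h * f -> p.[t] = 0 ->
  g.[t] = 0.
Proof.
move=> aN0 pN0 gE hE /eqP pt; apply/eqP/negPn/negP => gt.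
have [q qt pE] : exists2 q, ~~ root q t & exists k, p = q * ('X - t%:P) ^+ k.+1.
  have [[|k] [q]] := multiplicity_XsubC p t; rewrite (negPf pN0) /= => qt pE.
    by move: pt qt; rewrite pE expr0 mulr1 /root => ->.
  by exists q => //; exists k.
case: pE => k pE.
have fd : ('X - t%:P) ^+ k.+1 %| f.
  have cop : coprimep (('X - t%:P) ^+ k.+1) g.
    by rewrite coprimep_expl // coprimep_sym coprimep_XsubC.
  rewrite -(Gauss_dvdpr f cop) -gE pE.
  by rewrite dvdpZr // dvdp_mull.
have : ('X - t%:P) ^+ k.+1 %| p^`().
  by rewrite -(dvdpZr _ _ aN0) hE dvdp_mull.
rewrite pE derivM dvdp_addr; last by rewrite dvdp_mull.
rewrite deriv_exp derivXsubC mul1r /= mulrnAr -scaler_nat dvdpZr ?pnatr_eq0 //.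
rewrite exprS dvdp_mul2r ?expf_neq0 ?polyXsubC_eq0 //.
by rewrite dvdp_XsubCl (negPf qt).
Qed.

Lemma separable_roots (C : closedFieldType) (p u w : {poly C}) a D :
  size p = D.+1 -> a != 0 -> u * p + w * p^`() = a%:P ->
  exists2 s : seq C, uniq s && (size s == D) & forall t, root p t = (t \in s).
Proof.
move=> szp aN0 E; have [s ps] := closed_field_poly_normal p.
have lN0 : lead_coef p != 0 by rewrite lead_coef_eq0 -size_poly_gt0 szp.
exists s; last by move=> t; rewrite ps rootZ // root_prod_XsubC.
have := szp; rewrite {1}ps size_scale // size_prod_XsubC => -[->]; rewrite eqxx andbT.
rewrite -separable_prod_XsubC -(eqp_separable (eqp_scale _ lN0)) -ps.
rewrite unlock; apply/Pdiv.Idomain.Bezout_coprimepP; exists (u, w).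
by rewrite /= E polyC_eqp1.
Qed.

Section Fibres.
Variables (C : numClosedFieldType) (n N : nat).
Local Notation k := (n * N + N + n)%N.
Local Notation MP := {mpoly C[k]}.
Variables (X : set 'rV[C]_n) (D : nat) (mu : {poly MP}).
Hypothesis Rmin : forall P : {poly MP}, Rel X P -> P != 0 -> (D < size P)%N.
Hypothesis Rmu : Rel X mu.
Hypothesis szmu : size mu = D.+1.

Lemma mu_neq0 : mu != 0. Proof. by rewrite -size_poly_gt0 szmu. Qed.

(** The pseudo-remainder is again a relation and shorter than [mu], hence zero by minimality. *)
Lemma Rel_pseudo_division (P : {poly MP}) : Rel X P ->
  exists e Q, lead_coef mu ^+ e *: P = Q * mu.
Proof.
move=> RP; have E := Pdiv.Idomain.divp_eq P mu.
exists (Pdiv.Idomain.scalp P mu), (P %/ mu)%R; rewrite E.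
suff -> : (P %% mu)%R = 0 by rewrite addr0.
have RR : Rel X (P %% mu)%R.
  move=> A x c Xx; move/eqP: E; rewrite addrC -subr_eq => /eqP <-.
  rewrite evD evN evZ evM hornerD hornerN hornerZ hornerM.
  by rewrite Rmu // RP // !mulr0 subrr.
apply/eqP/negPn/negP => /(Rmin RR); rewrite ltnNge -ltnS -szmu.
by rewrite ltn_modp mu_neq0.
Qed.

(** Otherwise the cofactor of the gcd of [mu] and its derivative, which has the same roots, would
    give a shorter relation. The factor [lead_coef mu] takes care of the parameters at which [mu]
    may specialize to zero. *)
Lemma coprime_mu_deriv : exists u w, exists2 a, a != 0 & u * mu + w * mu^`() = a%:P.
Proof.
have [//|[f [g [h [a aN0 [gE hE /andP[gN0]]]]]]] := gcd_deriv_dichotomy mu_neq0.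
have lN0 : lead_coef mu != 0 by rewrite lead_coef_eq0 mu_neq0.
rewrite szmu ltnS leqNgt => /negP[].
rewrite -(size_scale g (mulf_neq0 aN0 lN0)); apply: Rmin; last first.
  by rewrite scale_poly_eq0 negb_or gN0 mulf_neq0.
move=> A x c Xx; set v := pt _ _ _; rewrite evZ hornerZ mevalM.
have [->|av] := eqVneq a.@[v 0] 0; first by rewrite !mul0r.
have [->|lv] := eqVneq (lead_coef mu).@[v 0] 0; first by rewrite mulr0 mul0r.
rewrite (root_cofactor_gcd_deriv (p := ev v mu) (f := ev v f) (h := ev v h) av).
- by rewrite mulr0.
- apply: contraNneq lv => m0.
  have -> : (lead_coef mu).@[v 0] = (ev v mu)`_(size mu).-1.
    by rewrite /ev coef_map.
  by rewrite m0 coef0.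
- by rewrite -evZ gE evM.
- by rewrite -ev_deriv -evZ hE evM.
- exact: Rmu.
Qed.

(** [G] at the point with coordinates -(dmu/dc_j) / (dmu/dT), multiplied by a power of dmu/dT large
    enough for all terms to be polynomial. *)
Definition clear_denom (G : {mpoly C[n]}) : {poly MP} :=
  \sum_(m <- msupp G) (G@_m)%:MP%:P * (\prod_j (- dcoef j mu) ^+ m j) *
     mu^`() ^+ (msize G - mdeg m).

Lemma clear_denomE (G : {mpoly C[n]}) v t (x : 'rV[C]_n) :
  (forall j, (ev v (dcoef j mu)).[t] = - (x 0 j * (ev v mu^`()).[t])) ->
  (ev v (clear_denom G)).[t] = (ev v mu^`()).[t] ^+ msize G * G.@[x 0].
Proof.
move=> H; rewrite /clear_denom ev_sum horner_sum mevalE mulr_sumr.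
apply: eq_big_seq => m mG; rewrite !evM !hornerM evC hornerC mevalC.
rewrite ev_prod horner_prod ev_exp horner_exp.
under eq_bigr do rewrite ev_exp horner_exp evN hornerN H opprK exprMn.
rewrite big_split /= prodrXr -mdegE; set w := (ev v mu^`()).[t].
have -> : w ^+ msize G = w ^+ (msize G - mdeg m) * w ^+ mdeg m.
  by rewrite -exprD subnK // ltnW // msize_mdeg_lt.
move: (w ^+ (msize G - mdeg m)) (w ^+ mdeg m) (\prod_i _) (G@_m) => a b d e.
ring.
Qed.

Variable Fs : seq {mpoly C[n]}.
Hypothesis XE : forall x, X x <-> forall G, G \in Fs -> G.@[x 0] = 0.

(** A relation is a multiple of [mu] up to a power of the leading coefficient. Hence an identity
    verified only on X holds at every root of [mu], before any point of X is known to lie over that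
    root. *)
Lemma Rel_vanish (P : {poly MP}) A b c t : Rel X P ->
  let v := pt A b c in (lead_coef mu).@[v 0] != 0 -> (ev v mu).[t] = 0 ->
  (ev v P).[t] = 0.
Proof.
move=> RP v lv mt; have [e [Q E]] := Rel_pseudo_division RP.
have := congr1 (fun p => (ev v p).[t]) E; rewrite evZ evM hornerZ hornerM mt.
by move/eqP; rewrite mulr0 mulf_eq0 rmorphXn /= expf_eq0 (negPf lv) andbF => /eqP.
Qed.

(** Three relations, read at a root t, say that [xi t] lies on X, that it satisfies x A = b, and
    that its form x c equals t. So [xi] and x |-> x c are inverse bijections between the D roots and
    the fibre. *)
Lemma fibre_card A b c u w a : u * mu + w * mu^`() = a%:P ->
  let v := pt A b c in (lead_coef mu).@[v 0] != 0 -> a.@[v 0] != 0 ->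
  (X `&` affine_space A b #= `I_D)%card.
Proof.
move=> Ebez v lv av; pose p := ev v mu.
have pbez : ev v u * p + ev v w * p^`() = (a.@[v 0])%:P.
  by rewrite /p -ev_deriv -!evM -evD Ebez evC.
have szp : size p = D.+1.
  by rewrite /p /ev size_map_poly_id0 //= szmu.
have [s /andP[us /eqP szs] sE] := separable_roots szp av pbez.
have dN0 t : p.[t] = 0 -> (ev v mu^`()).[t] != 0.
  move=> pt0; apply: contraNneq av => d0.
  have := congr1 (fun q => q.[t]) pbez.
  by rewrite /= hornerD !hornerM pt0 -ev_deriv d0 !mulr0 addr0 hornerC => <-.
pose xi t : 'rV[C]_n :=
  \row_j (- (ev v (dcoef j mu)).[t] / (ev v mu^`()).[t]).
have xiE t j : p.[t] = 0 ->
    (ev v (dcoef j mu)).[t] = - (xi t 0 j * (ev v mu^`()).[t]).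
  by move=> pt0; rewrite mxE mulfVK ?dN0 // opprK.
have xiX t : p.[t] = 0 -> X (xi t).
  move=> pt0; apply/XE => G GF.
  have RG : Rel X (clear_denom G).
    move=> A' x' c' Xx'; rewrite (@clear_denomE _ _ _ x') ?(XE x').1 ?mulr0 //.
    by move=> j; rewrite (Rel_dcoef _ _ _ Rmu Xx').
  have := Rel_vanish RG lv pt0; rewrite (@clear_denomE _ _ _ (xi t)).
    by move/eqP; rewrite mulf_eq0 expf_eq0 (negPf (dN0 t pt0)) andbF => /eqP.
  by move=> j; apply: xiE.
have xiA t : p.[t] = 0 -> xi t *m A = b.
  move=> pt0; apply/rowP => l.
  pose Q : {poly MP} := \sum_j (- dcoef j mu) * ('X_(idxA j l))%:P
                      - ('X_(idxb n l))%:P * mu^`().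
  have QE v' t' : (ev v' Q).[t'] =
      \sum_j (- (ev v' (dcoef j mu)).[t'] * v' 0 (idxA j l))
      - v' 0 (idxb n l) * (ev v' mu^`()).[t'].
    rewrite /Q evD evN hornerD hornerN ev_sum horner_sum evM evC hornerM hornerC.
    rewrite mevalXU; congr (_ - _); apply: eq_bigr => j _.
    by rewrite evM evN evC hornerM hornerN hornerC mevalXU.
  have RQ : Rel X Q.
    move=> A' x' c' Xx'; rewrite QE ptb [(x' *m A') 0 l]mxE mulr_suml.
    apply/eqP; rewrite subr_eq0; apply/eqP; apply: eq_bigr => j _.
    by rewrite (Rel_dcoef _ _ _ Rmu Xx') ptA opprK; ring.
  have := Rel_vanish RQ lv pt0; rewrite QE ptb => /eqP.
  rewrite subr_eq0 => /eqP H; apply: (mulIf (dN0 t pt0)); rewrite -H.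
  rewrite mxE mulr_suml; apply: eq_bigr => j _.
  by rewrite xiE // ptA opprK mulrAC.
have xiT t : p.[t] = 0 -> (xi t *m c^T) 0 0 = t.
  move=> pt0.
  pose Q : {poly MP} := \sum_j (- dcoef j mu) * ('X_(idxc N j))%:P - 'X * mu^`().
  have QE v' t' : (ev v' Q).[t'] =
      \sum_j (- (ev v' (dcoef j mu)).[t'] * v' 0 (idxc N j))
      - t' * (ev v' mu^`()).[t'].
    rewrite /Q evD evN hornerD hornerN ev_sum horner_sum evM evX hornerM hornerX.
    congr (_ - _); apply: eq_bigr => j _.
    by rewrite evM evN evC hornerM hornerN hornerC mevalXU.
  have RQ : Rel X Q.
    move=> A' x' c' Xx'; rewrite QE.
    have {2}-> : (x' *m c'^T) 0 0 = \sum_j x' 0 j * c' 0 j.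
      by rewrite mxE; under eq_bigr do rewrite mxE.
    rewrite mulr_suml.
    apply/eqP; rewrite subr_eq0; apply/eqP; apply: eq_bigr => j _.
    by rewrite (Rel_dcoef _ _ _ Rmu Xx') ptc opprK; ring.
  have := Rel_vanish RQ lv pt0; rewrite QE => /eqP.
  rewrite subr_eq0 => /eqP H; apply: (mulIf (dN0 t pt0)); rewrite -H.
  rewrite mxE mulr_suml; apply: eq_bigr => j _.
  by rewrite xiE // ptc opprK [c^T _ _]mxE mulrAC.
have sroot i : (i < D)%N -> p.[s`_i] = 0.
  by move=> iD; apply/rootP; rewrite sE mem_nth // szs.
have -> : (X `&` affine_space A b = (fun i => xi s`_i) @` `I_D)%classic.
  apply/seteqP; split => [x [Xx Ax]|x [i /sroot pi <-]]; last first.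
    by split; [exact: xiX|exact: xiA].
  have pt0 : p.[(x *m c^T) 0 0] = 0 by rewrite /p /v -[b]Ax; exact: Rmu.
  have : (x *m c^T) 0 0 \in s by rewrite -sE; apply/rootP.
  move=> ts; have iE := nth_index 0 ts; rewrite -index_mem szs in ts.
  exists (index ((x *m c^T) 0 0) s) => //; rewrite iE.
  apply/rowP => j; apply: (mulIf (dN0 _ pt0)); apply: oppr_inj.
  by rewrite -xiE // /v -[b]Ax (Rel_dcoef _ _ _ Rmu Xx).
apply: inj_card_eq => i j; rewrite !inE => iD jD /(congr1 (fun x => (x *m c^T) 0 0)).
rewrite !xiT ?sroot // => /eqP; rewrite nth_uniq ?szs //; exact/eqP.
Qed.

End Fibres.

(** * Growth estimates and the existence of a relation *)

Section Growth.
Local Open Scope nat_scope.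

Lemma expn_add_bound D N : exists M, forall e, 0 < e ->
  (e + D) ^ N.+1 <= e ^ N.+1 + M * e ^ N.
Proof.
elim: N => [|N [M IH]]; first by exists D => e _; rewrite !expn1 expn0 muln1.
exists (D + M * D.+1) => e e0; rewrite expnSr.
apply: leq_trans (leq_mul (IH e e0) (leqnn _)) _.
rewrite [e ^ N.+2]expnSr; move: (IH e e0) => _.
have : e ^ N <= e ^ N.+1 by rewrite leq_pexp2l.
rewrite ![e ^ N.+1]expnSr; move: (e ^ N) => x; nia.
Qed.

Lemma bin_fact_le d N : 'C(d, N) * N`! <= d ^ N.
Proof.
rewrite bin_ffact; elim: N => [|N IHN]; first by rewrite ffactn0 expn0.
by rewrite ffactnSr expnSr leq_mul // leq_subr.
Qed.

Lemma bin_fact_ge d N : d.+1 ^ N <= 'C(d + N, N) * N`!.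
Proof.
rewrite bin_ffact; elim: N => [|N IHN]; first by rewrite ffactn0 expn0.
by rewrite addnS ffactSS expnS leq_mul // ltnS leq_addr.
Qed.

(** The right side counts the pairs of a power T^e, e <= D, and a monomial of degree at most [d - D]
    in N forms; the left side bounds the functions of degree at most [d]. The leading terms are (D +
    1) d^N / N! and D d^N / N!. *)
Lemma growth_count D K N : 0 < N -> exists2 d, D <= d &
  D * 'C(d, N) + K * d.+1 ^ N.-1 < D.+1 * 'C(d - D + N, N).
Proof.
case: N => // N _; have [M MP] := expn_add_bound D N.
(* Chosen so that the spare [e ^ N.+1] exceeds the two error terms, both multiples of [e ^ N] (this
   is [l5]). *)
pose e := (D * M + K * N.+1`! * D.+1 ^ N).+1.
exists (e.-1 + D); first exact: leq_addl.
rewrite addnK -(ltn_pmul2r (fact_gt0 N.+1)) mulnDl -!mulnA.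
have l1 : e ^ N.+1 <= 'C(e.-1 + N.+1, N.+1) * N.+1`! by apply: bin_fact_ge.
have l2 := bin_fact_le (e.-1 + D) N.+1.
have l3 : (e.-1 + D) ^ N.+1 <= e ^ N.+1 + M * e ^ N.
  by apply: leq_trans (MP e isT); rewrite leq_exp2r // leq_add2r leq_pred.
have l4 : (e.-1 + D).+1 ^ N <= D.+1 ^ N * e ^ N.
  rewrite -expnMn; case: (N) => // N'; rewrite leq_exp2r //.
  have H x : 0 < x -> (x.-1 + D).+1 <= D.+1 * x by case: x => //= x _; nia.
  exact: (H e isT).
have l5 : D * M * e ^ N + K * N.+1`! * D.+1 ^ N * e ^ N < e ^ N.+1.
  by rewrite -mulnDl expnS ltn_pmul2r ?expn_gt0.
apply: leq_ltn_trans (_ : D * (e ^ N.+1 + M * e ^ N) +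
    K * (D.+1 ^ N * e ^ N * N.+1`!) < _).
  by apply: leq_add; rewrite ?leq_mul2l ?leq_mul2r ?l4 ?orbT //=;
     rewrite (leq_trans l2 l3) orbT.
apply: leq_trans (leq_mul (leqnn D.+1) l1).
move: l5; move: (e ^ N.+1) (e ^ N) (N.+1`!) (D.+1 ^ N) => x y z w; nia.
Qed.

(** Monomials of degree at most q in e functions grow like q^e, the functions available on X only
    like q^N; this makes any e > N functions on X dependent. *)
Lemma growth_dim D K N e k : N < e -> exists q,
  D * 'C(k * q, N) + K * (k * q).+1 ^ N.-1 < 'C(e + q, e).
Proof.
move=> Ne; exists (e`! * (D + K) * k.+1 ^ N).
set q := (X in _ < 'C(_ + X, _)).
rewrite -(ltn_pmul2r (fact_gt0 e)); apply: leq_trans (_ : q.+1 ^ N.+1 <= _).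
  have l0 : k * q <= k.+1 * q.+1 by nia.
  have l1 : 'C(k * q, N) <= k.+1 ^ N * q.+1 ^ N.
    apply: leq_trans (_ : 'C(k * q, N) * N`! <= _).
      by rewrite leq_pmulr // fact_gt0.
    by apply: leq_trans (bin_fact_le _ _) _; rewrite -expnMn; case: (N) => // N';
       rewrite leq_exp2r.
  have l2 : (k * q).+1 ^ N.-1 <= k.+1 ^ N * q.+1 ^ N.
    rewrite -expnMn; apply: leq_trans (_ : (k.+1 * q.+1) ^ N.-1 <= _).
      by case: (N.-1) => // N'; rewrite leq_exp2r //; nia.
    by rewrite leq_pexp2l ?leq_pred //; case: (k) (q) => [|k'] [|q'] //=; nia.
  apply: leq_ltn_trans (_ : (D + K) * (k.+1 ^ N * q.+1 ^ N) * e`! < _).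
    by rewrite leq_mul2r mulnDl leq_add ?orbT ?leq_mul2l ?l1 ?l2 ?orbT.
  rewrite expnS (_ : (D + K) * _ * _ = q * q.+1 ^ N).
    by rewrite ltn_pmul2r // expn_gt0.
  by move: (q.+1 ^ N) => x; rewrite /q; ring.
apply: leq_trans (_ : q.+1 ^ e <= _); first by rewrite leq_pexp2l //.
by rewrite addnC; apply: bin_fact_ge.
Qed.

End Growth.

Section MsizeBounds.
Variables (R : idomainType) (n : nat).
Implicit Types p q : {mpoly R[n]}.

Lemma msizeM_bound p q a b : (msize p <= a.+1)%N -> (msize q <= b.+1)%N ->
  (msize (p * q) <= (a + b).+1)%N.
Proof.
move=> pa qb; have [->|pN0] := eqVneq p 0; first by rewrite mul0r mmeasure0.
have [->|qN0] := eqVneq q 0; first by rewrite mulr0 mmeasure0.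
rewrite msizeM //; lia.
Qed.

Lemma msizeX_bound p a e : (msize p <= a.+1)%N -> (msize (p ^+ e) <= (a * e).+1)%N.
Proof.
move=> pa; elim: e => [|e IHe]; first by rewrite expr0 msize1.
by rewrite exprS mulnS msizeM_bound.
Qed.

Lemma msize_prod_bound (I : finType) (F : I -> {mpoly R[n]}) (a : I -> nat) :
  (forall i, msize (F i) <= (a i).+1)%N ->
  (msize (\prod_i F i) <= (\sum_i a i).+1)%N.
Proof.
move=> Fa; elim/big_rec2: _ => [|i b p _ pb]; first by rewrite msize1.
by rewrite msizeM_bound.
Qed.

End MsizeBounds.

Section Existence.
Variables (C : numClosedFieldType) (n N : nat).
Local Notation k := (n * N + N + n)%N.
Local Notation MP := {mpoly C[k]}.
Variables (X : set 'rV[C]_n) (D K : nat).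
Hypothesis Xspan : forall d, exists2 S, spanned X d S &
  (size S <= D * 'C(d, N) + K * d.+1 ^ N.-1)%N.

Lemma has_dim_upper e (f : 'I_e -> {mpoly C[n]}) : alg_indep_on X f -> (e <= N)%N.
Proof.
move=> fI; rewrite leqNgt; apply/negP => Ne.
pose d := \max_i msize (f i).
have fd i : (msize (f i) <= d.+1)%N by apply: leqW; apply: (leq_bigmax i).
have [q qP] := growth_dim D K d Ne; have [S Ssp szS] := Xspan (d * q).
pose T : finType := 'X_{1..e < q.+1}.
pose G (t : 'I_#|{: T}|) : {mpoly C[n]} := \prod_i f i ^+ (val (enum_val t) i).
have [||z zN0 zE] := linear_relation (idfun : {rmorphism C -> C}) (G := G) Ssp.
- move=> t; apply: leq_trans (msize_prod_bound (fun i => msizeX_bound _ (fd i))) _.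
  by rewrite ltnS -big_distrr /= leq_mul2l -mdegE -ltnS bmdeg orbT.
- by rewrite card_bmnm (leq_ltn_trans szS).
pose P : {mpoly C[e]} := \sum_(m : T) z 0 (enum_rank m) *: 'X_[m].
have P0 : P = 0.
  apply: fI => x Xx; rewrite -[RHS](zE idfun _ x Xx) // /P raddf_sum /=.
  rewrite (reindex (@enum_val T predT)) /=; last first.
    by exists enum_rank => t _; rewrite ?enum_valK ?enum_rankK.
  apply: eq_bigr => t _; rewrite enum_valK mevalZ mevalX; congr (_ * _).
  by rewrite -[RHS]/((G t).@[x 0]) /G rmorph_prod; apply: eq_bigr => i _;
     rewrite rmorphXn.
move: zN0; apply/negP/negPn/eqP/rowP => t; rewrite !mxE.
have : P@_(enum_val t) = 0 by rewrite P0 mcoeff0.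
rewrite /P raddf_sum /= (bigD1 (enum_val t)) //= mcoeffZ mcoeffX eqxx mulr1.
rewrite enum_valK big1 ?addr0 // => m mt.
rewrite mcoeffZ mcoeffX; case: eqP => [/val_inj E|]; rewrite ?mulr0 //.
by rewrite E eqxx in mt.
Qed.

Lemma exists_Rel : (0 < N)%N ->
  exists2 mu : {poly MP}, mu != 0 & Rel X mu /\ (size mu <= D.+1)%N.
Proof.
move=> N0; have [d Dd dP] := growth_count D K N0; have [S Ssp szS] := Xspan d.
pose T : finType := ('I_D.+1 * 'X_{1..N < (d - D).+1})%type.
pose Y j : {mpoly MP[n]} := \sum_i 'X_(idxA i j) *: 'X_i.
pose Th : {mpoly MP[n]} := \sum_i 'X_(idxc N i) *: 'X_i.
pose G (t : 'I_#|{: T}|) : {mpoly MP[n]} :=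
  (\prod_j Y j ^+ (val (enum_val t).2 j)) * Th ^+ (enum_val t).1.
have lin1 (a : 'I_n -> MP) : (msize (\sum_i a i *: 'X_i : {mpoly MP[n]}) <= 2)%N.
  apply: leq_trans (msize_sum _ _ _) _; apply/bigmax_leqP => i _.
  by apply: leq_trans (mmeasureZ_le _ _ _) _; rewrite msizeX mdeg1.
have [||z zN0 zE] := linear_relation (@mpolyC k C : {rmorphism C -> MP}) (G := G) Ssp.
- move=> t; rewrite /G.
  have l1 := msize_prod_bound (fun j => msizeX_bound (val (enum_val t).2 j) (lin1 (fun i => 'X_(idxA i j)))).
  have l2 := msizeX_bound (enum_val t).1 (lin1 (fun i => 'X_(idxc N i))).
  apply: leq_trans (msizeM_bound l1 l2) _.
  under eq_bigr do rewrite mul1n; rewrite -mdegE mul1n.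
  have h1 : (mdeg (val (enum_val t).2) < (d - D).+1)%N := bmdeg _.
  have h2 : ((enum_val t).1 < D.+1)%N := ltn_ord _.
  by move: (mdeg _) (nat_of_ord _) h1 h2 => x y; lia.
- by rewrite card_prod card_ord card_bmnm addnC (leq_ltn_trans szS).
have [t0 zt0] : exists t, z 0 t != 0 by apply/rV0Pn.
have [v0 zv0] := mpoly_nonvanishing zt0.
have [A0 [b0 [c0 v0E]]] := ptE v0.
(* The kernel entries may involve b as well. Freezing it at [b0] leaves b in [mu] only through the
   monomials b^m, whose independence then shows [mu != 0]. *)
have /choice[z' z'E] : forall t, exists Q : MP, forall A b c,
    Q.@[pt A b c 0] = (z 0 t).@[pt A b0 c 0].
  move=> t; pose g (v : 'rV[C]_k) : 'rV[C]_k :=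
    pt (vec_mx (lsubmx (lsubmx v))) b0 (rsubmx v).
  have [j|Q QE] := polyfun_comp (g := g) (polyfun_meval (z 0 t)).
    case: (split_ordP j) => i ->.
      case: (split_ordP i) => l ->.
        apply: eq_polyfun (polyfun_coord _ (lshift n (lshift N l))) => v.
        by rewrite /g /pt !row_mxEl vec_mxK !mxE.
      apply: eq_polyfun (polyfun_cst _ (b0 0 l)) => v.
      by rewrite /g /pt row_mxEl row_mxEr.
    apply: eq_polyfun (polyfun_coord _ (rshift (n * N + N) i)) => v.
    by rewrite /g /pt row_mxEr mxE.
  exists Q => A b c; rewrite -QE /g /pt !row_mxKl row_mxKr mxvecK //.
pose mu : {poly MP} := \poly_(e < D.+1)
  \sum_(m : 'X_{1..N < (d - D).+1})
     z' (enum_rank ((inord e, m) : T)) * \prod_j 'X_(idxb n j) ^+ (val m j).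
have muE A b c : ev (pt A b c) mu = \poly_(e < D.+1)
  \sum_(m : 'X_{1..N < (d - D).+1})
     (z 0 (enum_rank ((inord e, m) : T))).@[pt A b0 c 0] * \prod_j b 0 j ^+ (val m j).
  apply/polyP => e; rewrite /ev coef_map /mu !coef_poly; case: ifP => _ /=; last exact: meval0.
  rewrite raddf_sum /=; apply: eq_bigr => m _; rewrite mevalM z'E; congr (_ * _).
  by rewrite rmorph_prod /=; apply: eq_bigr => j _; rewrite rmorphXn /= mevalXU ptb.
exists mu; last first.
  split; last exact: size_poly.
  move=> A x c Xx; rewrite muE horner_poly.
  rewrite -[RHS](zE (meval (pt A b0 c 0)) (@mevalC _ _ _) x Xx).
  rewrite (reindex (@enum_rank T)) /=; last first.
    by exists enum_val => t _; rewrite ?enum_rankK ?enum_valK.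
  transitivity (\sum_(e < D.+1) \sum_m (z 0 (enum_rank ((e, m) : T))).@[pt A b0 c 0]
      * mmap (meval (pt A b0 c 0)) (x 0) (G (enum_rank ((e, m) : T)))); last first.
    by rewrite pair_bigA /=; apply: eq_bigr => -[e m] _.
  apply: eq_bigr => e _; rewrite mulr_suml; apply: eq_bigr => m _.
  rewrite inord_val -mulrA; congr (_ * _); rewrite /G enum_rankK /=.
  have lin (ix : 'I_n -> 'I_k) (y : 'I_n -> C) :
      (forall i, pt A b0 c 0 (ix i) = y i) ->
      mmap (meval (pt A b0 c 0)) (x 0) (\sum_i 'X_(ix i) *: 'X_i) = \sum_i x 0 i * y i.
    move=> ixE; rewrite raddf_sum /=; apply: eq_bigr => i _.
    by rewrite mmapZ mmapX mmap1U /= mevalXU ixE mulrC.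
  rewrite rmorphM rmorphXn rmorph_prod /= (lin _ (c 0)) => [|i]; last exact: ptc.
  congr (_ * _ ^+ _); last by rewrite mxE; apply: eq_bigr => i _; rewrite mxE.
  apply: eq_bigr => j _; rewrite rmorphXn /= (lin _ (A^~ j)) => [|i]; last exact: ptA.
  by rewrite mxE.
case: (enum_val t0) (enum_valK t0) => e0 m0 t0E.
pose q : {mpoly C[N]} := \sum_(m : 'X_{1..N < (d - D).+1})
  (z 0 (enum_rank ((e0, m) : T))).@[v0 0] *: 'X_[m].
have qN0 : q != 0.
  apply/eqP => /(congr1 (mcoeff m0)); rewrite mcoeff0 /q raddf_sum /=.
  rewrite (bigD1 m0) //= mcoeffZ mcoeffX eqxx mulr1 t0E big1 ?addr0; first exact/eqP.
  move=> m mm; rewrite mcoeffZ mcoeffX; case: eqP => [/val_inj E|]; rewrite ?mulr0 //.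
  by rewrite E eqxx in mm.
have [y yq] := mpoly_nonvanishing qN0.
apply: contraNneq yq => mu0.
have := muE A0 y c0; rewrite mu0 /ev map_poly0 => /(congr1 (fun p : {poly C} => p`_e0)).
rewrite /= coef0 coef_poly ltn_ord /q raddf_sum /= => E0; apply/eqP; rewrite [RHS]E0.
apply: eq_bigr => m _; rewrite inord_val mevalZ mevalX v0E //.
Qed.

End Existence.

Section Degree.
Variables (C : numClosedFieldType) (n N : nat).
Local Notation k := (n * N + N + n)%N.
Local Notation MP := {mpoly C[k]}.
Variables (X : set 'rV[C]_n) (D K : nat).

Theorem has_degree_of_hilbert_bounds (Fs : seq {mpoly C[n]}) :
  (0 < N <= n)%N -> (0 < D)%N ->
  (forall x, X x <-> forall G, G \in Fs -> G.@[x 0] = 0) ->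
  (forall d, exists2 S, spanned X d S &
     (size S <= D * 'C(d, N) + K * d.+1 ^ N.-1)%N) ->
  (exists f : 'I_N -> {mpoly C[n]}, alg_indep_on X f) ->
  (forall P : {poly MP}, Rel X P -> P != 0 -> (D < size P)%N) ->
  has_degree X D.
Proof.
move=> /andP[N0 Nn] D0 XE Xspan Xind Rmin; exists N.
  by split=> [//|e f fI]; exact: (has_dim_upper Xspan fI).
have [mu muN0 [Rmu szmu]] := exists_Rel Xspan N0.
have {}szmu : size mu = D.+1 by apply/eqP; rewrite eqn_leq szmu Rmin.
have [u [w [a aN0 E]]] := coprime_mu_deriv Rmin Rmu szmu.
have lN0 : lead_coef mu != 0 by rewrite lead_coef_eq0.
(* Genericity concerns A and b only, so c is fixed at a value [c0] for which the leading coefficient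
   and the Bezout constant do not vanish identically in A and b. *)
have [v0 v0P] := mpoly_nonvanishing (mulf_neq0 lN0 aN0).
have [A0 [b0 [c0 v0E]]] := ptE v0.
pose A (p : 'rV[C]_(n * N + N)) : 'M[C]_(n, N) := vec_mx (lsubmx p).
pose f1 p := (lead_coef mu * a).@[pt (A p) (rsubmx p) c0 0].
pose minor p := \det (rowsub (widen_ord Nn) (A p)).
have pA i j : polyfun (fun p => A p i j).
  apply: (eq_polyfun (f := fun p : 'rV_(n * N + N) => p 0 (lshift N (mxvec_index i j)))).
    by move=> p; rewrite /A !mxE.
  exact: polyfun_coord.
have pf1 : polyfun f1.
  apply: (@polyfun_comp _ _ _ (fun v => (lead_coef mu * a).@[v 0])
                         (fun p => pt (A p) (rsubmx p) c0)).
    exact: polyfun_meval.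
  move=> j.
  case: (split_ordP j) => i ->.
    apply: eq_polyfun (polyfun_coord _ i) => p.
    by rewrite /pt /A vec_mxK hsubmxK row_mxEl.
  apply: eq_polyfun (polyfun_cst _ (c0 0 i)) => p.
  by rewrite /pt row_mxEr.
have pmin : polyfun minor.
  apply: polyfun_det => i j.
  by apply: (eq_polyfun (f := fun p => A p (widen_ord Nn i) j)) => // p; rewrite /minor !mxE.
have [P1 P1E] := pf1; have [P2 P2E] := pmin.
exists (P1 * P2).
  apply: mulf_neq0.
    apply: contraNneq v0P => P10; rewrite v0E.
    have <- : f1 (row_mx (mxvec A0) b0) = (lead_coef mu * a).@[pt A0 b0 c0 0].
      by rewrite /f1 /A row_mxKl row_mxKr mxvecK.
    by rewrite P1E P10 meval0.
  apply/eqP => P20.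
  have := P2E (row_mx (mxvec (pid_mx N)) 0); rewrite P20 meval0 /minor /A.
  rewrite row_mxKl mxvecK (_ : rowsub _ _ = 1%:M) ?det1; first by move/eqP; rewrite oner_eq0.
  apply/matrixP => i j; rewrite !mxE /= ltn_ord andbT //.
move=> p; rewrite mevalM mulf_eq0 negb_or -P1E -P2E => /andP[].
rewrite /f1 mevalM mulf_eq0 negb_or => /andP[lv av] mp; split.
  apply/eqP; rewrite eqn_leq rank_leq_col /=.
  have := mxrank_unit (A := rowsub (widen_ord Nn) (A p)); rewrite unitmxE unitfE.
  move=> /(_ mp) {1}<-; exact: mxrankS (rowsub_sub _ _).
exact: (fibre_card Rmin Rmu szmu XE E lv av).
Qed.

End Degree.

(** * Families of disjoint lattice paths *)

Section ChoiceLists.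
Variable T : eqType.
Implicit Types (ls : seq (seq T)) (x : seq T).

Fixpoint choices ls : seq (seq T) :=
  if ls is l :: ls' then [seq y :: t | y <- l, t <- choices ls'] else [:: [::]].

Lemma choices_uniq ls : all uniq ls -> uniq (choices ls).
Proof.
elim: ls => //= l ls IH /andP[ul /IH uls].
by apply: allpairs_uniq => // -[a b] [c d] _ _ /= [-> ->].
Qed.

Lemma mem_choices (x0 : T) ls x : reflect
  (size x = size ls /\ forall j, (j < size ls)%N -> nth x0 x j \in nth [::] ls j)
  (x \in choices ls).
Proof.
elim: ls x => [|l ls IH] x /=.
  rewrite inE; apply: (iffP eqP) => [->|[/size0nil]] //; split=> //.
apply: (iffP allpairsP) => [[[y t] /= [yl /IH[st tP] ->]]|[]].
  by split=> [|[|j]] /=; rewrite ?st // => /tP.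
case: x => // y t [st] H; exists (y, t); split=> //=; first exact: (H 0).
by apply/IH; split=> // j jl; apply: (H j.+1).
Qed.

Lemma sum_choices (R : comPzRingType) (x0 : T) ls (g : nat -> T -> R) :
  \sum_(x <- choices ls) \prod_(j < size ls) g j (nth x0 x j) =
  \prod_(j < size ls) \sum_(y <- nth [::] ls j) g j y.
Proof.
elim: ls g => [|l ls IH] g /=; first by rewrite big_seq1 !big_ord0.
rewrite big_allpairs_dep big_ord_recl /= mulr_suml; apply: eq_bigr => y _.
rewrite -(IH (fun j => g j.+1)) mulr_sumr; apply: eq_bigr => t _.
by rewrite big_ord_recl.
Qed.

End ChoiceLists.

(** Multilinearity in the columns, the j-th one ranging over the j-th list. *)
Lemma det_sum_choices (R : comPzRingType) (T : eqType) (x0 : T) (ls : seq (seq T)) m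
    (f : nat -> T -> R) : size ls = m ->
  \sum_(x <- choices ls) \det (\matrix_(i < m, j < m) f i (nth x0 x j)) =
  \det (\matrix_(i < m, j < m) \sum_(y <- nth [::] ls j) f i y).
Proof.
move=> <-; rewrite -det_tr [RHS]/determinant.
transitivity (\sum_(x <- choices ls) \sum_(s : 'S_(size ls))
    (-1) ^+ s * \prod_(j < size ls) f (s j) (nth x0 x j)).
  apply: eq_bigr => x _; rewrite -det_tr; apply: eq_bigr => s _; congr (_ * _).
  by apply: eq_bigr => j _; rewrite !mxE.
rewrite exchange_big /=; apply: eq_bigr => s _; rewrite -mulr_sumr; congr (_ * _).
pose g (j : nat) y := f (if insub j is Some o then s o : nat else 0%N) y.
have gE (j : 'I_(size ls)) y : g j y = f (s j) y by rewrite /g valK.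
under [RHS]eq_bigr => j _ do [rewrite !mxE; under eq_bigr do rewrite -gE].
rewrite -(sum_choices x0); apply: eq_bigr => x _.
by apply: eq_bigr => j _; rewrite gE.
Qed.

(* Right multiplication by it takes partial sums of columns from the right. *)
Definition ones_trig (R : pzRingType) m : 'M[R]_m :=
  \matrix_(i, j) ((j <= i)%N)%:R.

Lemma det_ones_trig (R : comPzRingType) m : \det (ones_trig R m) = 1.
Proof.
rewrite det_trig; first by rewrite big1 // => i _; rewrite mxE leqnn.
by apply/is_trig_mxP => i j ij; rewrite mxE leqNgt ij.
Qed.

(** * A determinant for families of paths, row by row *)

Section PathCount.
Variable q : nat.

(** Lattice paths from the cell (2i, q - 1) that leave row k - 1 through column c: k - 1 - 2i steps
    down and q - 1 - c steps to the left. The value 0 from column q on closes the telescoping sums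
    at the right edge. *)
Definition npaths k i c : int :=
  if (c < q)%N then ('C((k - (2 * i).+1) + (q.-1 - c), k - (2 * i).+1))%:Z else 0.

Lemma npaths_top k i : npaths k i q = 0.
Proof. by rewrite /npaths ltnn. Qed.

Lemma npaths_start i c : (c < q)%N -> npaths (2 * i).+1 i c = 1.
Proof. by move=> cq; rewrite /npaths cq subnn bin0. Qed.

Lemma npathsS k i y : (2 * i < k)%N -> (y < q)%N ->
  npaths k.+1 i y = npaths k i y + npaths k.+1 i y.+1.
Proof.
move=> ik yq; rewrite /npaths yq subSn //; set a := (k - _)%N.
case: ltnP => [y1q|qy].
  have -> : (q.-1 - y = (q.-1 - y.+1).+1)%N by lia.
  by rewrite addSn addnS binS PoszD addrC !addSn addnC.
have -> : (q.-1 - y = 0)%N by lia.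
by rewrite !addn0 !binn addr0.
Qed.

Lemma npaths_sum k i a b : (2 * i < k)%N -> (a <= b <= q)%N ->
  \sum_(y <- iota a (b - a)) npaths k i y = npaths k.+1 i a - npaths k.+1 i b.
Proof.
move=> ik /andP[ab bq]; rewrite -{2}(subnKC ab).
have: (a + (b - a) <= q)%N by lia.
elim: (b - a)%N => [|d IH] adq; first by rewrite big_nil addn0 subrr.
rewrite -addn1 iotaD big_cat /= big_seq1 IH; last by lia.
by rewrite [in RHS]addn1 addnS (@npathsS k i (a + d)); [ring|lia|lia].
Qed.

(** Half-open intervals between consecutive exit columns: a path that enters the row within its own
    interval stops short of the next path, which is disjointness in that row. *)
Definition ranges (u : seq nat) : seq (seq nat) :=
  [seq iota (nth 0 u j) (nth 0 u j.+1 - nth 0 u j) | j <- iota 0 (size u).-1]%N.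

(* [families k s] lists the systems of disjoint lattice paths in the rows
   0, ..., k - 1: a new path enters at the right end of each even row, and s
   records the columns through which the paths leave row k - 1. *)
Fixpoint families k (s : seq nat) : seq (seq (seq nat)) :=
  if k is k'.+1 then
    [seq rcons t s | s' <- choices (ranges (if odd k' then rcons s q else s)),
                     t <- families k' s']
  else [:: [:: [::]]].

Definition nact k := (k.+1)./2.

(** Induction on the rows. Summing over the columns of entry gives, by multilinearity and
    [npaths_sum], differences of consecutive columns, which multiplication by [ones_trig] undoes. If
    a new path enters, the determinant is first bordered, and the border becomes the row of ones
    given by [npaths_start]. *)
Lemma size_families k s : sorted leq s -> size s = nact k -> all (ltn^~ q) s ->
  (size (families k s))%:Z =
  \det (\matrix_(i < nact k, j < nact k) npaths k i (nth 0%N s j)).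
Proof.
elim: k s => [|k IH] s ss szs sq.
  by rewrite /= det_mx00.
set u := if odd k then rcons s q else s.
have szu : size u = (nact k).+1.
  rewrite /u; case: ifP => ok; rewrite ?size_rcons szs /nact /=; lia.
have su : sorted leq u.
  rewrite /u; case: ifP => // _; case: (s) ss sq => //= a s' pa /andP[aq s'q].
  rewrite rcons_path pa /=; have /allP := s'q; have := mem_last a s'.
  by rewrite inE => /predU1P[-> _|ls H]; apply: ltnW => //; exact: (H _ ls).
have uq j : (j <= nact k)%N -> (nth 0 u j <= q)%N.
  move=> jk; have : nth 0%N u j \in u by rewrite mem_nth // szu.
  rewrite /u; case: ifP => _; last by move/(allP sq)/ltnW.
  by rewrite mem_rcons inE => /predU1P[->//|/(allP sq)/ltnW].
have uS j : (j < nact k)%N -> (nth 0 u j <= nth 0 u j.+1)%N.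
  by move=> jk; apply: (sortedP 0%N su); rewrite szu.
have szr : size (ranges u) = nact k by rewrite size_map size_iota szu.
have rE j : (j < nact k)%N ->
    nth [::] (ranges u) j = iota (nth 0%N u j) (nth 0 u j.+1 - nth 0 u j)%N.
  move=> jk; have jk' : (j < (size u).-1)%N by rewrite szu.
  by rewrite (nth_map 0%N) ?size_iota // nth_iota // add0n.
have -> : (size (families k.+1 s))%:Z =
    \det (\matrix_(i < nact k, j < nact k)
       (npaths k.+1 i (nth 0%N u j) - npaths k.+1 i (nth 0%N u j.+1))).
  rewrite /= size_allpairs_dep -/u sumnE big_map.
  transitivity (\sum_(x <- choices (ranges u))
      \det (\matrix_(i < nact k, j < nact k) npaths k i (nth 0%N x j))).
    rewrite (big_morph Posz PoszD (erefl _)).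
    apply: eq_big_seq => x /(mem_choices 0%N)[]; rewrite szr => szx xP.
    have xr j : (j < nact k)%N -> (nth 0 u j <= nth 0 x j < nth 0 u j.+1)%N.
      by move=> jk; have := xP j jk; rewrite rE // mem_iota subnKC // uS.
    apply: IH => //.
      apply/(sortedP 0%N) => j; rewrite szx => jk.
      have := xr j (ltnW jk); have := xr j.+1 jk; lia.
    apply/(all_nthP 0%N) => j; rewrite szx => jk.
    by have := xr j jk; have := uq j.+1 jk; rewrite /=; lia.
  rewrite (det_sum_choices 0%N (fun i y => npaths k i y) szr).
  congr (\det _); apply/matrixP => i j; rewrite !mxE rE //.
  rewrite npaths_sum ?uS ?uq //.
  by have := ltn_ord i; rewrite /nact; lia.
set Phi := \matrix_(i, j) _.
have teleN (f : nat -> int) m j : (j <= m)%N ->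
    \sum_(j <= l < m) (f l - f l.+1) = f j - f m.
  move=> jm; transitivity (- \sum_(j <= l < m) (f l.+1 - f l)).
    by rewrite -sumrN; apply: eq_bigr => l _; rewrite opprB.
  by rewrite (telescope_sumr f jm) opprB.
have sumT m (g : nat -> int) (j : nat) : (j <= m)%N ->
    \sum_(l < m) g l * ((j <= l)%N)%:R = \sum_(j <= l < m) g l.
  move=> jm; rewrite (big_nat_widenl _ 0) // big_mkord [RHS]big_mkcond /=.
  by apply: eq_bigr => l _; case: (j <= l)%N; rewrite ?mulr1 ?mulr0.
have [ok|ek] := boolP (odd k).
  have E : nact k.+1 = nact k by rewrite /nact; lia.
  have uE j : (j < nact k)%N -> nth 0%N u j = nth 0%N s j.
    by move=> jk; rewrite /u ok nth_rcons szs E jk.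
  rewrite E -[LHS]mulr1 -(det_ones_trig _ (nact k)) -det_mulmx; congr (\det _).
  apply/matrixP => i j; rewrite !mxE; under eq_bigr do rewrite !mxE.
  rewrite (sumT _ (fun l => npaths k.+1 i (nth 0%N u l) - npaths k.+1 i (nth 0%N u l.+1))).
    rewrite (teleN (fun l => npaths k.+1 i (nth 0%N u l))); last exact: ltnW.
    rewrite uE // /u ok nth_rcons szs E ltnn eqxx npaths_top subr0 //.
  exact: ltnW.
have E : nact k.+1 = (nact k + 1)%N by rewrite /nact; lia.
have uE : u = s by rewrite /u (negPf ek).
pose y := \col_(i < nact k) npaths k.+1 i (nth 0%N s (nact k)).
have -> : \det Phi = \det (block_mx Phi y 0 (1%:M : 'M_1)) by rewrite det_ublock det1 mulr1.
rewrite E; transitivity (\det (block_mx Phi y 0 (1%:M : 'M_1)) *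
    \det (ones_trig int (nact k + 1))); first by rewrite det_ones_trig mulr1.
rewrite -det_mulmx; congr (\det _).
apply/matrixP => i j; rewrite [RHS]mxE mxE big_split_ord /= big_ord1.
case: (split_ordP i) => i' ->.
  under eq_bigr do rewrite block_mxEul !mxE /=.
  have jk : (j <= nact k)%N by have := ltn_ord j; lia.
  rewrite block_mxEur !mxE /= addn0 jk mulr1.
  rewrite (sumT _ (fun l => npaths k.+1 i' (nth 0%N u l) - npaths k.+1 i' (nth 0%N u l.+1))) //.
  by rewrite (teleN (fun l => npaths k.+1 i' (nth 0%N u l))) // uE subrK.
rewrite big1; last by move=> l _; rewrite block_mxEdl mxE mul0r.
have jk : (j <= nact k)%N by have := ltn_ord j; lia.
rewrite block_mxEdr !mxE ord1 eqxx /= addn0 jk mulr1 add0r.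
have -> : k.+1 = (2 * nact k).+1 by rewrite /nact; lia.
have sj : nth 0%N s j \in s by rewrite mem_nth // szs; lia.
by rewrite npaths_start //; move: sj => /(allP sq).
Qed.

End PathCount.

(** * Path systems as column functions *)

Section PathSystems.
Local Open Scope nat_scope.
Variables r : nat.
Local Notation q := (2 * r).

(* C l i is the column in which the l-th path enters row i from above (i < q),
   so that it occupies the columns C l i.+1, ..., C l i of row i; it starts in
   the cell (2 l, q - 1) and ends in the cell (q - 1, 2 l). *)
Record path_system (C : nat -> nat -> nat) : Prop := PathSystem {
  path_bound : forall l i, l < r -> i <= q -> C l i < q;
  path_inactive : forall l i, l < r -> i <= 2 * l -> C l i = q.-1;
  path_desc : forall l i, l < r -> 2 * l <= i < q -> C l i.+1 <= C l i;
  path_sep : forall l i, l.+1 < r -> 2 * l.+1 <= i < q -> C l i < C l.+1 i.+1;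
  path_end : forall l, l < r -> C l q = 2 * l }.

Definition on_path (C : nat -> nat -> nat) l i j :=
  (2 * l <= i) && (C l i.+1 <= j <= C l i).

Definition on_paths C i j := has (fun l => on_path C l i j) (iota 0 r).

Lemma on_pathsP C i j :
  reflect (exists2 l, l < r & on_path C l i j) (on_paths C i j).
Proof.
apply: (iffP hasP) => [[l]|[l lr lP]].
  by rewrite mem_iota => /andP[_ lr] lP; exists l.
by exists l => //; rewrite mem_iota.
Qed.

Lemma path_lt C l l' i : path_system C -> l < l' < r -> 2 * l' <= i < q ->
  C l i < C l' i.+1.
Proof.
move=> PC /andP[ll' l'r] iP.
have : exists d, l' = l + d.+1 by exists (l' - l.+1); lia.
case=> d dE; rewrite {}dE {ll'} in l'r iP *.
elim: d l'r iP => [|d IH] l'r iP.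
  by rewrite addn1; apply: (path_sep PC); lia.
rewrite addnS; apply: leq_trans (path_sep PC _ _); [|lia|lia].
apply: leq_trans (IH _ _) _; [lia|lia|].
by apply: leq_trans (path_desc PC _ _) _; [lia|lia|exact: leqnSn].
Qed.

Lemma path_disjoint C l l' i j : path_system C -> l < r -> l' < r -> i < q ->
  on_path C l i j -> on_path C l' i j -> l = l'.
Proof.
move=> PC lr l'r iq /and3P[li lj1 lj2] /and3P[l'i l'j1 l'j2].
case: (ltngtP l l') => // H.
  have := @path_lt C l l' i PC; lia.
have := @path_lt C l' l i PC; lia.
Qed.

(** The union determines the paths row by row. If the entry columns agree, the exit cell of path l
    lies on some path of C'; a path with smaller index stays too far left, and one with larger index
    already yields the inequality. *)
Lemma on_paths_inj C C' : path_system C -> path_system C' ->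
  (forall i j, i < q -> j < q -> on_paths C i j = on_paths C' i j) ->
  forall l i, l < r -> i <= q -> C l i = C' l i.
Proof.
move=> PC PC' E l i lr; elim: i l lr => [|i IH] l lr iq.
  by rewrite (path_inactive PC) ?(path_inactive PC').
have [il|li] := ltnP i (2 * l).
  by rewrite (path_inactive PC) ?(path_inactive PC').
wlog suff H : C C' PC PC' E IH / C' l i.+1 <= C l i.+1.
  apply/eqP; rewrite eqn_leq !H // => [i' j' ??|l' ??]; first by rewrite E.
  by rewrite IH.
have jq := path_bound PC lr iq.
have : on_paths C' i (C l i.+1).
  rewrite -E //; apply/on_pathsP; exists l => //.
  by rewrite /on_path li leqnn (path_desc PC) ?li.
case/on_pathsP => l' l'r /and3P[l'i j1 j2].
case: (ltngtP l' l) j1 j2 => [l'l|ll'|->] // j1 j2.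
  have := @path_lt C l' l i PC; rewrite IH //; lia.
apply: leq_trans j1; apply: leq_trans (path_desc PC' _ _) _; [lia|lia|].
by apply: ltnW; apply: path_lt => //; lia.
Qed.

Definition last_state := mkseq (muln 2) r.
(** The default [q.-1] is where [path_inactive] keeps the paths that have not started. *)
Definition cols (t : seq (seq nat)) l i := nth q.-1 (nth [::] t i) l.

Definition step i s' s := s' \in choices (ranges (if odd i then rcons s q else s)).

Lemma stepP i s' s : size s = nact i.+1 -> reflect
  (size s' = nact i /\ forall j, j < nact i ->
     nth 0 s j <= nth 0 s' j < (if j.+1 < nact i.+1 then nth 0 s j.+1 else q))
  (step i s' s).
Proof.
move=> szs; rewrite /step; set u := if _ then _ else _.
have szu : size u = (nact i).+1.
  by move: szs; rewrite /u /nact; case: ifP; rewrite ?size_rcons; lia.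
have szr : size (ranges u) = nact i by rewrite size_map size_iota szu.
have nu j : j < (nact i).+1 -> nth 0 u j = if j < nact i.+1 then nth 0 s j else q.
  move=> ji; rewrite /u; case: ifP => oi.
    rewrite nth_rcons szs; case: ltnP => // jn; case: eqP => // jn'.
    by move: ji jn jn'; rewrite /nact; lia.
  by case: ltnP => //; move: ji; rewrite /nact; lia.
have rE j : j < nact i -> nth [::] (ranges u) j =
    iota (nth 0 s j) ((if j.+1 < nact i.+1 then nth 0 s j.+1 else q) - nth 0 s j).
  move=> ji; have jk' : j < (size u).-1 by rewrite szu.
  rewrite (nth_map 0) ?size_iota // nth_iota // add0n !nu; [|lia|lia].
  by rewrite (_ : j < nact i.+1) //; move: ji; rewrite /nact; lia.
apply: (iffP (mem_choices 0 _ _)); rewrite szr => -[sz H]; split=> // j ji.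
  by have := H j ji; rewrite rE // mem_iota /=; move: (if _ then _ else _) (nth 0 s j) (nth 0 s' j) => b a x; lia.
by have := H j ji; rewrite rE // mem_iota /=; move: (if _ then _ else _) (nth 0 s j) (nth 0 s' j) => b a x; lia.
Qed.

Lemma mem_families k s t : size s = nact k ->
  t \in families q k s <->
  [/\ size t = k.+1, nth [::] t 0 = [::], nth [::] t k = s &
      forall i, i < k -> step i (nth [::] t i) (nth [::] t i.+1)].
Proof.
elim: k s t => [|k IH] s t szs.
  rewrite (size0nil szs) /= inE; split=> [/eqP->|[]] //.
  by case: t => [//|a [|//]] _ /= ->.
split.
  case/allpairsPdep => s' [t' [s'P t'P ->]].
  have [sz' _] := stepP _ szs s'P; have [szt t0 tk tP] := (IH s' t' sz').1 t'P.
  split; rewrite ?size_rcons ?nth_rcons ?szt ?ltnn ?eqxx // => i.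
  move=> ik; rewrite !nth_rcons szt ik.
  case: (ltnP i.+1 k.+1) => ik'; first exact: tP.
  have -> : i = k by lia.
  by rewrite eqxx tk.
case=> szt t0 tk tP; apply/allpairsPdep.
have := tP k (leqnn _); rewrite tk => skP; have [sz' _] := stepP _ szs skP.
exists (nth [::] t k), (take k.+1 t).
have tE : t = rcons (take k.+1 t) s.
  by rewrite -{1}(cat_take_drop k.+1 t) (drop_nth [::]) ?szt // tk drop_oversize ?szt // cats1.
split=> //; apply/(IH _ _ sz'); split; rewrite ?size_take ?szt ?leqnn ?nth_take //.
by move=> i ik; rewrite !nth_take ?ltnS ?(ltnW ik) // ?tP // ltnW.
Qed.

Lemma families_uniq k s : size s = nact k -> uniq (families q k s).
Proof.
elim: k s => //= k IH s szs; set u := if _ then _ else _.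
have stp s' : s' \in choices (ranges u) -> size s' = nact k.
  by move=> s'P; have [] := stepP _ szs s'P.
apply: allpairs_uniq_dep.
- by apply: choices_uniq; apply/allP => l /mapP[j _ ->]; exact: iota_uniq.
- by move=> s' /stp; apply: IH.
move=> x y /allpairsPdep[s1 [t1 [s1P t1P ->]]] /allpairsPdep[s2 [t2 [s2P t2P ->]]] /=.
move=> /rcons_inj[tE].
have [_ _ e1 _] := (mem_families t1 (stp _ s1P)).1 t1P.
have [_ _ e2 _] := (mem_families t2 (stp _ s2P)).1 t2P.
have E : s1 = s2 by rewrite -e1 tE e2.
by rewrite E tE.
Qed.

Lemma size_last_state : size last_state = nact q.
Proof. by rewrite size_mkseq /nact; lia. Qed.

Definition path_families := families q q last_state.

Lemma path_families_size t : t \in path_families ->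
  size t = q.+1 /\ forall i, i <= q -> size (nth [::] t i) = nact i.
Proof.
move/(mem_families _ size_last_state) => [szt t0 tq tP]; split=> // i iq.
have [d dE] : exists d, q = i + d by exists (q - i); lia.
elim: d i dE {iq} => [|d IH] i dE.
  by rewrite (_ : i = q) ?tq ?size_last_state //; lia.
have sz1 : size (nth [::] t i.+1) = nact i.+1 by apply: IH; lia.
have iq : i < q by lia.
by have [] := stepP _ sz1 (tP i iq).
Qed.

Lemma path_families_inj t t' : t \in path_families -> t' \in path_families ->
  (forall l i, l < r -> i <= q -> cols t l i = cols t' l i) -> t = t'.
Proof.
move=> /path_families_size[szt szi] /path_families_size[szt' szi'] E.
apply: (@eq_from_nth _ [::]) => [|i]; rewrite szt ?szt' // ltnS => iq.
apply: (@eq_from_nth _ q.-1) => [|l]; rewrite szi ?szi' // => li.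
by apply: E => //; move: li; rewrite /nact; lia.
Qed.

Lemma path_families_system t : t \in path_families -> path_system (cols t).
Proof.
move=> tF; have [_ szi] := path_families_size tF.
have [_ _ tq tP] := (mem_families _ size_last_state).1 tF.
have stp i j : i < q -> j < nact i -> cols t j i.+1 <= cols t j i <
    (if j.+1 < nact i.+1 then cols t j.+1 i.+1 else q).
  move=> iq ji; have sz1 := szi _ iq; have [sz0 H] := stepP _ sz1 (tP i iq).
  have nE a b : a < nact b -> b <= q -> cols t a b = nth 0 (nth [::] t b) a.
    by move=> ab bq; rewrite /cols; apply: set_nth_default; rewrite szi.
  have j1 : j < nact i.+1 by move: ji; rewrite /nact; lia.
  have := H j ji; rewrite (nE j i.+1) // (nE j i) ?(ltnW iq) //.
  by case: ifP => // jj; rewrite nE.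
have inact l i : i <= q -> i <= 2 * l -> cols t l i = q.-1.
  by move=> iq il; rewrite /cols nth_default // szi //; rewrite /nact; lia.
have bnd l i : l < r -> i <= q -> cols t l i < q.
  move=> lr; elim: i => [|i IH] iq; first by rewrite inact //; lia.
  have [il|il] := leqP i.+1 (2 * l); first by rewrite inact //; lia.
  have := stp i l iq; have := IH (ltnW iq); rewrite /nact.
  have [il'|il'] := leqP i (2 * l); last by lia.
  have iE : i = 2 * l by lia.
  have iq' : i.+1 < q by lia.
  have lact : l < nact i.+1 by rewrite /nact; lia.
  by have /andP[] := stp i.+1 l iq' lact; rewrite ifF //; rewrite /nact; lia.
have act l i : 2 * l < i -> l < nact i by rewrite /nact; lia.
split=> //.
- by move=> l i lr il; rewrite inact //; lia.
- move=> l i lr /andP[li iq]; have [il|il] := leqP i (2 * l).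
    by rewrite (inact l i) //; [have := bnd l i.+1 lr iq; lia|lia].
  by have /andP[] := stp i l iq (act _ _ il).
- move=> l i lr /andP[li iq]; have lact : l < nact i by apply: act; lia.
  by have /andP[_] := stp i l iq lact; rewrite ifT //; apply: act; lia.
- move=> l lr; rewrite /cols tq nth_mkseq //.
Qed.

Lemma path_system_families C : path_system C ->
  exists2 t, t \in path_families & forall l i, l < r -> i <= q -> cols t l i = C l i.
Proof.
move=> PC; pose t := mkseq (fun i => mkseq (C^~ i) (nact i)) q.+1.
have tE i : i <= q -> nth [::] t i = mkseq (C^~ i) (nact i).
  by move=> iq; rewrite nth_mkseq.
have act i l : i <= q -> l < nact i -> l < r by rewrite /nact; lia.
exists t.
  apply/(mem_families _ size_last_state); split.
  - by rewrite size_mkseq.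
  - by rewrite tE.
  - rewrite tE // /last_state (_ : nact q = r); last by rewrite /nact; lia.
    apply: (@eq_from_nth _ 0); rewrite ?size_mkseq // => l lr.
    by rewrite !nth_mkseq // (path_end PC).
  move=> i iq; rewrite !tE //; last exact: ltnW.
  apply/stepP; first by rewrite size_mkseq.
  split=> [|j ji]; first by rewrite size_mkseq.
  have jr := act _ _ (ltnW iq) ji.
  have ji1 : j < nact i.+1 by move: ji; rewrite /nact; lia.
  rewrite (nth_mkseq _ _ ji1) (nth_mkseq _ _ ji); apply/andP; split.
    by apply: (path_desc PC) => //; move: ji; rewrite /nact; lia.
  case: ifP => [jj|_]; last by apply: (path_bound PC) => //; apply: ltnW.
  rewrite nth_mkseq //; apply: (path_sep PC); move: jj; rewrite /nact; lia.
move=> l i lr iq; rewrite /cols tE //; have [li|li] := ltnP l (nact i).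
  by rewrite nth_mkseq.
rewrite nth_default ?size_mkseq // (path_inactive PC) //.
by move: li; rewrite /nact; lia.
Qed.

End PathSystems.

(** * Faces *)

Section FaceComplex.
Local Open Scope nat_scope.

Lemma bigminn_le (I : finType) (P : pred I) (f : I -> nat) x0 i :
  P i -> \big[minn/x0]_(j | P j) f j <= f i.
Proof.
move=> Pi; have : i \in index_enum I by rewrite mem_index_enum.
elim: (index_enum I) => //= a s IH; rewrite inE big_cons => /predU1P[<-|/IH {}IH].
  by rewrite Pi geq_minl.
by case: ifP => // _; rewrite geq_min IH orbT.
Qed.

Lemma bigminn_attained (I : finType) (P : pred I) (f : I -> nat) x0 :
  \big[minn/x0]_(j | P j) f j = x0 \/
  exists2 i, P i & \big[minn/x0]_(j | P j) f j = f i.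
Proof.
elim/big_rec: _ => [|i m Pi IH]; first by left.
have [im|mi] := leqP (f i) m; first by right; exists i.
exact: IH.
Qed.

Section Faces.
Variable r : nat.
Local Notation q := (2 * r).
Local Notation cell := ('I_q * 'I_q)%type.
Implicit Types (F : {set cell}) (p : cell).

Definition below p' p := (p'.1 < p.1) && (p'.2 < p.2).

(** The number of cells of F preceding p in a longest chain for [below]. [n] is fuel; [p.1] is
    enough because rows decrease along the recursion. *)
Fixpoint level_rec F n p :=
  if n is n'.+1 then \max_(p' in F | below p' p) (level_rec F n' p').+1 else 0.
Definition level F p := level_rec F p.1 p.

(** It excludes chains of l + 1 cells inside the first 2l rows or columns, the supports of the
    products that straightening rewrites. *)
Definition face F := [forall p in F, (2 * level F p <= p.1) && (2 * level F p <= p.2)].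

Lemma level_recE F n m p : p.1 <= n -> p.1 <= m ->
  level_rec F n p = level_rec F m p.
Proof.
have Z (p1 : cell) (f : cell -> nat) : p1.1 = 0 :> nat ->
    \max_(p' in F | below p' p1) f p' = 0.
  by move=> p0; rewrite big_pred0 // => p'; rewrite /below p0 ltn0 andbF.
elim: n m p => [|n IH] m p pn pm.
  have p0 : p.1 = 0 :> nat by lia.
  by case: m {pm} => //= m; rewrite Z.
case: m pm => [|m] pm /=; first by rewrite Z //; lia.
by apply: eq_bigr => p' /andP[_ /andP[p'p _]]; rewrite (IH m) //; lia.
Qed.

Lemma levelE F p : level F p = \max_(p' in F | below p' p) (level F p').+1.
Proof.
rewrite {1}/level (@level_recE F p.1 p.1.+1) //=.
by apply: eq_bigr => p' /andP[_ /andP[p'p _]]; rewrite (@level_recE F _ p'.1) // ltnW.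
Qed.

Lemma level_lt F p' p : p' \in F -> below p' p -> level F p' < level F p.
Proof.
move=> p'F p'p; rewrite [leqRHS]levelE.
apply: (@leq_bigmax_cond _ (fun p' => (p' \in F) && below p' p)
          (fun p' => (level F p').+1) p').
by rewrite p'F.
Qed.

Lemma level_pred F p l : level F p = l.+1 ->
  exists2 p' : cell, p' \in F & below p' p && (level F p' == l).
Proof.
move=> pl; have : 0 < #|[pred p' | (p' \in F) && below p' p]|.
  rewrite lt0n; apply/eqP => /card0_eq E; move: pl.
  by rewrite levelE big_pred0.
case/(eq_bigmax_cond (fun p' => (level F p').+1)) => p' /andP[p'F p'p] E.
by exists p' => //; rewrite p'p /=; move: pl; rewrite levelE E => -[->].
Qed.

Lemma level_chain F p : p \in F ->
  exists2 s : seq cell, size s = (level F p).+1 &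
    [/\ sorted below s, {subset s <= F} & last p s = p].
Proof.
move: {2}(level F p) (erefl (level F p)) => l; elim: l p => [|l IH] p pl pF.
  by exists [:: p]; rewrite ?pl //; split=> // x; rewrite inE => /eqP->.
have [p' p'F /andP[p'p /eqP p'l]] := level_pred pl.
have [s szs [ss sF sp']] := IH _ p'l p'F.
exists (rcons s p); first by rewrite size_rcons szs p'l pl.
split; last by rewrite last_rcons.
  case: s szs ss sp' {sF} => // a s _ /= pa la; rewrite rcons_path pa /=.
  by rewrite la.
by move=> x; rewrite mem_rcons inE => /predU1P[->|/sF].
Qed.

Definition level_set F l := [set p in F | level F p == l].

Definition diag l p := p.1 + (q.-1 - p.2) - 2 * l.

Lemma sum_level_max : \sum_(l < r) (2 * (q.-1 - 2 * l)).+1 = r * (2 * r).+1.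
Proof.
rewrite (reindex_inj rev_ord_inj) /=.
transitivity (\sum_(l < r) (4 * l + 3)).
  by apply: eq_bigr => l _; have := ltn_ord l; lia.
rewrite big_split /= -big_distrr /= sum_nat_const card_ord.
have := bin2_sum r; rewrite big_mkord => ->; rewrite bin2.
have : ~~ odd (r * r.-1) by rewrite oddM; case: (r) => //= n; rewrite andNb.
case: (r) => [|n] //=; lia.
Qed.

Section FaceBound.
Variable F : {set cell}.
Hypothesis faceF : face F.

Lemma face_level p l : p \in level_set F l -> (2 * l <= p.1) && (2 * l <= p.2).
Proof. by rewrite inE => /andP[pF /eqP <-]; apply: (implyP (forallP faceF p)). Qed.

(** Cells of one level are incomparable for [below], whereas distinct cells on one diagonal are
    comparable. The face condition keeps the truncated subtraction in [diag] exact. *)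
Lemma diag_inj l : {in level_set F l &, injective (diag l)}.
Proof.
move=> p p' pl p'l; have /andP[a1 a2] := face_level pl.
have /andP[b1 b2] := face_level p'l.
move: pl p'l; rewrite !inE => /andP[pF /eqP lp] /andP[p'F /eqP lp'] E.
have := ltn_ord p.1; have := ltn_ord p.2; have := ltn_ord p'.1; have := ltn_ord p'.2.
move=> h1 h2 h3 h4; move: E; rewrite /diag => E.
have nb : ~~ below p p'.
  by apply/negP => /(level_lt pF); rewrite lp lp' ltnn.
have nb' : ~~ below p' p.
  by apply/negP => /(level_lt p'F); rewrite lp lp' ltnn.
case: p p' {pF p'F lp lp'} a1 a2 b1 b2 h1 h2 h3 h4 E nb nb' => [i j] [i' j'].
rewrite /below /= => *; congr (_, _); apply: val_inj => /=; lia.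
Qed.

Lemma diag_range l p : l < r -> p \in level_set F l -> diag l p < (2 * (q.-1 - 2 * l)).+1.
Proof.
move=> lr /face_level/andP[a b]; have := ltn_ord p.1; have := ltn_ord p.2.
rewrite /diag; lia.
Qed.

(** The equality case is recorded because a face of maximal size must attain the bound in every
    level, hence meet every diagonal there. *)
Lemma card_level_set l : l < r -> #|level_set F l| <= (2 * (q.-1 - 2 * l)).+1 ?= iff
  [forall d : 'I_(2 * (q.-1 - 2 * l)).+1, d \in [set inord (diag l p) | p in level_set F l]].
Proof.
move=> lr; pose g p : 'I_(2 * (q.-1 - 2 * l)).+1 := inord (diag l p).
have <- : #|g @: level_set F l| = #|level_set F l|.
  apply: card_in_imset => p p' pl p'l /(congr1 val) /=.
  rewrite !inordK ?diag_range //; exact: diag_inj.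
split; first by rewrite -[leqRHS]card_ord max_card.
rewrite -[RHS]/[forall d, d \in g @: level_set F l].
apply/eqP/forallP => [E d|H].
  have /eqP := E; rewrite -[X in _ == X]card_ord -cardsT => /eqP /esym Ec.
  have /eqP -> : g @: level_set F l == [set: _] by rewrite eqEcard finset.subsetT Ec /=.
  by rewrite inE.
rewrite -[RHS]card_ord -cardsT; congr #|pred_of_set _|.
by apply/setP => d; rewrite H inE.
Qed.

Lemma face_partition : #|F| = \sum_(l < r) #|level_set F l|.
Proof.
have lvr p : p \in F -> level F p < r.
  move=> pF; have pl : p \in level_set F (level F p) by rewrite inE pF /=.
  by have /andP[H _] := face_level pl; have := ltn_ord p.1; lia.
transitivity (\sum_(p in F) \sum_(l < r) (level F p == l : nat)).
  rewrite -sum1_card; apply: eq_bigr => p pF.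
  rewrite (bigD1 (Ordinal (lvr p pF))) //= eqxx big1 // => l.
  by rewrite -val_eqE /= eq_sym => /negPf->.
rewrite exchange_big /=; apply: eq_bigr => l _.
rewrite -sum1_card big_mkcond [RHS]big_mkcond /=; apply: eq_bigr => p _.
by rewrite inE; case: (p \in F); case: (_ == _).
Qed.

Lemma face_card : #|F| <= r * (2 * r).+1.
Proof.
rewrite face_partition -sum_level_max; apply: leq_sum => l _.
by have [] := card_level_set (ltn_ord l).
Qed.

Hypothesis maxF : #|F| = r * (2 * r).+1.

Lemma level_set_diag l d : l < r -> d <= 2 * (q.-1 - 2 * l) ->
  exists2 p : cell, p \in level_set F l & diag l p = d.
Proof.
move=> lr dl; have := maxF; rewrite face_partition -sum_level_max => E.
have H (k : 'I_r) : true -> #|level_set F k| <= (2 * (q.-1 - 2 * k)).+1 ?= iff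
   [forall d : 'I_(2 * (q.-1 - 2 * k)).+1, d \in [set inord (diag k p) | p in level_set F k]].
  by move=> _; apply: card_level_set.
have [_] := leqif_sum H; rewrite E eqxx => /esym/forallP/(_ (Ordinal lr)) /=.
move=> /forallP/(_ (inord d))/imsetP[p pl] /(congr1 val) /=.
by rewrite !inordK ?diag_range ?ltnS // => ->; exists p.
Qed.

Definition face_cols l i := \big[minn/q.-1]_(p in level_set F l | p.1 < i) p.2.

Lemma face_cols_le l i (p : cell) : p \in level_set F l -> p.1 < i ->
  face_cols l i <= p.2.
Proof.
move=> pl pi; apply: (@bigminn_le _ (fun p' : cell =>
  (p' \in level_set F l) && (p'.1 < i)) (fun p' => p'.2 : nat)).
by rewrite pl.
Qed.

Lemma face_colsP l i : face_cols l i = q.-1 \/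
  exists2 p : cell, p \in level_set F l & p.1 < i /\ face_cols l i = p.2.
Proof.
have [E|[p /andP[pl pi] E]] := bigminn_attained (fun p' : cell =>
  (p' \in level_set F l) && (p'.1 < i)) (fun p' => p'.2 : nat) q.-1; first by left.
by right; exists p.
Qed.

Lemma level_set_below l p p' : p \in level_set F l -> p' \in level_set F l ->
  ~~ below p' p.
Proof.
rewrite !inE => /andP[_ /eqP lp] /andP[p'F /eqP lp'].
by apply/negP => /(level_lt p'F); rewrite lp lp' ltnn.
Qed.

(** Maximality puts a cell p1 of the level set on the diagonal of p. In a later row p1 would lie
    strictly beyond the cell realizing [face_cols l p.1.+1]; in an earlier row it would lie further
    left than [face_cols l p.1] permits. *)
Lemma face_cols_on_path l (p : cell) : l < r ->
  (p \in level_set F l) = on_path face_cols l p.1 p.2.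
Proof.
move=> lr; have ip := ltn_ord p.1; have jp := ltn_ord p.2.
apply/idP/and3P => [pl|[li j1 j2]].
  have /andP[a b] := face_level pl; split=> //; first exact: face_cols_le.
  have [->|[p' p'l [p'p ->]]] := face_colsP l p.1; first by lia.
  by have := level_set_below pl p'l; rewrite /below p'p -leqNgt.
have [p1 p1l p1d] : exists2 p1 : cell, p1 \in level_set F l & diag l p1 = diag l p.
  apply: level_set_diag => //; rewrite /diag.
  have [H|[p' p'l [p'p E]]] := face_colsP l p.1.+1; first by lia.
  by have /andP[_] := face_level p'l; lia.
have /andP[a1 a2] := face_level p1l.
have h1 := ltn_ord p1.1; have h2 := ltn_ord p1.2.
suff -> : p = p1 by [].
case: (ltngtP p.1 p1.1) => H.
- exfalso; have [Hm|[p' p'l [p'p E]]] := face_colsP l p.1.+1.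
    by move: p1d j1; rewrite Hm /diag; lia.
  have := level_set_below p1l p'l; move: p1d j1; rewrite E /diag /below; lia.
- by exfalso; have := face_cols_le p1l H; move: p1d; rewrite /diag; lia.
case: p p1 {p1l} ip jp li j1 j2 p1d a1 a2 h1 h2 H => [i j] [i' j'] /=.
rewrite /diag /= => *; congr (_, _); apply: val_inj => /=; lia.
Qed.

(** Neighbouring paths are separated because a cell of level l + 1 has one of level l strictly above
    and to the left of it; the ends are the cells on the two extreme diagonals. *)
Lemma face_cols_path_system : path_system r face_cols.
Proof.
have bnd l i : l < r -> face_cols l i < q.
  by move=> lr; have [->|[p _ [_ ->]]] := face_colsP l i; [lia|exact: ltn_ord].
have sep l (p : cell) i : p \in level_set F l.+1 -> p.1 <= i -> face_cols l i < p.2.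
  rewrite inE => /andP[_ /eqP/level_pred[p' p'F /andP[/andP[c d] /eqP lp']]] pi.
  by apply: leq_ltn_trans d; apply: face_cols_le; [rewrite inE p'F lp' /=|lia].
split=> [l i lr _|l i lr il|l i lr /andP[li iq]|l i lr /andP[li iq]|l lr].
- exact: bnd.
- have [//|[p pl [pi _]]] := face_colsP l i.
  by have /andP[a b] := face_level pl; lia.
- have [->|[p pl [pi ->]]] := face_colsP l i; first by have := bnd l i.+1 lr; lia.
  exact: face_cols_le (ltnW _).
- have [->|[p pl [pi ->]]] := face_colsP l.+1 i.+1; last exact: sep pl _.
  have [p pl pd] := @level_set_diag l.+1 0 lr (leq0n _).
  have /andP[a b] := face_level pl; have h1 := ltn_ord p.1; have h2 := ltn_ord p.2.
  have p1E : p.1 = 2 * l.+1 :> nat by move: pd; rewrite /diag; lia.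
  have := sep l p i pl; rewrite p1E li; lia.
have [p pl pd] := @level_set_diag l _ lr (leqnn _).
have /andP[a b] := face_level pl; have h1 := ltn_ord p.1; have h2 := ltn_ord p.2.
have p2E : p.2 = 2 * l :> nat by move: pd; rewrite /diag; lia.
apply/eqP; rewrite eqn_leq -{1}p2E face_cols_le //=.
have [->|[p' p'l [_ ->]]] := face_colsP l q; first by lia.
by have /andP[] := face_level p'l.
Qed.

Lemma face_on_paths (p : cell) : (p \in F) = on_paths r face_cols p.1 p.2.
Proof.
apply/idP/on_pathsP => [pF|[l lr]]; last first.
  by rewrite -face_cols_on_path // inE => /andP[].
have pl : p \in level_set F (level F p) by rewrite inE pF /=.
have /andP[a b] := face_level pl; have h1 := ltn_ord p.1.
have lr : level F p < r by lia.
by exists (level F p) => //; rewrite -face_cols_on_path.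
Qed.

End FaceBound.

Lemma card_max_faces :
  #|[set F : {set cell} | face F && (#|F| == r * (2 * r).+1)]| <= size (path_families r).
Proof.
pose S := path_families r.
pose good t F := [forall p : cell, (p \in F) == on_paths r (cols r t) p.1 p.2].
pose g (F : {set cell}) := find (good^~ F) S.
have gP F : face F -> #|F| = r * (2 * r).+1 -> g F < size S /\
    forall p : cell, (p \in F) = on_paths r (cols r (nth [::] S (g F))) p.1 p.2.
  move=> fF cF; have [t tS tE] := path_system_families (face_cols_path_system fF cF).
  have hs : has (good^~ F) S.
    apply/hasP; exists t => //; apply/forallP => p; rewrite (face_on_paths fF cF).
    apply/eqP; apply/on_pathsP/on_pathsP => -[l lr H]; exists l => //; move: H;
      by rewrite /on_path !tE // ltnW.
  by split; [rewrite -has_find|move/(nth_find [::])/forallP: hs => H p; apply/eqP].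
rewrite cardE -(size_map g) -[leqRHS](size_iota 0); apply: uniq_leq_size.
  rewrite map_inj_in_uniq ?enum_uniq // => F F'.
  rewrite !mem_enum !inE => /andP[fF /eqP cF] /andP[fF' /eqP cF'] E.
  by apply/setP => p; rewrite (gP F fF cF).2 (gP F' fF' cF').2 E.
move=> x /mapP[F]; rewrite mem_enum inE => /andP[fF /eqP cF] ->.
by rewrite mem_iota add0n (gP F fF cF).1.
Qed.

End Faces.

End FaceComplex.

(** * The number and the size of path systems *)

Section PathCounts.
Local Open Scope nat_scope.

Lemma det_rev (R : comPzRingType) n (A : 'M[R]_n) :
  (\det (\matrix_(i, j) A (rev_ord i) (rev_ord j)) = \det A)%R.
Proof.
pose s : 'S_n := perm (@rev_ord_inj n).
have -> : (\matrix_(i, j) A (rev_ord i) (rev_ord j) = row_perm s (col_perm s A))%R.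
  by apply/matrixP => i j; rewrite !mxE !permE.
rewrite row_permE col_permE !det_mulmx !det_perm mulrCA.
by rewrite odd_permV -expr2 sqrr_sign mulr1.
Qed.

Section PathFamilies.
Variable r : nat.
Local Notation q := (2 * r).

Lemma path_families_det : ((size (path_families r))%:Z =
  \det (\matrix_(i < r, j < r)
     ('C(2 * i.+1 + 2 * j.+1 - 2, 2 * i.+1 - 1))%:Z))%R.
Proof.
rewrite /path_families size_families.
- have E : nact q = r by rewrite /nact; lia.
  (* Paths are numbered from the longest to the shortest, against the order of the binomial
     matrix. *)
  rewrite E -[RHS]det_rev; congr (determinant _); apply/matrixP => i j; rewrite !mxE.
  have ir := ltn_ord i; have jr := ltn_ord j.
  rewrite nth_mkseq // /npaths ifT; last by lia.
  by congr (Posz (binomial _ _)); rewrite /=; lia.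
- apply/(sortedP 0) => i; rewrite size_mkseq => ir.
  by rewrite !nth_mkseq //; lia.
- exact: size_last_state.
by apply/(all_nthP 0) => i; rewrite size_mkseq => ir; rewrite nth_mkseq //=; lia.
Qed.

Lemma path_families_gt0 : 0 < size (path_families r).
Proof.
(* L-shaped paths: along row 2l to column 2l, then straight down. *)
pose C l i := if i <= 2 * l then q.-1 else 2 * l.
have PC : path_system r C.
  split; rewrite /C.
  - by move=> l i lr iq; case: ifP; lia.
  - by move=> l i lr ->.
  - by move=> l i lr iP; do 2![case: ifP]; lia.
  - by move=> l i lr iP; do 2![case: ifP]; lia.
  - by move=> l lr; case: ifP; lia.
by have [t tS _] := path_system_families PC; case: (path_families r) tS.
Qed.

Lemma sum_interval a b : b < q -> a <= b ->
  \sum_(j < q) (a <= j <= b : nat) = b.+1 - a.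
Proof.
move=> bq ab; rewrite -(big_mkord predT (fun j => (a <= j <= b : nat))).
rewrite (big_cat_nat _ (n := a)) //=; last by lia.
rewrite (big_cat_nat _ (m := a) (n := b.+1)) //=; last by lia.
rewrite big_nat_cond big1; last by move=> j; lia.
rewrite add0n [X in _ + X]big_nat_cond [X in _ + X]big1; last by move=> j; lia.
rewrite addn0 big_nat_cond (eq_bigr (fun=> 1)); last by move=> j; lia.
by rewrite -big_nat_cond sum_nat_const_nat muln1.
Qed.

Lemma card_on_paths C : path_system r C ->
  #|[set p : 'I_q * 'I_q | on_paths r C p.1 p.2]| = r * (2 * r).+1.
Proof.
move=> PC; rewrite -sum_level_max -sum1_card big_mkcond /=.
transitivity (\sum_(p : 'I_q * 'I_q) \sum_(l < r) (on_path C l p.1 p.2 : nat)).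
  apply: eq_bigr => p _; rewrite inE; case: on_pathsP => [[l lr lp]|H]; last first.
    rewrite big1 // => l _; apply/eqP; rewrite eqb0; apply/negP => lp.
    by apply: H; exists l.
  rewrite (bigD1 (Ordinal lr)) //= lp big1 // => l' ll'.
  apply/eqP; rewrite eqb0; apply: contra ll' => l'p; apply/eqP/val_inj.
  exact: (path_disjoint PC _ _ _ l'p lp).
rewrite exchange_big /=; apply: eq_bigr => -[l lr] _ /=.
rewrite -(pair_bigA _ (fun i j : 'I_q => (on_path C l i j : nat))) /=.
transitivity (\sum_(i < q) (if 2 * l <= i then (C l i).+1 - C l i.+1 else 0)).
  apply: eq_bigr => -[i iq] _ /=; rewrite /on_path; case: ifP => li /=.
    by rewrite sum_interval ?(path_bound PC) ?(path_desc PC) ?li // ltnW.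
  by rewrite big1.
rewrite -(big_mkord predT (fun i => if 2 * l <= i then (C l i).+1 - C l i.+1 else 0)).
rewrite (big_cat_nat _ (n := 2 * l)) //=; last by lia.
rewrite big_nat_cond big1 ?add0n; last by move=> i; case: ifP; lia.
have tel k : 2 * l + k <= q ->
  \sum_(2 * l <= i < 2 * l + k) (if 2 * l <= i then (C l i).+1 - C l i.+1 else 0)
    + C l (2 * l + k) = k + C l (2 * l).
  elim: k => [|k IH] kq; first by rewrite addn0 big_geq.
  rewrite addnS big_nat_recr ?leq_addr //= ?leq_addr.
  have := IH (ltac:(lia)); have := @path_desc _ _ PC l (2 * l + k) lr.
  lia.
have := tel (q - 2 * l); rewrite subnKC; last by lia.
rewrite (path_end PC) // (path_inactive PC) //; lia.
Qed.

End PathFamilies.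

End PathCounts.

(** * Straightening *)

Section Spans.
Variables (F : numFieldType) (n : nat) (X : set 'rV[F]_n).
Implicit Types (Q : 'X_{1..n} -> Prop) (f g : 'rV[F]_n -> F).

Definition in_span Q f := exists2 p : {mpoly F[n]},
  forall m, m \in msupp p -> Q m & forall x, X x -> f x = p.@[x 0].

Lemma in_span0 Q : in_span Q (fun=> 0).
Proof. by exists 0 => [m|x _]; rewrite ?msupp0 ?meval0. Qed.

Lemma in_spanD Q f g : in_span Q f -> in_span Q g -> in_span Q (fun x => f x + g x).
Proof.
move=> [p pQ pE] [s sQ sE]; exists (p + s) => [m /msuppD_le|x Xx].
  by rewrite mem_cat => /orP[/pQ|/sQ].
by rewrite mevalD pE // sE.
Qed.

Lemma in_spanZ Q a f : in_span Q f -> in_span Q (fun x => a * f x).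
Proof.
move=> [p pQ pE]; exists (a *: p) => [m /msuppZ_le/pQ //|x Xx].
by rewrite mevalZ pE.
Qed.

Lemma in_span_ext Q f g : (forall x, X x -> f x = g x) -> in_span Q f -> in_span Q g.
Proof. by move=> fg [p pQ pE]; exists p => // x Xx; rewrite -fg // pE. Qed.

Lemma in_spanB Q f g : in_span Q f -> in_span Q g -> in_span Q (fun x => f x - g x).
Proof.
move=> fQ gQ; apply: in_span_ext (in_spanD fQ (in_spanZ (-1) gQ)) => x _.
by rewrite mulN1r.
Qed.

Lemma in_span_sum Q I (s : seq I) (P : pred I) (f : I -> 'rV[F]_n -> F) :
  (forall i, P i -> in_span Q (f i)) -> in_span Q (fun x => \sum_(i <- s | P i) f i x).
Proof.
move=> fQ; elim: s => [|i s IH].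
  by apply: in_span_ext (in_span0 Q) => x _; rewrite big_nil.
have [Pi|/negPf Pi] := boolP (P i); last first.
  by apply: in_span_ext IH => x _; rewrite big_cons Pi.
by apply: in_span_ext (in_spanD (fQ i Pi) IH) => x _; rewrite big_cons Pi.
Qed.

Lemma in_span_monomial Q m : Q m -> in_span Q (fun x => 'X_[m].@[x 0]).
Proof. by move=> Qm; exists 'X_[m] => // m'; rewrite msuppX inE => /eqP->. Qed.

Lemma in_span_trans Q Q' f : in_span Q f ->
  (forall m, Q m -> in_span Q' (fun x => 'X_[m].@[x 0])) -> in_span Q' f.
Proof.
move=> [p pQ pE] H.
apply: (in_span_ext (f := fun x => \sum_(m <- msupp p) p@_m * 'X_[m].@[x 0])).
  by move=> x Xx; rewrite pE // {3}[p]mpolyE raddf_sum /=; apply: eq_bigr => m _; rewrite mevalZ.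
have : {subset msupp p <= msupp p} by [].
elim: {1 3}(msupp p) => [|m s IH] sp.
  by apply: in_span_ext (in_span0 Q') => x _; rewrite big_nil.
apply: (in_span_ext (f := fun x => p@_m * 'X_[m].@[x 0] +
  \sum_(m <- s) p@_m * 'X_[m].@[x 0])) => [x _|]; first by rewrite big_cons.
apply: in_spanD; first by apply/in_spanZ/H/pQ/sp; rewrite mem_head.
by apply: IH => m' m's; apply: sp; rewrite inE m's orbT.
Qed.

Lemma in_span_mulm Q Q' m f : (forall m', Q m' -> Q' (m + m')%MM) -> in_span Q f ->
  in_span Q' (fun x => 'X_[m].@[x 0] * f x).
Proof.
move=> QQ [p pQ pE]; exists ('X_[m] * p) => [m'|x Xx]; last by rewrite mevalM pE.
rewrite mulrC (perm_mem (msuppMX _ _)) => /mapP[m1 /pQ /QQ H ->]; exact: H.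
Qed.

End Spans.

Section RowMinors.
Variables (R : comPzRingType) (T : eqType) (k : nat) (a0 : T) (x : T -> 'I_k -> R).

Definition row_minor (s : seq T) : R := \det (\matrix_(t < k, u < k) x (nth a0 s t) u).

Lemma row_minor_swap s1 a b s2 : (size s1 + (size s2).+2)%N = k ->
  row_minor (s1 ++ a :: b :: s2) = - row_minor (s1 ++ b :: a :: s2).
Proof.
move=> szk; have l1 : (size s1 < k)%N by lia.
have l2 : ((size s1).+1 < k)%N by lia.
pose i1 := Ordinal l1; pose i2 := Ordinal l2.
have : row_minor (s1 ++ a :: b :: s2) =
    \det (xrow i1 i2 (\matrix_(t < k, u < k) x (nth a0 (s1 ++ b :: a :: s2) t) u)).
  congr (\det _); apply/matrixP => t u; rewrite !mxE; congr (x _ _).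
  case: tpermP => [->|->|/eqP t1 /eqP t2].
  - by rewrite !nth_cat /= ltnn subnn ltnNge leqnSn /= subSnn.
  - by rewrite !nth_cat /= ltnn subnn ltnNge leqnSn /= subSnn.
  rewrite !nth_cat; case: ltnP => // st.
  move: t1 t2; rewrite -!val_eqE /= => t1 t2.
  have -> : (t - size s1 = (t - (size s1).+2).+2)%N by lia.
  by [].
move=> ->; rewrite /xrow row_permE det_mulmx det_perm odd_tperm.
have -> : i1 != i2 by rewrite -val_eqE /= neq_ltn ltnSn.
by rewrite expr1 mulN1r.
Qed.

Lemma row_minor_repeat s t u : (t < u < k)%N -> nth a0 s t = nth a0 s u ->
  row_minor s = 0.
Proof.
move=> /andP[tu uk] E; have tk : (t < k)%N by lia.
apply: (@determinant_alternate _ _ _ (Ordinal tk) (Ordinal uk)).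
  by rewrite -val_eqE /= neq_ltn tu.
by move=> c; rewrite !mxE E.
Qed.

End RowMinors.

Lemma row_minor_not_uniq (R : comPzRingType) (T : eqType) k (a0 : T)
    (x : T -> 'I_k -> R) s : size s = k -> ~~ uniq s -> row_minor a0 x s = 0.
Proof.
move=> sz /(uniqPn a0)[t [u [tu us E]]]; apply: row_minor_repeat E.
by rewrite tu -sz.
Qed.

Lemma row_minor_perm (R : comPzRingType) (T : eqType) k (a0 : T) s s' :
  size s = k -> perm_eq s s' -> exists b : bool, forall x : T -> 'I_k -> R,
    row_minor a0 x s = (-1) ^+ b * row_minor a0 x s'.
Proof.
move=> szs ps; have szs' : size s' = k by rewrite -(perm_size ps).
have [p pE] : exists p : 'S_k, forall t : 'I_k, nth a0 s t = nth a0 s' (p t).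
  have sz1 : size s == k by rewrite szs.
  have sz2 : size s' == k by rewrite szs'.
  have /tuple_permP[p pE] : perm_eq (Tuple sz1) (Tuple sz2) by [].
  exists p => t; rewrite /= in pE; rewrite pE nth_mktuple.
  by rewrite (tnth_nth a0).
exists p => x; rewrite -det_perm -det_mulmx -row_permE; congr (\det _).
by apply/matrixP => t u; rewrite !mxE pE.
Qed.

(* Inverse of the incidence matrix of a-subsets versus (a-1)-subsets of a set
   with 2a-1 elements; the entries depend on the number t of elements outside
   the given a-subset. *)
Section BooleanInversion.
Variables (F : numFieldType) (a : nat).

Fixpoint inv_coef t : F :=
  if t is t'.+1 then - (t'.+1)%:R / (a - t'.+1)%:R * inv_coef t' else a%:R^-1.

Lemma inv_coefE t : (t < a)%N ->
  (a - t)%:R * inv_coef t + t%:R * inv_coef t.-1 = (t == 0%N)%:R.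
Proof.
case: t => [|t] ta /=; first by rewrite subn0 mul0r addr0 divff // pnatr_eq0; lia.
have nz : (a - t.+1)%:R != 0 :> F by rewrite pnatr_eq0; lia.
by field.
Qed.

Lemma boolean_inversion r (phi : {set 'I_r} -> F) (W P : {set 'I_r}) :
  P \subset W -> #|P| = a -> #|W| = (2 * a).-1 -> (0 < a)%N ->
  phi P = \sum_(P' : {set 'I_r} | (P' \subset W) && (#|P'| == a.-1))
    inv_coef #|P' :\: P| * \sum_(u in W :\: P') phi (u |: P').
Proof.
move=> PW cP cW a0.
pose Zs := [pred Z : {set 'I_r} | (Z \subset W) && (#|Z| == a)].
have cZ (Z : {set 'I_r}) : Zs Z -> (#|Z :\: P| < a)%N /\ #|Z :&: P| = (a - #|Z :\: P|)%N.
  move=> /andP[ZW /eqP Za]; have := cardsID P Z; have := cardsID P W.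
  rewrite (finset.setIidPr PW) cP cW Za => e1 e2.
  have : (#|Z :\: P| <= #|W :\: P|)%N by apply: subset_leq_card; apply: finset.setSD.
  by lia.
(* Exchanging the sums leaves a coefficient for each a-subset Z of W; by [inv_coefE] it is 1 if Z =
   P and 0 otherwise. *)
transitivity (\sum_(Z | Zs Z) phi Z * \sum_(u in Z) inv_coef #|(Z :\ u) :\: P|).
  rewrite (bigD1 P) /=; last by rewrite PW cP eqxx.
  have inner Z : Zs Z -> \sum_(u in Z) inv_coef #|(Z :\ u) :\: P| = (Z == P)%:R.
    move=> ZZ; have [lt eq] := cZ Z ZZ.
    rewrite (bigID (mem P)) /= (eq_bigr (fun=> inv_coef #|Z :\: P|)); last first.
      move=> u /andP[uZ uP]; congr (inv_coef #|pred_of_set _|).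
      by apply/setP => v; rewrite !inE; case: eqP => [->|] //=; rewrite uP.
    rewrite [X in _ + X](eq_bigr (fun=> inv_coef #|Z :\: P|.-1)); last first.
      move=> u /andP[uZ uP]; congr inv_coef.
      have -> : (Z :\ u) :\: P = (Z :\: P) :\ u by rewrite !finset.setDDl finset.setUC.
      by rewrite [in RHS](cardsD1 u) inE uZ uP.
    have -> : \sum_(u in Z | u \in P) inv_coef #|Z :\: P| = (a - #|Z :\: P|)%:R * inv_coef #|Z :\: P|.
      rewrite -eq -[#|Z :&: P|]sum1_card natr_sum mulr_suml.
      by apply: eq_big => u; rewrite ?inE // mul1r.
    have -> : \sum_(u in Z | u \notin P) inv_coef #|Z :\: P|.-1 = #|Z :\: P|%:R * inv_coef #|Z :\: P|.-1.
      rewrite -[X in X%:R * _]sum1_card natr_sum mulr_suml.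
      by apply: eq_big => u; rewrite ?inE 1?andbC // mul1r.
    rewrite inv_coefE // cards_eq0 finset.setD_eq0; congr (_%:R); congr nat_of_bool.
    by rewrite eqEcard cP; move/andP: ZZ => [_ /eqP ->]; rewrite leqnn andbT.
  rewrite inner ?eqxx ?mulr1 ?big1 ?addr0 //=; last by rewrite PW cP eqxx.
  by move=> Z /andP[ZZ /negPf ZP]; rewrite inner // ZP mulr0.
under eq_bigr do rewrite mulr_sumr.
under [RHS]eq_bigr do rewrite mulr_sumr.
rewrite (exchange_big_dep predT) //= [RHS](exchange_big_dep predT) //=.
apply: eq_bigr => u _.
rewrite (reindex_onto (fun P' : {set 'I_r} => u |: P') (fun Z => Z :\ u)) /=; last first.
  by move=> Z /andP[_ uZ]; rewrite finset.setD1K.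
apply: eq_big => [P'|P' /andP[/andP[_ uP']] /eqP uP].
  rewrite !inE eqxx /= andbT finset.subUset finset.sub1set.
  have [uP'|uP'] := boolP (u \in P').
    rewrite andbF; apply/negP => /andP[_ /eqP E].
    by move: uP'; rewrite -E !inE eqxx.
  rewrite finset.setU1K // eqxx andbT cardsU1 uP' add1n -[X in _ == X](prednK a0) eqSS.
  by move: (u \in W) (P' \subset W) (_ == _) => [] [] [].
by rewrite uP mulrC.
Qed.

End BooleanInversion.

Lemma perm_descent k (s : 'S_k) : s != 1%g ->
  exists t : 'I_k, exists2 u : 'I_k, (t < u)%N & (s u < s t)%N.
Proof.
move=> sN1; apply: contrapT => H.
have inc (t u : 'I_k) : (t < u)%N -> (s t < s u)%N.
  move=> tu; rewrite ltn_neqAle leqNgt; apply/andP; split; last first.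
    by apply/negP => us; apply: H; exists t; exists u.
  by rewrite (inj_eq val_inj) (inj_eq perm_inj) -val_eqE neq_ltn tu.
have ge (t : 'I_k) : (t <= s t)%N.
  case: t => t; elim: t => //= t IH tk.
  have tk' : (t < k)%N by lia.
  by have := inc (Ordinal tk') (Ordinal tk) (ltnSn t); have := IH tk'; lia.
case/eqP: sN1; apply/permP => t; rewrite perm1; apply/val_inj => /=.
have E : (\sum_(i < k) s i = \sum_(i < k) i)%N by rewrite [RHS](reindex_inj (@perm_inj _ s)).
apply/eqP; rewrite eqn_leq ge andbT leqNgt; apply/negP => lt.
have : (\sum_(i < k) i < \sum_(i < k) s i)%N.
  rewrite (bigD1 t) //= [ltnRHS](bigD1 t) //= -addSn leq_add //.
  by apply: leq_sum => u _.
by rewrite E ltnn.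
Qed.

(** Exchanging the values at a descent increases the sum strictly, so a maximizing permutation is
    the identity and no other one attains the maximum. *)
Lemma rearrangement k (i j : 'I_k -> nat) (s : 'S_k) :
  (forall t u : 'I_k, t < u -> i t < i u)%N ->
  (forall t u : 'I_k, t < u -> j t < j u)%N -> s != 1%g ->
  (\sum_t i t * j (s t) < \sum_t i t * j t)%N.
Proof.
move=> hi hj sN1; pose f (s : 'S_k) := (\sum_t i t * j (s t))%N.
have step s' : s' != 1%g -> exists s'', (f s' < f s'')%N.
  move=> /perm_descent[t [u tu us]]; exists (tperm t u * s')%g.
  have ut : u != t by rewrite -val_eqE neq_ltn tu orbT.
  have dec s0 : f s0 = (i t * j (s0 t) + (i u * j (s0 u) +
      \sum_(v | (v != t) && (v != u)) i v * j (s0 v)))%N.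
    by rewrite /f (bigD1 t) //= (bigD1 u).
  rewrite !dec !permM tpermL tpermR !addnA.
  rewrite [X in (_ < _ + X)%N](eq_bigr (fun v => i v * j (s' v))%N); last first.
    by move=> v /andP[vt vu]; rewrite permM tpermD // eq_sym.
  by rewrite ltn_add2r; have := hi t u tu; have := hj _ _ us; nia.
have [m _ mP] := arg_maxnP f (isT : xpredT (1%g : 'S_k)).
have m1 : m = 1%g.
  by apply/eqP; apply: contraT => /step[s'' lt]; have := mP s'' isT; rewrite /= leqNgt lt.
have [s'' lt] := step s sN1.
have := leq_trans lt (mP s'' isT); rewrite m1 /f.
by under [X in (_ < X)%N]eq_bigr do rewrite perm1.
Qed.

(** * Minors with isotropic rows *)

Section RowReduction.
Variables (F : numFieldType) (r n : nat) (X : set 'rV[F]_n).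
Local Notation q := (2 * r)%N.
Variable var : 'I_q -> 'I_q -> 'I_n.
Hypothesis var_inj : forall a b a' b', var a b = var a' b' -> a = a' /\ b = b'.

(* The products a * b make the diagonal the heaviest term of a minor; wt_row
   dominates them, and since 2 ^ u > \sum_(v < u) 2 ^ v it prefers minors with
   one pair of rows far down. *)
Definition wt_row (a : nat) := (2 ^ r - 2 ^ a./2)%N.
Definition wt_cell (a b : nat) := (a * b + (q ^ 3).+1 * (wt_row a + wt_row b))%N.
Definition wt (m : 'X_{1..n}) := (\sum_a \sum_b m (var a b) * wt_cell a b)%N.

Definition cell_mono k (f g : 'I_k -> 'I_q) : 'X_{1..n} :=
  (\sum_(t < k) U_(var (f t) (g t)))%MM.

Lemma meval_cell_mono k f g (x : 'rV[F]_n) :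
  'X_[@cell_mono k f g].@[x 0] = \prod_t x 0 (var (f t) (g t)).
Proof.
rewrite /cell_mono -mprodXE rmorph_prod /=.
by apply: eq_bigr => t _; rewrite mevalXU.
Qed.

Lemma mdeg_cell_mono k f g : mdeg (@cell_mono k f g) = k.
Proof.
rewrite /cell_mono mdeg_sum (eq_bigr (fun=> 1%N)) => [|t _]; last exact: mdeg1.
by rewrite sum1_card card_ord.
Qed.

Lemma wtD m1 m2 : wt (m1 + m2)%MM = (wt m1 + wt m2)%N.
Proof.
rewrite /wt -big_split /=; apply: eq_bigr => a _; rewrite -big_split /=.
by apply: eq_bigr => b _; rewrite mnmDE mulnDl.
Qed.

Lemma wtU a b : wt U_(var a b)%MM = wt_cell a b.
Proof.
rewrite /wt (bigD1 a) //= (bigD1 b) //= mnm1E eqxx mul1n.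
rewrite big1 => [|b' bb']; last first.
  rewrite mnm1E; case: eqP => [/var_inj[_ E]|]; last by rewrite mul0n.
  by rewrite E eqxx in bb'.
rewrite big1 => [|a' aa']; first by rewrite !addn0.
rewrite big1 // => b' _; rewrite mnm1E; case: eqP => [/var_inj[E _]|]; last by rewrite mul0n.
by rewrite E eqxx in aa'.
Qed.

Lemma wt_cell_mono k f g :
  wt (@cell_mono k f g) = (\sum_(t < k) wt_cell (f t) (g t))%N.
Proof.
rewrite /cell_mono (big_morph wt wtD (_ : wt 0%MM = 0%N)); last first.
  by rewrite /wt big1 // => a _; rewrite big1 // => b _; rewrite mnm0E.
by apply: eq_bigr => t _; rewrite wtU.
Qed.

Lemma wt_cell_monoE k f g : wt (@cell_mono k f g) =
  (\sum_t f t * g t + (q ^ 3).+1 * (\sum_t wt_row (f t) + \sum_t wt_row (g t)))%N.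
Proof. by rewrite wt_cell_mono big_split -big_distrr big_split. Qed.

Variable a0 : 'I_q.
Definition minor k (j : 'I_k -> 'I_q) (s : seq 'I_q) (x : 'rV[F]_n) : F :=
  row_minor a0 (fun a u => x 0 (var a (j u))) s.

Lemma minor_span Q k (j : 'I_k -> 'I_q) s :
  (forall p : 'S_k, Q (cell_mono (fun t : 'I_k => nth a0 s t) (fun t => j (p t)))) ->
  in_span X Q (minor j s).
Proof.
move=> Qp; apply: (in_span_ext (f := fun x => \sum_(p : 'S_k) (-1) ^+ p *
    'X_[cell_mono (fun t : 'I_k => nth a0 s t) (fun t => j (p t))].@[x 0])).
  move=> x _; apply: eq_bigr => p _; congr (_ * _); rewrite meval_cell_mono.
  by apply: eq_bigr => t _; rewrite mxE.
by apply: in_span_sum => p _; apply/in_spanZ/in_span_monomial.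
Qed.

Lemma lo_subproof (u : 'I_r) : (2 * u < q)%N. Proof. by have := ltn_ord u; lia. Qed.
Lemma hi_subproof (u : 'I_r) : ((2 * u).+1 < q)%N. Proof. by have := ltn_ord u; lia. Qed.
Definition lo u : 'I_q := Ordinal (lo_subproof u).
Definition hi u : 'I_q := Ordinal (hi_subproof u).

Variable omega : 'I_q -> 'I_q -> F.
Hypothesis isotropic : forall x, X x -> forall a b,
  \sum_u (x 0 (var (lo u) a) * x 0 (var (hi u) b) -
          x 0 (var (hi u) a) * x 0 (var (lo u) b)) = omega a b.

Lemma minor_expand2 k (j : 'I_k.+2 -> 'I_q) al be J x :
  minor j (al :: be :: J) x = \sum_(a < k.+2) \sum_(b < k.+1) (-1) ^+ a * (-1) ^+ b *
    (x 0 (var al (j a)) * x 0 (var be (j (lift a b)))) *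
    minor (fun v => j (lift a (lift b v))) J x.
Proof.
rewrite /minor /row_minor (expand_det_row _ 0); apply: eq_bigr => a _.
rewrite mxE /cofactor (expand_det_row _ 0) add0n /= !mulr_sumr; apply: eq_bigr => b _.
rewrite /cofactor !mxE add0n /=.
have -> : row' 0 (col' b (row' 0 (col' a (\matrix_(t < k.+2, u < k.+2)
    x 0 (var (nth a0 (al :: be :: J) t) (j u)))))) =
    \matrix_(t < k, u < k) x 0 (var (nth a0 J t) (j (lift a (lift b u)))).
  by apply/matrixP => t u; rewrite !mxE.
by ring.
Qed.

(** In the expansion along the first two rows, the sum over u turns the products of two entries into
    values of the isotropy form, which are constant on X; the degree drops by two. The factor 2
    comes from antisymmetrizing in the two rows. *)
Lemma contraction_span k (j : 'I_k.+2 -> 'I_q) J : size J = k ->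
  in_span X (fun m => (mdeg m <= k)%N)
    (fun x => \sum_u minor j (lo u :: hi u :: J) x).
Proof.
move=> szJ; apply: (in_span_ext (f := fun x => 2^-1 * \sum_(a < k.+2) \sum_(b < k.+1)
   (-1) ^+ a * (-1) ^+ b * omega (j a) (j (lift a b)) *
    minor (fun v => j (lift a (lift b v))) J x)); last first.
  apply: in_spanZ; apply: in_span_sum => a _; apply: in_span_sum => b _.
  by apply/in_spanZ/minor_span => p; rewrite mdeg_cell_mono.
move=> x Xx; apply: (mulfI (_ : 2 != 0 :> F)); first by rewrite pnatr_eq0.
rewrite mulrA divff ?pnatr_eq0 // mul1r.
transitivity (\sum_u (minor j (lo u :: hi u :: J) x - minor j (hi u :: lo u :: J) x)).
  rewrite (eq_bigr (fun u => \sum_(a < k.+2) \sum_(b < k.+1) (-1) ^+ a * (-1) ^+ b *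
    (x 0 (var (lo u) (j a)) * x 0 (var (hi u) (j (lift a b))) -
     x 0 (var (hi u) (j a)) * x 0 (var (lo u) (j (lift a b)))) *
    minor (fun v => j (lift a (lift b v))) J x)); last first.
    move=> u _; rewrite !minor_expand2 -sumrB; apply: eq_bigr => a _.
    by rewrite -sumrB; apply: eq_bigr => b _; ring.
  rewrite [RHS]exchange_big /=; apply: eq_bigr => a _.
  rewrite [RHS]exchange_big /=; apply: eq_bigr => b _.
  by rewrite -mulr_suml -mulr_sumr (isotropic Xx).
rewrite mulr_natl -sumrMnl; apply: eq_bigr => u _.
rewrite [X in _ - X](row_minor_swap _ _ (s1 := [::])) ?szJ //.
by rewrite opprK mulr2n.
Qed.

Definition pairs (us : seq 'I_r) := flatten [seq [:: lo u; hi u] | u <- us].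

Lemma size_pairs us : size (pairs us) = (2 * size us)%N.
Proof. by elim: us => //= u us ->; lia. Qed.

Lemma pairs_cat us vs : pairs (us ++ vs) = pairs us ++ pairs vs.
Proof. by rewrite /pairs map_cat flatten_cat. Qed.

(** One pair passes another by four adjacent transpositions, hence without a sign; so only the set
    of pairs matters. *)
Lemma minor_move_pair k (j : 'I_k -> 'I_q) L u us S x :
  (size L + (2 * size us).+2 + size S)%N = k ->
  minor j (L ++ lo u :: hi u :: pairs us ++ S) x =
  minor j (L ++ pairs us ++ lo u :: hi u :: S) x.
Proof.
elim: us L => //= v us IH L szk.
have sw al be s1 s2 : (size s1 + (size s2).+2)%N = k ->
    minor j (s1 ++ al :: be :: s2) x = - minor j (s1 ++ be :: al :: s2) x.
  exact: row_minor_swap.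
have := IH (L ++ [:: lo v; hi v]); rewrite -!catA /= => <-; last first.
  by rewrite size_cat /=; lia.
have : size (pairs us ++ S) = (2 * size us + size S)%N by rewrite size_cat size_pairs.
move: (pairs us ++ S) => T szT.
have := sw (hi u) (lo v) (L ++ [:: lo u]) (hi v :: T); rewrite -!catA /= => ->; last first.
  by rewrite size_cat /=; lia.
have := sw (hi u) (hi v) (L ++ [:: lo u; lo v]) T; rewrite -!catA /= => ->; last first.
  by rewrite size_cat /=; lia.
have := sw (lo u) (lo v) L (hi v :: hi u :: T) => /= ->; last by lia.
have := sw (lo u) (hi v) (L ++ [:: lo v]) (hi u :: T); rewrite -!catA /= => ->; last first.
  by rewrite size_cat /=; lia.
by rewrite !opprK.
Qed.

Lemma minor_pairs_perm k (j : 'I_k -> 'I_q) L us vs S x : perm_eq us vs ->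
  (size L + 2 * size us + size S)%N = k ->
  minor j (L ++ pairs us ++ S) x = minor j (L ++ pairs vs ++ S) x.
Proof.
elim: us vs L => [|u us IH] vs L.
  by rewrite perm_sym => /perm_nilP->.
move=> p; have : u \in vs by rewrite -(perm_mem p) mem_head.
move=> /splitPr uvs; case: uvs p => v1 v2.
rewrite -[u :: v2]cat1s perm_sym perm_catCA perm_cons perm_sym => p szk.
have := IH _ (L ++ [:: lo u; hi u]) p; rewrite -!catA /= => ->; last first.
  by rewrite size_cat /=; rewrite /= in szk; lia.
have szp := perm_size p; rewrite size_cat in szp.
rewrite !pairs_cat -!catA minor_move_pair //=.
rewrite -szk -[size (u :: us)]/(size us).+1 szp size_cat size_pairs.
by move: (size v1) (size v2) (size L) (size S) => *; lia.
Qed.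

Lemma half_subproof (b : 'I_q) : (b./2 < r)%N. Proof. by have := ltn_ord b; lia. Qed.
Definition half_ord b : 'I_r := Ordinal (half_subproof b).

Lemma half_lo u : half_ord (lo u) = u. Proof. by apply: ord_inj => /=; lia. Qed.
Lemma half_hi u : half_ord (hi u) = u. Proof. by apply: ord_inj => /=; lia. Qed.
Lemma half_ordK b : (b == lo (half_ord b)) || (b == hi (half_ord b)).
Proof. by rewrite -!val_eqE /=; lia. Qed.
Lemma lo_neq_hi u v : lo u != hi v. Proof. by rewrite -val_eqE /=; lia. Qed.

Lemma mem_pairs us b : (b \in pairs us) = (half_ord b \in us).
Proof.
elim: us => //= u us IH; rewrite !inE IH orbA; congr (_ || _).
apply/idP/eqP => [/orP[]/eqP-> | <-]; rewrite ?half_lo ?half_hi //; exact: half_ordK.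
Qed.

Lemma pairs_uniq us : uniq us -> uniq (pairs us).
Proof.
elim: us => //= u us IH /andP[uus /IH ->].
by rewrite inE negb_or !mem_pairs half_lo half_hi uus lo_neq_hi.
Qed.

Lemma sum_pairs (f : nat -> nat) us :
  (\sum_(b <- pairs us) f b./2 = 2 * \sum_(u <- us) f u)%N.
Proof.
elim: us => [|u us IH]; first by rewrite !big_nil.
rewrite /= !big_cons IH /= [in RHS]mulnDr.
have -> : (2 * u)./2 = u by lia.
have -> : uphalf (2 * u) = u by lia.
lia.
Qed.

Lemma sum_wt_row (s : seq 'I_q) :
  (\sum_(b <- s) wt_row b + \sum_(b <- s) 2 ^ b./2 = size s * 2 ^ r)%N.
Proof.
rewrite -big_split /= -sum1_size big_distrl /=; apply: eq_bigr => b _.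
by rewrite /wt_row subnK ?mul1n // leq_exp2l // ltnW // half_subproof.
Qed.

Lemma sum_pow2_lt m (P : {set 'I_r}) : (forall u, u \in P -> (u < m)%N) -> (m <= r)%N ->
  (\sum_(u in P) 2 ^ u < 2 ^ m)%N.
Proof.
move=> Pm mr; have -> : (2 ^ m = (\sum_(u < r | (u < m)%N) 2 ^ u).+1)%N.
  rewrite -(big_ord_widen _ (fun u => 2 ^ u)%N mr).
  by elim: m {Pm mr} => [|m IH]; rewrite ?big_ord0 // big_ord_recr expnS IH /=; lia.
rewrite ltnS [leqRHS](bigID (mem P)) /= -[leqLHS]addn0 leq_add //.
rewrite leq_eqVlt; apply/orP; left; apply/eqP; apply: eq_bigl => u.
by have [/Pm ->|] := boolP (u \in P); rewrite ?andbF.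
Qed.

(* The rows of the minor come in pairs [lo u, hi u] (u in P) and singletons;
   boolean_inversion rewrites it through sums over a full set of pairs, which
   isotropy contracts, up to minors with a pair of rows further down. *)
Lemma minor_reduction k (j : 'I_k.+2 -> 'I_q) (I : seq 'I_q) :
  uniq I -> size I = k.+2 -> (k < r)%N -> (forall b, b \in I -> (b < 2 * k.+1)%N) ->
  in_span X (fun m => (mdeg m <= k)%N \/ mdeg m = k.+2 /\
      (wt m < (q ^ 3).+1 * (\sum_(b <- I) wt_row b + \sum_t wt_row (j t)))%N)
    (minor j I).
Proof.
move=> uI szI kr ltI; set Q := (X in in_span _ X _).
pose P := [set u | (lo u \in I) && (hi u \in I)].
pose W := [set u : 'I_r | (u < k.+1)%N && ((lo u \in I) == (hi u \in I))].
pose S := [seq b <- I | half_ord b \notin P].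
have halfI b : b \in I -> (half_ord b < k.+1)%N by move=> /ltI /=; lia.
have loI u : lo u \in I -> (u < k.+1)%N by move=> /halfI; rewrite half_lo.
have hiI u : hi u \in I -> (u < k.+1)%N by move=> /halfI; rewrite half_hi.
have inP b : half_ord b \in P -> b \in I.
  by rewrite inE => /andP[loh hih]; case/orP: (half_ordK b) => /eqP ->.
have pI : perm_eq I (pairs (enum P) ++ S).
  apply: uniq_perm => // [|b].
    rewrite cat_uniq pairs_uniq ?enum_uniq // filter_uniq // andbT.
    apply/hasPn => b; rewrite mem_filter => /andP[nP _].
    by rewrite mem_pairs mem_enum.
  rewrite mem_cat mem_pairs mem_enum mem_filter.
  by have [/inP ->|] := boolP (half_ord b \in P).
have szS : (2 * #|P| + size S = k.+2)%N.
  by rewrite -szI (perm_size pI) size_cat size_pairs -cardE.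
(* Each index below k + 1 lies in W or contributes exactly one row to [S]. Together with [szS] this
   gives |W| = 2 |P| - 1, the size needed for [boolean_inversion]. *)
have szWS : (#|W| + size S = k.+1)%N.
  pose V := [set u : 'I_r | (u < k.+1)%N].
  have cV : #|V| = k.+1.
    by rewrite -sum1dep_card -(big_ord_widen _ (fun=> 1%N) kr) sum1_card card_ord.
  have WV : W \subset V by apply/fintype.subsetP => u; rewrite !inE => /andP[].
  have : #|V :\: W| = size S.
    rewrite -(size_map half_ord).
    have /card_uniqP <- : uniq [seq half_ord b | b <- S].
      rewrite map_inj_in_uniq ?filter_uniq // => b b'.
      rewrite !mem_filter => /andP[bP bI] /andP[_ bI'] E.
      move: bP; rewrite inE negb_and.
      by case/orP: (half_ordK b) => /eqP Eb; case/orP: (half_ordK b') => /eqP Eb';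
        rewrite Eb Eb' E // -?E -?Eb ?bI E -?Eb' ?bI'.
    apply: eq_card => u; rewrite !inE.
    apply/idP/mapP => [/andP[nW uk]|[b]].
      move: nW; rewrite uk /=; have [lu|lu] := boolP (lo u \in I).
        move=> hu; exists (lo u); rewrite ?half_lo // mem_filter half_lo inE lu /=.
        by move: hu; case: (hi u \in I).
      rewrite eq_sym eqbF_neg negbK => hu; exists (hi u); rewrite ?half_hi //.
      by rewrite mem_filter half_hi inE hu (negPf lu).
    rewrite mem_filter inE => /andP[nP bI] ->; rewrite (halfI _ bI) andbT /=.
    by move: nP; case/orP: (half_ordK b) => /eqP E; rewrite -E bI ?andbT /=;
      case: (_ \in I).
  by rewrite cardsD (finset.setIidPr WV) cV; have := subset_leq_card WV; rewrite cV; lia.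
have P0 : (0 < #|P|)%N by lia.
have PW : P \subset W.
  by apply/fintype.subsetP => u; rewrite !inE => /andP[lu hu]; rewrite lu hu loI.
have cW : #|W| = (2 * #|P|).-1 by lia.
pose phi x (Z : {set 'I_r}) := minor j (pairs (enum Z) ++ S) x.
have [b bE] : exists b : bool, forall x, minor j I x = (-1) ^+ b * phi x P.
  have [b bE] := row_minor_perm F a0 szI pI; exists b => x; exact: bE.
apply: (in_span_ext (f := fun x => (-1) ^+ b * \sum_(P' : {set 'I_r} |
   (P' \subset W) && (#|P'| == #|P|.-1))
    inv_coef F #|P| #|P' :\: P| * \sum_(u in W :\: P') phi x (u |: P'))).
  by move=> x _; rewrite bE -(boolean_inversion _ PW erefl cW P0).
apply: in_spanZ; apply: in_span_sum => P' /andP[P'W /eqP cP']; apply: in_spanZ.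
pose J := pairs (enum P') ++ S.
have szJ : size J = k by rewrite size_cat size_pairs -cardE cP'; lia.
apply: (in_span_ext (f := fun x => \sum_u minor j (lo u :: hi u :: J) x -
   \sum_(u | u \notin W :\: P') minor j (lo u :: hi u :: J) x)).
  move=> x _; rewrite [X in X - _](bigID (mem (W :\: P'))) /= addrK.
  apply: eq_bigr => u; rewrite inE => /andP[uP' uW]; symmetry.
  apply: (@minor_pairs_perm _ _ [::] _ (u :: enum P')).
    by apply: uniq_perm; rewrite /= ?enum_uniq ?mem_enum ?uP' // => v; rewrite !inE !mem_enum !inE.
  by rewrite -cardE cardsU1 uP' cP' add1n prednK // addnC addn0 szS.
apply: in_spanB.
  apply: in_span_trans (contraction_span _ szJ) _ => m mk.
  by apply: in_span_monomial; left.
apply: in_span_sum => u uWP'.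
have zero : ~~ uniq (lo u :: hi u :: J) -> in_span X Q (minor j (lo u :: hi u :: J)).
  move=> nu; apply: in_span_ext (in_span0 X Q) => x _.
  by rewrite /minor row_minor_not_uniq //= szJ.
have [uP'|uP'] := boolP (u \in P').
  apply: zero; rewrite /= inE mem_cat mem_pairs half_lo mem_enum uP' orbT //.
move: uWP'; rewrite inE uP' /= => uW.
(* For u <= k outside W, one row of the pair already occurs in [S], so the minor has a repeated row.
   For larger u, the new pair contributes 2 ^ u, which exceeds the sum over P and makes the minor
   lighter. *)
have [uk|uk] := ltnP u k.+1.
  apply: zero; move: uW; rewrite inE uk /= => luhu.
  rewrite /= inE !mem_cat !mem_filter half_lo half_hi !inE.
  by move: luhu; case: (lo u \in I); case: (hi u \in I); rewrite //= ?orbT ?andbF.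
apply: minor_span => p; right; rewrite mdeg_cell_mono; split=> //.
rewrite wt_cell_monoE [X in (_ + _ * (_ + X) < _)%N](_ : _ = \sum_t wt_row (j t))%N; last first.
  by rewrite [RHS](reindex_inj (@perm_inj _ p)).
have -> : (\sum_(t < k.+2) wt_row (nth a0 [:: lo u, hi u & J] t) =
    \sum_(c <- [:: lo u, hi u & J]) wt_row c)%N.
  by rewrite (big_nth a0) big_mkord /= szJ.
set A := (\sum_(t < k.+2) _ * _)%N.
(* Since k + 2 <= q, the products of indices add up to at most q ^ 3 and cannot outweigh a change in
   the [wt_row] part. *)
have AL : (A <= q ^ 3)%N.
  apply: (@leq_trans (\sum_(t < k.+2) q * q)).
    by apply: leq_sum => t _; apply: leq_mul; apply: ltnW.
  by rewrite sum_nat_const card_ord !expnS expn0; nia.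
have := sum_wt_row I; have := sum_wt_row [:: lo u, hi u & J].
have -> : (\sum_(c <- I) 2 ^ c./2 = 2 * \sum_(v in P) 2 ^ v + \sum_(c <- S) 2 ^ c./2)%N.
  by rewrite (perm_big _ pI) big_cat /= (sum_pairs (fun v => 2 ^ v)%N) big_enum.
have -> : (\sum_(c <- [:: lo u, hi u & J]) 2 ^ c./2 = 2 * 2 ^ u +
    (2 * \sum_(v in P') 2 ^ v + \sum_(c <- S) 2 ^ c./2))%N.
  rewrite !big_cons big_cat /= (sum_pairs (fun v => 2 ^ v)%N) big_enum /= addnA; congr (_ + _)%N.
  have -> : (2 * u)./2 = u by lia.
  have -> : uphalf (2 * u) = u by lia.
  lia.
have : (\sum_(v in P) 2 ^ v < 2 ^ k.+1)%N.
  by apply: sum_pow2_lt => // v; rewrite inE => /andP[/loI].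
have : (2 ^ k.+1 <= 2 ^ u)%N by rewrite leq_exp2l.
rewrite szI /= szJ.
have arith a l b1 b2 b3 b4 b5 b6 b7 b8 b9 : (a <= l -> b8 <= b7 -> b3 < b8 ->
    b1 + (2 * b7 + (2 * b4 + b5)) = b9 -> b2 + (2 * b3 + b5) = b9 ->
    a + l.+1 * (b1 + b6) < l.+1 * (b2 + b6))%N.
  move=> h1 h2 h3 h4 h5; have : (b1 < b2)%N by lia.
  nia.
exact: arith AL.
Qed.

(** The monomial is the diagonal term of a minor that reduces to lighter ones. The other terms have
    the same [wt_row] part and are lighter by [rearrangement]. *)
Lemma row_reduction k (i j : 'I_k.+2 -> 'I_q) :
  (forall t u : 'I_k.+2, t < u -> i t < i u)%N ->
  (forall t u : 'I_k.+2, t < u -> j t < j u)%N ->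
  (k < r)%N -> (forall t, (i t < 2 * k.+1)%N) ->
  in_span X (fun m => (mdeg m < k.+2)%N \/
      mdeg m = k.+2 /\ (wt m < wt (cell_mono i j))%N)
    (fun x => 'X_[cell_mono i j].@[x 0]).
Proof.
move=> hi_ hj kr ik; set Q := (X in in_span _ X _).
pose I := [seq i t | t <- enum 'I_k.+2].
have szI : size I = k.+2 by rewrite size_map size_enum_ord.
have nthI (t : 'I_k.+2) : nth a0 I t = i t.
  by rewrite (nth_map t) ?size_enum_ord // nth_ord_enum.
have uI : uniq I.
  rewrite map_inj_uniq ?enum_uniq // => t u E; apply: ord_inj.
  by case: (ltngtP t u) => // /hi_; rewrite E ltnn.
have minorI : in_span X Q (minor j I).
  apply: in_span_trans (minor_reduction j uI szI kr _) _ => [b|m].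
    by move=> /mapP[t _ ->].
  move=> Qm; apply: in_span_monomial; case: Qm => [|[dm wm]]; [by left; lia|right].
  split=> //; apply: leq_trans wm _; rewrite wt_cell_monoE big_map big_enum.
  exact: leq_addl.
apply: (in_span_ext (f := fun x => minor j I x - \sum_(p : 'S_k.+2 | p != 1%g)
    (-1) ^+ p * 'X_[cell_mono i (fun t => j (p t))].@[x 0])).
  move=> x _; rewrite /minor /row_minor /determinant (bigD1 (1%g : 'S_k.+2)) //=.
  rewrite odd_perm1 mul1r; apply/eqP; rewrite subr_eq; apply/eqP; congr (_ + _).
    by rewrite meval_cell_mono; apply: eq_bigr => t _; rewrite mxE nthI perm1.
  apply: eq_bigr => p _; congr (_ * _); rewrite meval_cell_mono.
  by apply: eq_bigr => t _; rewrite mxE nthI.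
apply: in_spanB minorI _; apply: in_span_sum => p p1; apply/in_spanZ/in_span_monomial.
right; rewrite mdeg_cell_mono; split=> //; rewrite !wt_cell_monoE.
rewrite [X in (_ + _ * (_ + X) < _)%N](_ : _ = \sum_t wt_row (j t))%N.
  by rewrite ltn_add2r; exact: rearrangement.
by rewrite [RHS](reindex_inj (@perm_inj _ p)).
Qed.

End RowReduction.

(** * Monomials supported on faces *)

Section StandardMonomials.
Variables (F : numFieldType) (r n : nat) (X : set 'rV[F]_n).
Local Notation q := (2 * r)%N.
Local Notation cell := ('I_q * 'I_q)%type.
Local Notation N := (r * (2 * r).+1)%N.
Variable var : 'I_q -> 'I_q -> 'I_n.
Hypothesis var_bij : bijective (fun p : cell => var p.1 p.2).
Variables omega omega' : 'I_q -> 'I_q -> F.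
Hypothesis isotropic_rows : forall x, X x -> forall a b,
  \sum_u (x 0 (var (lo u) a) * x 0 (var (hi u) b) -
          x 0 (var (hi u) a) * x 0 (var (lo u) b)) = omega a b.
Hypothesis isotropic_cols : forall x, X x -> forall a b,
  \sum_u (x 0 (var a (lo u)) * x 0 (var b (hi u)) -
          x 0 (var a (hi u)) * x 0 (var b (lo u))) = omega' a b.

Let var_inj a b a' b' : var a b = var a' b' -> a = a' /\ b = b'.
Proof. by move=> E; have [] := @bij_inj _ _ _ var_bij (a, b) (a', b') E. Qed.

Let tvar a b := var b a.

Let tvar_inj a b a' b' : tvar a b = tvar a' b' -> a = a' /\ b = b'.
Proof. by case/var_inj. Qed.

Lemma wt_transpose m : wt tvar m = wt var m.
Proof.
rewrite /wt exchange_big; apply: eq_bigr => a _; apply: eq_bigr => b _.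
by rewrite /wt_cell /tvar mulnC [(b * a)%N]mulnC (addnC (wt_row _ b)) mulnC.
Qed.

Definition cells (m : 'X_{1..n}) : {set cell} := [set p | m (var p.1 p.2) != 0%N].

Definition lighter (m m' : 'X_{1..n}) :=
  (mdeg m' < mdeg m)%N \/ mdeg m' = mdeg m /\ (wt var m' < wt var m)%N.

Lemma cell_mono_le m k (i j : 'I_k -> 'I_q) : injective (fun t => (i t, j t)) ->
  (forall t, (i t, j t) \in cells m) -> (cell_mono var i j <= m)%MM.
Proof.
move=> ij_inj ijm; apply/mnm_lepP => v; rewrite mnm_sumE.
have [t /eqP tv|nv] := pickP (fun t => var (i t) (j t) == v); last first.
  by rewrite big1 // => t _; rewrite mnm1E nv.
rewrite (bigD1 t) //= big1 => [|t' t't].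
  by rewrite mnm1E tv eqxx addn0; have := ijm t; rewrite inE /= tv lt0n.
rewrite mnm1E; case: eqP => // E; case/eqP: t't; apply: ij_inj.
by move: E; rewrite -tv => /var_inj[-> ->].
Qed.

Lemma chain_reduction m k (s : seq cell) : size s = k.+2 -> sorted (@below r) s ->
  {subset s <= cells m} -> (k < r)%N ->
  (forall p, p \in s -> (p.1 < 2 * k.+1)%N) \/ (forall p, p \in s -> (p.2 < 2 * k.+1)%N) ->
  in_span X (lighter m) (fun x => 'X_[m].@[x 0]).
Proof.
move=> szs ss sm kr small.
have q0 : (0 < q)%N by lia.
pose a0 : 'I_q := Ordinal q0.
pose i (t : 'I_k.+2) := (nth (a0, a0) s t).1.
pose j (t : 'I_k.+2) := (nth (a0, a0) s t).2.
have ins (t : 'I_k.+2) : nth (a0, a0) s t \in s by rewrite mem_nth // szs.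
have inc (t u : 'I_k.+2) : (t < u)%N -> (i t < i u)%N /\ (j t < j u)%N.
  move=> tu; apply/andP; apply: (sorted_ltn_nth _ _ ss) => //; rewrite ?inE ?szs //.
  move=> y x z; rewrite /below => /andP[a b] /andP[c d].
  by rewrite (ltn_trans a c) (ltn_trans b d).
have leij : (cell_mono var i j <= m)%MM.
  apply: cell_mono_le => [t u [it _]|t]; last by rewrite /i /j -surjective_pairing; exact: sm.
  by apply: ord_inj; case: (ltngtP t u) => // /inc[]; rewrite it ltnn.
have red : in_span X (lighter (cell_mono var i j)) (fun x => 'X_[cell_mono var i j].@[x 0]).
  rewrite /lighter mdeg_cell_mono.
  case: small => small.
    apply: (row_reduction var_inj a0 isotropic_rows) => // [t u|t u|t].
    - by case/inc.
    - by case/inc.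
    exact: small.
  have iso x : X x -> forall a b, \sum_u (x 0 (tvar (lo u) a) * x 0 (tvar (hi u) b) -
      x 0 (tvar (hi u) a) * x 0 (tvar (lo u) b)) = omega' a b.
    move=> Xx a b; rewrite -(isotropic_cols Xx); apply: eq_bigr => u _.
    by rewrite /tvar; ring.
  have incj (t u : 'I_k.+2) : (t < u)%N -> (j t < j u)%N by case/inc.
  have inci (t u : 'I_k.+2) : (t < u)%N -> (i t < i u)%N by case/inc.
  have := row_reduction tvar_inj a0 iso incj inci kr (fun t => small _ (ins t)).
  rewrite !wt_transpose => H; apply: in_span_trans H _ => m' Qm'.
  apply: in_span_monomial; case: Qm' => [|[E lt]]; [by left|right].
  by split=> //; rewrite -wt_transpose.
apply: (in_span_ext (f := fun x : 'rV[F]_n => 'X_[m - cell_mono var i j].@[x 0] *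
  'X_[cell_mono var i j].@[x 0])).
  by move=> x _; rewrite -mevalM -mpolyXD submK.
have := submK leij; move: (m - _)%MM => D mE.
apply: in_span_mulm red => m' Qm'; rewrite /lighter -mE !mdegD !wtD.
by case: Qm' => [|[-> lt]]; [left; lia|right; split=> //; lia].
Qed.

Lemma nonface_reduction m : ~~ face (cells m) ->
  in_span X (lighter m) (fun x => 'X_[m].@[x 0]).
Proof.
rewrite negb_forall => /existsP[p]; rewrite negb_imply => /andP[pm].
have [s szs [ss sm lastp]] := level_chain pm.
(* A chain that is too long is cut to r + 1 cells; with l = r the row condition holds for every
   cell. *)
pose l := minn (level (cells m) p) r => nl.
have l0 : (0 < l)%N by move: nl (ltn_ord p.1); rewrite /l; lia.
have szt : size (take l.+1 s) = l.-1.+2.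
  by rewrite size_takel ?szs ?prednK // ltnS geq_minl.
apply: (chain_reduction szt) => [|p'||].
- by apply: (subseq_sorted _ (take_subseq _ _)) ss => y x z;
    rewrite /below => /andP[a b] /andP[c d]; rewrite (ltn_trans a c) (ltn_trans b d).
- by move=> /mem_take/sm.
- by rewrite prednK // geq_minr.
have lep p' : p' \in s -> (p'.1 <= p.1)%N /\ (p'.2 <= p.2)%N.
  move=> p's; have : (last p s == p') || below p' (last p s).
    move: ss p's; case/lastP: s {szs sm lastp szt} => // s y.
    rewrite last_rcons mem_rcons inE (sorted_pairwise (leT := @below r)); last first.
      by move=> y' x z; rewrite /below => /andP[a b] /andP[c d];
        rewrite (ltn_trans a c) (ltn_trans b d).
    rewrite pairwise_rcons eq_sym => /andP[/allP H _] /orP[-> //|/H ->].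
    by rewrite orbT.
  by rewrite lastp => /orP[/eqP <- //|/andP[/ltnW ? /ltnW ?]].
rewrite prednK //; have [lr|lr] := ltnP r (level (cells m) p).
  left => p' _; have := ltn_ord p'.1; rewrite /l; lia.
have -> : l = level (cells m) p by rewrite /l; lia.
move: nl; rewrite negb_and -!ltnNge => /orP[] lt; [left|right] => p' /mem_take/lep[]; lia.
Qed.

Lemma standard_span m : in_span X (fun m' => (mdeg m' <= mdeg m)%N /\ face (cells m'))
  (fun x => 'X_[m].@[x 0]).
Proof.
have [d] := ubnP (mdeg m); elim: d m => // d IHd m md.
have [w] := ubnP (wt var m); elim: w m md => // w IHw m md mw.
have [fm|nfm] := boolP (face (cells m)); first exact: in_span_monomial.
apply: in_span_trans (nonface_reduction nfm) _ => m' mm'.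
have sub m1 : (mdeg m1 <= mdeg m)%N -> in_span X
    (fun m' => (mdeg m' <= mdeg m1)%N /\ face (cells m')) (fun x => 'X_[m1].@[x 0]) ->
  in_span X (fun m' => (mdeg m' <= mdeg m)%N /\ face (cells m')) (fun x => 'X_[m1].@[x 0]).
  move=> le sp; apply: in_span_trans sp _ => m2 [le2 f2].
  by apply: in_span_monomial; rewrite (leq_trans le2).
case: mm' => [lt|[E lt]].
  by apply: sub (ltnW lt) (IHd _ _); lia.
by apply: sub (IHw _ _ _); rewrite ?E //; lia.
Qed.

Definition standard d : seq 'X_{1..n} :=
  map (@bmnm n d.+1) [seq m <- enum {: 'X_{1..n < d.+1}} | face (cells (bmnm m))].

Lemma standard_spanned d : spanned X d (standard d).
Proof.
move=> m md; have [p pQ pE] := standard_span m.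
exists (fun m' => p@_m') => x Xx; rewrite pE // {1}[p]mpolyE raddf_sum /=.
have us : uniq (standard d).
  rewrite map_inj_uniq => [|a b]; last exact: val_inj.
  by apply: filter_uniq; apply: enum_uniq.
rewrite [RHS](bigID (fun m' => m' \in msupp p)) /= [X in _ + X]big1 ?addr0; last first.
  by move=> m' /memN_msupp_eq0 E; rewrite /= E mul0r.
rewrite -[RHS]big_filter; under eq_bigr do rewrite mevalZ.
apply: perm_big; apply: uniq_perm => [||m']; rewrite ?filter_uniq ?msupp_uniq //.
rewrite mem_filter; case: (boolP (m' \in msupp p)) => //= /pQ[m'm fm'].
symmetry; apply/mapP; have m'd : (mdeg m' < d.+1)%N by rewrite ltnS (leq_trans m'm).
by exists (BMultinom m'd) => //; rewrite mem_filter fm' mem_enum.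
Qed.

Lemma mdeg_cells m : mdeg m = (\sum_(p in cells m) m (var p.1 p.2))%N.
Proof.
rewrite mdegE (reindex (fun p : cell => var p.1 p.2)); last exact: onW_bij.
by rewrite [LHS](bigID (mem (cells m))) /= [X in (_ + X)%N]big1 ?addn0 // => p;
  rewrite inE negbK => /eqP.
Qed.

Lemma eq_on_cells m m' (A : {set cell}) : cells m = A -> cells m' = A ->
  (forall p, p \in A -> m (var p.1 p.2) = m' (var p.1 p.2)) -> m = m'.
Proof.
move=> mA m'A E; apply/mnmP => v; have [g gK Kg] := var_bij; rewrite -(Kg v).
have [/E //|gA] := boolP (g v \in A).
have : g v \notin cells m by rewrite mA.
have : g v \notin cells m' by rewrite m'A.
by rewrite !inE !negbK => /eqP-> /eqP->.
Qed.

Lemma count_support_le d (A : {set cell}) :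
  (#|[set m : 'X_{1..n < d.+1} | cells m == A]| <= d.+1 ^ #|A|)%N.
Proof.
pose g (m : 'X_{1..n < d.+1}) : {ffun 'I_#|A| -> 'I_d.+1} :=
  [ffun k => inord (m (var (enum_val k).1 (enum_val k).2))].
have md (m : 'X_{1..n < d.+1}) v : (m v < d.+1)%N.
  by apply: leq_ltn_trans (bmdeg m); rewrite mdegE (bigD1 v) //= leq_addr.
rewrite -[d.+1 in leqRHS]card_ord -[#|A|]card_ord -card_ffun.
rewrite -(card_in_imset (f := g)); first exact: max_card.
move=> m m'; rewrite !inE => /eqP mA /eqP m'A /ffunP E; apply: val_inj.
apply: (eq_on_cells mA m'A) => p pA.
have := E (enum_rank_in pA p); rewrite !ffunE enum_rankK_in // => /(congr1 val).
by rewrite /= !inordK.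
Qed.

(** Lowering every exponent on the support by one leaves an arbitrary monomial in #|A| variables of
    degree at most [d - #|A|]. *)
Lemma count_support_bin d (A : {set cell}) :
  (#|[set m : 'X_{1..n < d.+1} | cells m == A]| <= 'C(d, #|A|))%N.
Proof.
have key (m : 'X_{1..n}) : cells m = A -> (mdeg m = #|A| +
    mdeg [multinom (m (var (enum_val k).1 (enum_val k).2)).-1 | k < #|A|])%N.
  move=> mA; rewrite mdeg_cells mA big_enum_val mdegE /=.
  transitivity (\sum_(k < #|A|) (1 + (m (var (enum_val k).1 (enum_val k).2)).-1))%N.
    apply: eq_bigr => k _; rewrite add1n prednK // lt0n.
    by have := enum_valP k; rewrite -{2}mA inE.
  rewrite big_split /= sum1_card card_ord; congr (_ + _)%N.
  by apply: eq_bigr => k _; rewrite mnmE.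
have [dA|Ad] := ltnP d #|A|.
  rewrite (_ : [set _ | _] = finset.set0) ?cards0 //; apply/setP => m; rewrite !inE.
  by apply/negP => /eqP/key; have := bmdeg m; lia.
have -> : 'C(d, #|A|) = 'C(#|A| + (d - #|A|), #|A|) by rewrite subnKC.
pose h (m : 'X_{1..n}) := [multinom (m (var (enum_val k).1 (enum_val k).2)).-1 | k < #|A|].
pose g (m : 'X_{1..n < d.+1}) : 'X_{1..#|A| < (d - #|A|).+1} := insubd bm0 (h m).
have gE m : m \in [set m : 'X_{1..n < d.+1} | cells m == A] -> g m = h m :> 'X_{1.. #|A|}.
  rewrite inE => /eqP/key mA; rewrite /g; apply: (@insubdK _ (fun m => mdeg m < _)%N).
  by rewrite -topredE /= ltnS -(leq_add2l #|A|) subnKC //; have := bmdeg m; rewrite mA -/(h m).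
rewrite -card_bmnm -(card_in_imset (f := g)); first exact: max_card.
move=> m m' mS m'S E; apply: val_inj; move: (mS) (m'S).
rewrite !inE => /eqP mA /eqP m'A; apply: (eq_on_cells mA m'A) => p pA.
have : h m = h m' by rewrite -!gE // E.
move=> /mnmP/(_ (enum_rank_in pA p)); rewrite !mnmE enum_rankK_in //.
by move: (pA) (pA); rewrite -{1}mA -{1}m'A !inE; lia.
Qed.

(** Faces of maximal size give the leading term; each smaller face contributes only to order N - 1
    in d. *)
Lemma size_standard d : (size (standard d) <=
  size (path_families r) * 'C(d, N) + #|{set cell}| * d.+1 ^ N.-1)%N.
Proof.
have -> : size (standard d) = (\sum_(A : {set cell} | face A)
    #|[set m : 'X_{1..n < d.+1} | cells m == A]|)%N.
  rewrite size_map -sum1_size big_filter big_enum_cond /=.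
  rewrite (partition_big (fun m : 'X_{1..n < d.+1} => cells m) (fun A => face A)) //=.
  apply: eq_bigr => A fA; rewrite -sum1dep_card; apply: eq_bigl => m.
  by case: eqP => [->|]; rewrite ?fA ?andbF.
rewrite (bigID (fun A : {set cell} => #|A| == N)) /= leq_add //.
  apply: (@leq_trans (\sum_(A : {set cell} | face A && (#|A| == N)) 'C(d, N))).
    by apply: leq_sum => A /andP[_ /eqP <-]; exact: count_support_bin.
  by rewrite sum_nat_cond_const leq_mul2r card_max_faces orbT.
apply: (@leq_trans (\sum_(A : {set cell} | face A && (#|A| != N)) d.+1 ^ N.-1)%N).
  apply: leq_sum => A /andP[fA nA]; apply: leq_trans (count_support_le d A) _.
  have lt : (#|A| < N)%N by rewrite ltn_neqAle nA face_card.
  by apply: leq_pexp2l => //; rewrite -ltnS (ltn_predK lt).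
by rewrite sum_nat_cond_const leq_mul2r max_card orbT.
Qed.
End StandardMonomials.

(** * Isotropy of rows and columns of symplectic matrices *)

Section SymplecticForm.
Variables (F : fieldType) (r : nat).
Local Notation q := (2 * r)%N.
Local Notation Om := (symp_form F r).

Lemma symp_formE m n (A : 'M[F]_(m, r + r)) (B : 'M_(r + r, n)) a b :
  (A *m Om *m B) a b = \sum_u (A a (lshift r u) * B (rshift r u) b -
                               A a (rshift r u) * B (lshift r u) b).
Proof.
rewrite -[A]hsubmxK -[B]vsubmxK /symp_form mul_row_block !mulmx0 !mulmx1 mulmxN mulmx1.
rewrite addr0 add0r mul_row_col mulNmx !mxE sumrB addrC; congr (_ - _);
  by apply: eq_bigr => u _; rewrite ?row_mxEl ?row_mxEr ?col_mxEu ?col_mxEd.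
Qed.

Lemma symp_form_sq : Om *m Om = - 1%:M.
Proof.
rewrite /symp_form mulmx_block scalar_mx_block opp_block_mx.
by rewrite !(mulmx0, mul0mx, mulNmx, mul1mx, mulmx1, addr0, add0r, oppr0).
Qed.

Lemma Sp_tr M : Sp F r M -> M *m Om *m M^T = Om.
Proof.
rewrite /Sp /= => H.
have : M *m (- (Om *m M^T *m Om)) = 1%:M.
  apply: mulmx1C; rewrite mulNmx -!mulmxA [M^T *m _]mulmxA H symp_form_sq opprK //.
rewrite mulmxN => /(congr1 (fun A => A *m Om)).
rewrite mulNmx mul1mx -!mulmxA symp_form_sq !mulmxN opprK mulmx1.
by rewrite mulmxA.
Qed.

(* Rows and columns are listed in the order l_0, r_0, l_1, r_1, ... of the
   symplectic pairs rather than in the block order of symp_form. *)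
Definition unpos (p : 'I_q) : 'I_(r + r) :=
  if odd p then rshift r (half_ord p) else lshift r (half_ord p).

Lemma unpos_lo u : unpos (lo u) = lshift r u.
Proof. by rewrite /unpos /= oddM half_lo. Qed.
Lemma unpos_hi u : unpos (hi u) = rshift r u.
Proof. by rewrite /unpos /= oddM half_hi. Qed.

Lemma unpos_inj : injective unpos.
Proof.
move=> a b /(congr1 val) E; apply: ord_inj; move: E (ltn_ord a) (ltn_ord b).
by rewrite /unpos; case: ifP; case: ifP => /=; lia.
Qed.

Definition spvar (a b : 'I_q) : 'I_((r + r) * (r + r)) := mxvec_index (unpos a) (unpos b).

Lemma spvar_bij : bijective (fun p : 'I_q * 'I_q => spvar p.1 p.2).
Proof.
apply: inj_card_bij => [[a b] [a' b'] /= E|].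
  have : forall i j i' j' : 'I_(r + r), mxvec_index i j = mxvec_index i' j' -> (i, j) = (i', j').
    move=> i j i' j' E'; have [g gK _] := curry_mxvec_bij (r + r) (r + r).
    by rewrite -[LHS]gK // -[RHS]gK //= E'.
  by move=> H; have [/unpos_inj -> /unpos_inj ->] := H _ _ _ _ E.
by rewrite card_prod !card_ord; nia.
Qed.

Lemma spvarE (M : 'M[F]_(r + r)) a b : mxvec M 0 (spvar a b) = M (unpos a) (unpos b).
Proof. exact: mxvecE. Qed.

Lemma Sp_isotropic_rows (x : 'rV[F]_((r + r) * (r + r))) : Sp_variety F r x -> forall a b,
  \sum_u (x 0 (spvar (lo u) a) * x 0 (spvar (hi u) b) -
          x 0 (spvar (hi u) a) * x 0 (spvar (lo u) b)) = Om (unpos a) (unpos b).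
Proof.
move=> [M SpM <-] a b; rewrite -[Om in RHS]SpM symp_formE; apply: eq_bigr => u _.
by rewrite !spvarE !mxE unpos_lo unpos_hi.
Qed.

Lemma Sp_isotropic_cols (x : 'rV[F]_((r + r) * (r + r))) : Sp_variety F r x -> forall a b,
  \sum_u (x 0 (spvar a (lo u)) * x 0 (spvar b (hi u)) -
          x 0 (spvar a (hi u)) * x 0 (spvar b (lo u))) = Om (unpos a) (unpos b).
Proof.
move=> [M SpM <-] a b; rewrite -[Om in RHS](Sp_tr SpM) symp_formE; apply: eq_bigr => u _.
by rewrite !spvarE !mxE unpos_lo unpos_hi.
Qed.

End SymplecticForm.

Lemma Sp_spanned (F : numFieldType) r d : exists2 S, spanned (Sp_variety F r) d S &
  (size S <= size (path_families r) * 'C(d, r * (2 * r).+1) +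
     #|{set 'I_(2 * r) * 'I_(2 * r)}| * d.+1 ^ (r * (2 * r).+1).-1)%N.
Proof.
exists (standard (@spvar r) d); last exact: size_standard (spvar_bij r) d.
pose om a b := symp_form F r (unpos a) (unpos b).
exact: (@standard_spanned F r _ _ _ (@spvar_bij r) om om
  (@Sp_isotropic_rows F r) (@Sp_isotropic_cols F r)).
Qed.

(** * Degenerations *)

Section InitialForm.
Variables (C : numFieldType) (M : nat) (w : 'I_M -> nat).

(* The coefficient of 'X^k is the part of weight k. *)
Definition graded : {mpoly C[M]} -> {poly {mpoly C[M]}} :=
  mmap (polyC \o @mpolyC M C) (fun i => 'X^(w i) * ('X_i)%:P).

Lemma gradedD a b : graded (a + b) = graded a + graded b.
Proof. exact: mmapD. Qed.

Lemma gradedM a b : graded (a * b) = graded a * graded b.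
Proof. exact: (rmorphM (mmap (polyC \o @mpolyC M C) _)). Qed.

Lemma map_eval_D (z : 'I_M -> C) s (p p' : {poly {mpoly C[M]}}) :
  (map_poly (meval z) (p + p')).[s] = (map_poly (meval z) p).[s] + (map_poly (meval z) p').[s].
Proof. by rewrite rmorphD hornerD. Qed.

Lemma map_eval_M (z : 'I_M -> C) s (p p' : {poly {mpoly C[M]}}) :
  (map_poly (meval z) (p * p')).[s] = (map_poly (meval z) p).[s] * (map_poly (meval z) p').[s].
Proof. by rewrite rmorphM hornerM. Qed.

Lemma graded_eval (z : 'I_M -> C) s a :
  (map_poly (meval z) (graded a)).[s] = a.@[fun i => s ^+ w i * z i].
Proof.
elim/mpoly_ring_ind: a => [a|j|a b IHa IHb|a b IHa IHb].
- by rewrite /graded mmapC /= map_polyC hornerC /= !mevalC.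
- rewrite /graded mmapX mmap1U mevalXU rmorphM /= map_polyXn map_polyC hornerM hornerXn.
  by rewrite hornerC /= mevalXU.
- by rewrite gradedD mevalD -IHa -IHb; exact: map_eval_D.
by rewrite gradedM mevalM -IHa -IHb; exact: map_eval_M.
Qed.

Lemma graded_inj a : graded a = 0 -> a = 0.
Proof.
move=> a0; apply: mpoly_vanishing => z; have := graded_eval z 1 a.
rewrite a0 rmorph0 horner0 => ->; apply: meval_eq => i; by rewrite expr1n mul1r.
Qed.

(** [P'] collects the parts of the least weight k occurring in a coefficient of [P]. Along the curve
    s ^ w * y(s) the relation is divisible by s ^ k; the quotient vanishes for s != 0, hence
    identically, and at s = 0 it is the value of [P']. *)
Lemma initial_form (P : {poly {mpoly C[M]}}) : P != 0 ->
  exists P' : {poly {mpoly C[M]}}, [/\ P' != 0, (size P' <= size P)%N &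
    forall (y : 'I_M -> {poly C}) (t : {poly C}),
    (forall s, s != 0 ->
      (map_poly (meval (fun i => s ^+ w i * (y i).[s])) P).[t.[s]] = 0) ->
    (map_poly (meval (fun i => (y i).[0])) P').[t.[0]] = 0].
Proof.
move=> PN0; pose nz k := [exists e : 'I_(size P), (graded P`_e)`_k != 0].
have exk : exists k, nz k.
  have ls : ((size P).-1 < size P)%N by rewrite prednK // lt0n size_poly_eq0.
  have lN0 : graded (lead_coef P) != 0.
    by apply/eqP => /graded_inj/eqP; rewrite lead_coef_eq0 (negPf PN0).
  exists (size (graded (lead_coef P))).-1; apply/existsP; exists (Ordinal ls).
  by rewrite /= -[_`_ _]/(lead_coef (graded (lead_coef P))) lead_coef_eq0.
case: (ex_minnP exk) => k /existsP[e0 e0N0] kmin.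
pose R e := drop_poly k (graded P`_e).
have RE (e : 'I_(size P)) : graded P`_e = R e * 'X^k.
  rewrite -[LHS](poly_take_drop k) -[RHS]add0r; congr (_ + _).
  apply/polyP => i; rewrite coef_take_poly coef0; case: ltnP => // ik.
  apply/eqP; apply: contraLR ik => N0; rewrite -leqNgt; apply: kmin.
  by apply/existsP; exists e.
pose P' := \poly_(e < size P) (R e)`_0.
exists P'; split; [|exact: size_poly|].
  apply/eqP => /polyP/(_ e0); rewrite coef_poly ltn_ord coef0 coef_drop_poly add0n.
  exact/eqP.
move=> y t H; pose f := mmap polyC y.
have fS s a : (f a).[s] = a.@[fun i => (y i).[s]].
  elim/mpoly_ring_ind: a => [a|j|a b IHa IHb|a b IHa IHb].
  - by rewrite /f mmapC mevalC hornerC.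
  - by rewrite /f mmapX mmap1U mevalXU.
  - by rewrite /f mmapD hornerD mevalD -IHa -IHb.
  by rewrite /f rmorphM /= hornerM mevalM -IHa -IHb.
pose G := \sum_(e < size P) (map_poly f (R e)).['X] * t ^+ e.
have GE s : G.[s] = \sum_(e < size P)
    (map_poly (meval (fun i => (y i).[s])) (R e)).[s] * t.[s] ^+ e.
  rewrite horner_sum; apply: eq_bigr => e _; rewrite hornerM horner_exp.
  rewrite horner_map_horner hornerX; congr (_.[_] * _).
  by apply/polyP => i; rewrite !coef_map_id0 ?fS ?rmorph0 ?horner0 // mevalC.
have G0 : G = 0.
  apply: poly_vanishing => s s0; apply: (mulfI (expf_neq0 k s0)).
  rewrite mulr0 -[RHS](H s s0) GE mulr_sumr.
  rewrite (horner_coef_wide _ (size_poly _ _)); apply: eq_bigr => e _.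
  rewrite coef_map_id0 ?meval0 // mulrA; congr (_ * _).
  by rewrite -graded_eval RE rmorphM /= map_polyXn hornerM hornerXn mulrC.
transitivity G.[0]; [rewrite GE|by rewrite G0 horner0].
have sP' : (size (map_poly (meval (fun i => (y i).[0%R])) P') <= size P)%N.
  exact: leq_trans (size_poly _ _) (size_poly _ _).
rewrite (horner_coef_wide _ sP'); apply: eq_bigr => e _; congr (_ * _).
by rewrite coef_map_id0 ?meval0 // coef_poly ltn_ord horner_coef0 coef_map_id0 ?meval0.
Qed.

End InitialForm.

Lemma idx_ind n N (Q : 'I_(n * N + N + n) -> Prop) :
  (forall i j, Q (idxA i j)) -> (forall j, Q (idxb n j)) -> (forall i, Q (idxc N i)) ->
  forall v, Q v.
Proof.
move=> QA Qb Qc v; case: (split_ordP v) => u ->; last exact: Qc.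
case: (split_ordP u) => u' ->; last exact: Qb.
by case/mxvec_indexP: u' => i j; exact: QA.
Qed.

(** Weights [w] on the rows of A and on c compensate the factors s ^ -w on x. So b = x A and T = x c
    keep weight 0, and the degree in T cannot grow. *)
Lemma Rel_degenerate (C : numClosedFieldType) n N (X X' : set 'rV[C]_n) (w : 'I_n -> nat) :
  (forall x', X' x' -> exists y : 'I_n -> {poly C}, (forall i, (y i).[0] = x' 0 i) /\
    forall s, s != 0 -> X (\row_i ((s ^+ w i)^-1 * (y i).[s]))) ->
  forall P : {poly {mpoly C[n * N + N + n]}}, P != 0 -> Rel X P ->
  exists P' : {poly {mpoly C[n * N + N + n]}},
    [/\ P' != 0, (size P' <= size P)%N & Rel X' P'].
Proof.
move=> limX P PN0 RP.
pose W : 'rV[nat]_(n * N + N + n) :=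
  pt (\matrix_(i, j) w i) (const_mx 0%N) (\row_i w i).
have [P' [P'N0 szP' HP']] := initial_form (W 0) PN0.
exists P'; split=> // A x' c /limX[y [y0 ys]].
pose yr : 'rV[{poly C}]_n := \row_i y i.
pose Y := pt (map_mx polyC A) (yr *m map_mx polyC A) (map_mx polyC c).
pose t := (yr *m (map_mx polyC c)^T) 0 0.
have x'E : x' = \row_i (y i).[0] by apply/rowP => i; rewrite mxE y0.
have YE : (fun i => (Y 0 i).[0]) =1 pt A (x' *m A) c 0.
  elim/idx_ind => [i j|j|i]; rewrite ?ptA ?ptb ?ptc !mxE ?hornerC //.
  by rewrite horner_sum; apply: eq_bigr => i _; rewrite !mxE hornerM hornerC y0.
have tE : t.[0] = (x' *m c^T) 0 0.
  rewrite /t !mxE horner_sum; apply: eq_bigr => i _.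
  by rewrite !mxE hornerM hornerC y0.
rewrite -tE /ev -(eq_map_poly (f := meval (fun i => (Y 0 i).[0]))); last first.
  by move=> a; apply: meval_eq.
apply: HP' => s s0.
pose As := \matrix_(i, j) (s ^+ w i * A i j).
pose cs := \row_i (s ^+ w i * c 0 i).
pose xs := \row_i ((s ^+ w i)^-1 * (y i).[s]).
have sw i : s ^+ w i != 0 by rewrite expf_neq0.
rewrite -[RHS](RP As xs cs (ys s s0)) /ev.
have -> : t.[s] = (xs *m cs^T) 0 0.
  rewrite /t !mxE horner_sum; apply: eq_bigr => i _.
  by rewrite !mxE hornerM hornerC mulrACA mulVf ?mul1r ?expf_neq0.
congr (_.[_]); apply: eq_map_poly => a; apply: meval_eq.
elim/idx_ind => [i j|j|i]; rewrite ?ptA ?ptb ?ptc !mxE ?hornerC //.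
rewrite expr0 mul1r horner_sum; apply: eq_bigr => i _.
by rewrite !mxE hornerM hornerC mulrACA mulVf ?mul1r ?expf_neq0.
Qed.

(** * Degeneration to products of triangular matrices *)

Section SpFactor.
Variables (F : fieldType) (r : nat).

Lemma Sp_mul M M' : Sp F r M -> Sp F r M' -> Sp F r (M *m M').
Proof.
rewrite /Sp /= => H H'; rewrite trmx_mul -!mulmxA (mulmxA (symp_form F r)).
by rewrite (mulmxA M^T) (mulmxA M^T) H mulmxA.
Qed.

Lemma Sp_lower (L K D : 'M[F]_r) : K *m L = 1%:M -> (L^T *m D)^T = L^T *m D ->
  Sp F r (block_mx L 0 D K^T).
Proof.
move=> KL LD; rewrite /Sp /symp_form /= tr_block_mx !mulmx_block trmxK trmx0.
rewrite !(mulmx0, mul0mx, addr0, add0r, mulmx1, mulmxN, mulNmx).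
rewrite -trmx_mul KL trmx1; move: LD; rewrite trmx_mul trmxK => ->.
by rewrite addrC subrr.
Qed.

Lemma Sp_factor (L K D L' K' D' : 'M[F]_r) :
  K *m L = 1%:M -> (L^T *m D)^T = L^T *m D ->
  K' *m L' = 1%:M -> (L'^T *m D')^T = L'^T *m D' ->
  Sp F r (block_mx (L *m L'^T) (L *m D'^T) (D *m L'^T) (D *m D'^T + K^T *m K')).
Proof.
move=> KL LD KL' LD'; have S1 := Sp_lower KL LD.
have S2 : Sp F r (block_mx L' 0 D' K'^T)^T.
  by rewrite /Sp /= trmxK; exact: Sp_tr (Sp_lower KL' LD').
have := Sp_mul S1 S2; rewrite tr_block_mx mulmx_block trmx0 trmxK.
by rewrite !(mulmx0, mul0mx, addr0).
Qed.

End SpFactor.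

Section LowerTriangular.
Variables (F : fieldType) (r : nat).
Implicit Types L D : 'M[F]_r.

Definition lower L := forall i j : 'I_r, (i < j)%N -> L i j = 0.

Lemma lower_unit L : lower L -> (forall i, L i i != 0) -> L \in unitmx.
Proof.
move=> lL dL; rewrite unitmxE det_trig; last by apply/is_trig_mxP.
by rewrite unitfE; apply/prodf_neq0 => i _.
Qed.

Lemma lower_inv L : lower L -> (forall i, L i i != 0) -> lower (invmx L).
Proof.
move=> lL dL i j; have [k] := ubnP (i : nat); elim: k i => // k IH i ik ij.
have := mulmxV (lower_unit lL dL) => /matrixP/(_ i j).
rewrite !mxE -val_eqE /= (ltn_eqF ij) (bigD1 i) //= big1 ?addr0 => [|l li].
  by move/eqP; rewrite mulf_eq0 (negPf (dL i)) => /eqP.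
move: li; rewrite -val_eqE /= neq_ltn => /orP[li|li]; last by rewrite lL ?mul0r.
by rewrite IH ?mulr0 //; lia.
Qed.

Definition strict_upper (G : 'M[F]_r) := \matrix_(i, j) (if (i < j)%N then G i j else 0).

Lemma symmetrized G : (G + strict_upper (G^T - G))^T = G + strict_upper (G^T - G).
Proof.
apply/matrixP => i j; rewrite !mxE.
by case: ltngtP => [_|_|/ord_inj ->]; rewrite ?addr0 // addrC subrK.
Qed.

Lemma strict_upper_eq G i j : strict_upper G i j = (i < j)%N%:R * G i j.
Proof. by rewrite mxE; case: ifP; rewrite ?mul1r ?mul0r. Qed.

Variables L D : 'M[F]_r.
Hypotheses (lL : lower L) (dL : forall i, L i i != 0) (lD : lower D).

(* The second summand is small for the weights below and makes L^T D symmetric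
   after scaling row k of L and D by s^-(r - k). *)
Definition sym_def : 'M[{poly F}]_r := \matrix_(k, j) ((D k j)%:P +
  \sum_(i < r) \sum_(k' < r) ((i < j)%N%:R * (invmx L i k * (L k' j * D k' i - L k' i * D k' j)))%:P
     * 'X^(2 * (k' - k))).

(** A surviving term has k <= i because the inverse of L is lower triangular, i < j, and j <= k'
    because L and D are. So the exponent 2 (k' - k) in [sym_def] is positive and the correction
    vanishes at s = 0. *)
Lemma sym_def_term (i j k k' : 'I_r) :
  (i < j)%N%:R * (invmx L i k * (L k' j * D k' i - L k' i * D k' j)) = 0 \/ (k < k')%N.
Proof.
have [ij|] := ltnP i j; last by left; rewrite mul0r.
have [ik|ki] := ltnP i k; first by left; rewrite (lower_inv lL dL) // mul0r mulr0.
have [k'j|jk'] := ltnP k' j; last by right; lia.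
by left; rewrite (lL k'j) (lD k'j) mul0r mulr0 subrr !mulr0.
Qed.

Lemma sym_def0 k j : (sym_def k j).[0] = D k j.
Proof.
rewrite mxE hornerD hornerC horner_sum big1 ?addr0 // => i _.
rewrite horner_sum big1 // => k' _; rewrite hornerM hornerC hornerXn.
case: (sym_def_term i j k k') => [->|kk']; first by rewrite mul0r.
by rewrite expr0n; case: eqP => [|_]; [lia|rewrite mulr0].
Qed.

(** With G = (Ui L)^T (Ui D), adding the strictly upper part of G^T - G symmetrizes G. Pulling this
    part back through (Ui L)^T Ui produces the inverse of L and the powers of s in [sym_def]. *)
Lemma sym_def_sym s : s != 0 ->
  let Ui := diag_mx (\row_(k < r) s ^- (r - k)) in
  let Ds := map_mx (horner_eval s) sym_def in
  ((Ui *m L)^T *m (Ui *m Ds))^T = (Ui *m L)^T *m (Ui *m Ds).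
Proof.
move=> s0 Ui Ds; pose G := (Ui *m L)^T *m (Ui *m D).
suff -> : (Ui *m L)^T *m (Ui *m Ds) = G + strict_upper (G^T - G) by exact: symmetrized.
have GE i j : G i j = \sum_(k < r) s ^- (2 * (r - k)) * (L k i * D k j).
  rewrite /G mxE; apply: eq_bigr => k _; rewrite !mul_diag_mx !mxE mul2n -addnn exprD invfM.
  by ring.
have GGE i j : (G^T - G) i j =
    \sum_(k < r) s ^- (2 * (r - k)) * (L k j * D k i - L k i * D k j).
  have -> : (G^T - G) i j = G j i - G i j by rewrite [LHS]mxE [G^T i j]mxE [(- G) i j]mxE.
  rewrite !GE -sumrB; apply: eq_bigr => k _; ring.
pose U2 := diag_mx (\row_(k < r) s ^+ (2 * (r - k))).
have DsE : Ds = D + U2 *m ((invmx L)^T *m strict_upper (G^T - G)).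
  apply/matrixP => k j; rewrite mul_diag_mx !mxE horner_evalE hornerD hornerC.
  congr (_ + _); rewrite mulr_sumr horner_sum; apply: eq_bigr => i _.
  rewrite strict_upper_eq GGE.
  rewrite horner_sum !mulr_sumr; apply: eq_bigr => k' _.
  rewrite hornerM hornerC hornerXn !mxE.
  transitivity (s ^+ (2 * (r - k)) * s ^- (2 * (r - k')) *
    ((i < j)%N%:R * (invmx L i k * (L k' j * D k' i - L k' i * D k' j)))); last by ring.
  rewrite mulrC; case: (sym_def_term i j k k') => [->|kk']; first by rewrite !mulr0.
  congr (_ * _); have -> : (2 * (r - k) = 2 * (k' - k) + 2 * (r - k'))%N.
    by have := ltn_ord k'; lia.
  by rewrite exprD mulfK // expf_neq0.
have UU : U2 *m (Ui *m Ui) = 1%:M.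
  apply/matrixP => i j; rewrite !mul_diag_mx !mxE; case: eqP => [->|]; rewrite ?mulr0n ?mulr0 //.
  by rewrite mulr1n mul2n -addnn exprD -invfM divff // mulf_neq0 ?expf_neq0.
have UiT : Ui^T = Ui by rewrite tr_diag_mx.
rewrite DsE !mulmxDr -/G; congr (_ + _).
rewrite trmx_mul UiT -!mulmxA (mulmxA Ui) (mulmxA (Ui *m Ui)).
have -> : Ui *m Ui *m U2 = 1%:M by exact: mulmx1C UU.
by rewrite mul1mx mulmxA -trmx_mul mulVmx ?lower_unit // trmx1 mul1mx.
Qed.

End LowerTriangular.

Section SpLimit.
Variables (F : fieldType) (r : nat).

Definition cell_height : 'I_((r + r) * (r + r)) -> nat :=
  let h := row_mx (\row_(k < r) (r - k)%N) (\row_(k < r) (r - k)%N) in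
  mxvec (\matrix_(a, b) (h ord0 a + h ord0 b)%N) ord0.

Definition triangular_products (x : 'rV[F]_((r + r) * (r + r))) : Prop :=
  exists L D L' D' : 'M[F]_r, [/\ lower L /\ (forall i, L i i != 0), lower D,
    lower L' /\ (forall i, L' i i != 0), lower D' &
    x = mxvec (block_mx (L *m L'^T) (L *m D'^T) (D *m L'^T) (D *m D'^T))].

(** In [Sp_factor] row k of each block of both factors is scaled by s ^ -(r - k). Once these scalars
    are removed, the block K^T K' carries positive powers of s, like the corrections in [sym_def],
    and the limit is (L; D) (L'; D')^T free of symmetry conditions. *)
Lemma Sp_limit x : triangular_products x ->
  exists y : 'I_((r + r) * (r + r)) -> {poly F}, (forall i, (y i).[0] = x 0 i) /\
    forall s, s != 0 -> Sp_variety F r (\row_i ((s ^+ cell_height i)^-1 * (y i).[s])).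
Proof.
move=> [L [D [L' [D' [[lL dL] lD [lL' dL'] lD' ->]]]]].
pose E : 'M[{poly F}]_r := \matrix_(i, j)
  ((((invmx L)^T *m invmx L') i j)%:P * 'X^(2 * (r - i) + 2 * (r - j))).
pose cst := map_mx (@polyC F).
pose Mh : 'M[{poly F}]_(r + r) := block_mx (cst _ _ (L *m L'^T)) (cst _ _ L *m (sym_def L' D')^T)
  (sym_def L D *m (cst _ _ L')^T) (sym_def L D *m (sym_def L' D')^T + E).
have cstK s m n (A : 'M[F]_(m, n)) : map_mx (horner_eval s) (cst _ _ A) = A.
  by apply/matrixP => i j; rewrite !mxE horner_evalE hornerC.
have MhE s : map_mx (horner_eval s) Mh = block_mx (L *m L'^T)
    (L *m (map_mx (horner_eval s) (sym_def L' D'))^T)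
    (map_mx (horner_eval s) (sym_def L D) *m L'^T)
    (map_mx (horner_eval s) (sym_def L D) *m (map_mx (horner_eval s) (sym_def L' D'))^T +
     map_mx (horner_eval s) E).
  by rewrite map_block_mx map_mxD !map_mxM -!map_trmx !cstK.
exists (mxvec Mh 0); split=> [v|s s0].
  have E0 : map_mx (horner_eval 0) E = 0.
    apply/matrixP => i j; rewrite !mxE horner_evalE hornerM hornerXn expr0n.
    by case: eqP => [|_]; [have := ltn_ord i; lia|rewrite mulr0].
  have S0 A B : lower A -> (forall i, A i i != 0) -> lower B ->
      map_mx (horner_eval 0) (@sym_def F r A B) = B.
    by move=> lA dA lB; apply/matrixP => i j; rewrite mxE horner_evalE sym_def0.
  case/mxvec_indexP: v => i j; rewrite !mxvecE -horner_evalE.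
  have := MhE 0; rewrite E0 addr0 !S0 // => /matrixP/(_ i j).
  by rewrite mxE.
pose Ui := diag_mx (\row_(k < r) s ^- (r - k)).
pose U := diag_mx (\row_(k < r) s ^+ (r - k)).
have UUi : U *m Ui = 1%:M.
  apply/matrixP => i j; rewrite !mul_diag_mx !mxE; case: eqP => [->|]; rewrite ?mulr0n ?mulr0 //.
  by rewrite mulr1n divff ?expf_neq0.
have UiT : Ui^T = Ui by rewrite tr_diag_mx.
have UT : U^T = U by rewrite tr_diag_mx.
pose Ds := map_mx (horner_eval s) (sym_def L D).
pose Ds' := map_mx (horner_eval s) (sym_def L' D').
have inv A : lower A -> (forall i, A i i != 0) -> (invmx A *m U) *m (Ui *m A) = 1%:M.
  move=> lA dA; rewrite -mulmxA (mulmxA U) UUi mul1mx mulVmx //; exact: lower_unit.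
have := Sp_factor (inv L lL dL) (sym_def_sym lL dL lD s0) (inv L' lL' dL')
  (sym_def_sym lL' dL' lD' s0).
rewrite -/Ui -/Ds -/Ds'; set M := block_mx _ _ _ _ => SpM.
exists M => //; apply/rowP => v; rewrite [RHS]mxE; case/mxvec_indexP: v => i j.
have ME : M = diag_mx (row_mx (\row_(k < r) s ^- (r - k)) (\row_(k < r) s ^- (r - k))) *m
    map_mx (horner_eval s) Mh *m
    diag_mx (row_mx (\row_(k < r) s ^- (r - k)) (\row_(k < r) s ^- (r - k))).
  rewrite MhE !diag_mx_row -/Ui -/Ds -/Ds' !mulmx_block.
  rewrite !(mulmx0, mul0mx, addr0, add0r) /M !trmx_mul UiT UT !mulmxA.
  congr (block_mx _ _ _ _); rewrite mulmxDr mulmxDl !mulmxA; congr (_ + _).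
  have -> : U *m (invmx L)^T *m invmx L' *m U = U *m ((invmx L)^T *m invmx L') *m U.
    by rewrite !mulmxA.
  apply/matrixP => a b; rewrite !mul_mx_diag [LHS]mxE [RHS]mxE !mul_diag_mx.
  rewrite [X in X * _ = _]mxE [X in _ = X * _]mxE [map_mx _ _ _ _]mxE [E _ _]mxE.
  rewrite horner_evalE hornerM hornerC hornerXn !mxE mul2n mul2n -!addnn !exprD.
  have na : s ^+ (r - a) != 0 by rewrite expf_neq0.
  have nb : s ^+ (r - b) != 0 by rewrite expf_neq0.
  by field; rewrite na nb.
rewrite !mxvecE ME mul_mx_diag mxE mul_diag_mx mxE [map_mx _ _ _ _]mxE horner_evalE.
rewrite mulrAC; congr (_ * _).
have dE (a : 'I_(r + r)) : row_mx (\row_(k < r) s ^- (r - k)) (\row_(k < r) s ^- (r - k)) 0 a =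
    s ^- (row_mx (\row_(k < r) (r - k)%N) (\row_(k < r) (r - k)%N) ord0 a).
  by case: (split_ordP a) => k ->; rewrite ?row_mxEl ?row_mxEr !mxE.
by rewrite /cell_height mxvecE mxE exprD invfM -!dE.
Qed.

End SpLimit.

(** * Algebraically independent functions *)

Section SpIndependence.
Variables (F : numFieldType) (r : nat).
Local Notation n := ((r + r) * (r + r))%N.
Local Notation N := (r * (2 * r).+1)%N.

Definition upper_pair := {p : 'I_r * 'I_r | (p.1 <= p.2)%N}.

Definition sp_coord : finType := ('I_r * 'I_r + (upper_pair + upper_pair))%type.

Lemma card_sp_coord : #|sp_coord| = N.
Proof.
have : (#|[pred p : 'I_r * 'I_r | (p.1 <= p.2)%N]| +
        #|[pred p : 'I_r * 'I_r | (p.1 <= p.2)%N]| = r * r + r)%N.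
  rewrite -{2}(card_in_imset (f := fun p : 'I_r * 'I_r => (p.2, p.1))); last first.
    by move=> [a b] [c d] _ _ [-> ->].
  rewrite -cardUI; congr (_ + _)%N.
    rewrite -[RHS](_ : #|{: 'I_r * 'I_r}| = _); last by rewrite card_prod card_ord.
    apply: eq_card => -[a b]; rewrite !inE /=.
    have [//|ba] := leqP a b; apply/imsetP; exists (b, a) => //.
    by rewrite inE /= ltnW.
  rewrite -[RHS](card_ord r) -(card_in_imset (f := fun a : 'I_r => (a, a))); last first.
    by move=> a b _ _ [].
  apply: eq_card => -[a b]; rewrite !inE /=; apply/andP/imsetP.
    move=> [ab /imsetP[[c d]]]; rewrite inE /= => cd [ac bd].
    by exists a => //; congr (_, _); apply: ord_inj; rewrite ac bd in ab *; lia.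
  move=> [c _ [-> ->]]; split=> //; apply/imsetP; exists (c, c) => //.
  by rewrite inE /=.
by move=> E; rewrite !card_sum card_prod !card_ord !card_sig E; nia.
Qed.

Definition coord_of (k : 'I_N) : sp_coord := enum_val (cast_ord (esym card_sp_coord) k).
Definition of_coord (t : sp_coord) : 'I_N := cast_ord card_sp_coord (enum_rank t).

Lemma coord_ofK : cancel coord_of of_coord.
Proof. by move=> k; rewrite /of_coord /coord_of enum_valK cast_ordKV. Qed.
Lemma of_coordK : cancel of_coord coord_of.
Proof. by move=> t; rewrite /of_coord /coord_of cast_ordK enum_rankK. Qed.

Local Notation Z a b := ('X_(mxvec_index a b) : {mpoly F[n]}).

(* In blocks [A, B; C, D]: the entries of A and, above the diagonal, those of
   the symmetric matrices A^T C and A B^T. *)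
Definition sp_chart (k : 'I_N) : {mpoly F[n]} :=
  match coord_of k with
  | inl p => Z (lshift r p.1) (lshift r p.2)
  | inr (inl p) => \sum_u Z (lshift r u) (lshift r (val p).1) * Z (rshift r u) (lshift r (val p).2)
  | inr (inr p) => \sum_u Z (lshift r (val p).1) (lshift r u) * Z (lshift r (val p).2) (rshift r u)
  end.

(** For every invertible A and all symmetric S and T, [Sp_factor] with L' = 1 yields a symplectic
    matrix with A^T C = S and A B^T = T. So the chart takes every value with det A nonzero, and a
    polynomial vanishing there is zero. *)
Lemma Sp_alg_indep : alg_indep_on (Sp_variety F r) sp_chart.
Proof.
move=> P HP; apply: contrapT => /eqP PN0.
pose A (v : 'rV[F]_N) : 'M_r := \matrix_(i, j) v 0 (of_coord (inl (i, j))).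
pose sym (inj : upper_pair -> sp_coord) (v : 'rV[F]_N) : 'M_r := \matrix_(i, j)
  (if insub (i, j) is Some p then v 0 (of_coord (inj p))
   else if insub (j, i) is Some p then v 0 (of_coord (inj p)) else 0).
have symT inj v : (sym inj v)^T = sym inj v.
  apply/matrixP => i j; rewrite !mxE.
  case: insubP => [p ij pE|ij]; case: insubP => [p' ji p'E|ji] //.
  congr (v _ (of_coord (inj _))); apply: val_inj; rewrite pE p'E /=.
  by congr (_, _); apply: ord_inj; move: ij ji => /=; lia.
pose g (b : bool) (v : 'rV[F]_N) := if b then P.@[v 0] else \det (A v).
have [v gv] : exists v, forall b, g b v != 0.
  apply: polyfun_avoid_fin => [[]|[]]; rewrite /g.
  - exact: polyfun_meval.
  - apply: polyfun_det => i j; apply: (eq_polyfun (f := fun w => w 0 (of_coord (inl (i, j))))); [move=> w|exact: polyfun_coord].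
    by rewrite mxE.
  - exact: mpoly_nonvanishing.
  exists (\row_k (if coord_of k is inl p then (p.1 == p.2)%:R else 0)).
  rewrite (_ : A _ = 1%:M) ?det1 ?oner_neq0 //.
  by apply/matrixP => i j; rewrite !mxE of_coordK.
have := gv false; rewrite /g -unitfE -[_ \is a GRing.unit]/(A v \in unitmx) => uA.
set L := A v in uA *; pose K := invmx L.
have KL : K *m L = 1%:M by exact: mulVmx.
have LK : L *m K = 1%:M by exact: mulmxV.
have LTKT : L^T *m K^T = 1%:M by rewrite -trmx_mul KL trmx1.
pose S := sym (fun p => inr (inl p)) v; pose T := sym (fun p => inr (inr p)) v.
pose D := K^T *m S; pose D' := (K *m T *m K^T)^T.
have SpM : Sp F r (block_mx (L *m 1%:M^T) (L *m D'^T) (D *m 1%:M^T) (D *m D'^T + K^T *m 1%:M)).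
  apply: Sp_factor => //.
  - by rewrite /D mulmxA LTKT mul1mx; exact: symT.
  - by rewrite mulmx1.
  - by rewrite trmx1 !mul1mx /D' !trmx_mul !trmxK symT !mulmxA.
case/eqP: (gv true); rewrite /g -[RHS](HP (mxvec (block_mx (L *m 1%:M^T) (L *m D'^T)
  (D *m 1%:M^T) (D *m D'^T + K^T *m 1%:M)))); last by exists (block_mx (L *m 1%:M^T) (L *m D'^T)
  (D *m 1%:M^T) (D *m D'^T + K^T *m 1%:M)).
apply: meval_eq => k; rewrite trmx1 !mulmx1.
have -> : L *m D'^T = T *m K^T by rewrite /D' trmxK !mulmxA LK mul1mx.
rewrite /sp_chart; case E : (coord_of k) => [[i j]|[p|p]].
- rewrite mevalXU mxvecE block_mxEul mxE; congr (v _ _).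
  by rewrite -E coord_ofK.
- rewrite raddf_sum /=.
  transitivity ((L^T *m D) (val p).1 (val p).2).
    rewrite /D mulmxA LTKT mul1mx mxE; case: insubP => [p' ij pE|]; last first.
      by rewrite -surjective_pairing (valP p).
    congr (v _ _); rewrite -[LHS]coord_ofK E; congr (of_coord (inr (inl _))).
    by apply: val_inj; rewrite pE -surjective_pairing.
  rewrite mxE; apply: eq_bigr => u _.
  by rewrite mevalM !mevalXU !mxvecE block_mxEul block_mxEdl mxE.
rewrite raddf_sum /=.
transitivity ((L *m (T *m K^T)^T) (val p).1 (val p).2).
  rewrite trmx_mul trmxK symT mulmxA LK mul1mx mxE; case: insubP => [p' ij pE|]; last first.
    by rewrite -surjective_pairing (valP p).
  congr (v _ _); rewrite -[LHS]coord_ofK E; congr (of_coord (inr (inr _))).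
  by apply: val_inj; rewrite pE -surjective_pairing.
rewrite mxE; apply: eq_bigr => u _.
by rewrite mevalM !mevalXU !mxvecE block_mxEul block_mxEur [_^T _ _]mxE.
Qed.

End SpIndependence.

(** * Degeneration of rank-one matrices to lattice paths *)

Section PathLimits.
Variables (F : fieldType) (r : nat).
Local Notation q := (2 * r)%N.
Variable C : nat -> nat -> nat.
Hypothesis PC : path_system r C.

Lemma path_mono l i i' : (l < r -> 2 * l <= i -> i <= i' -> i' <= q -> C l i' <= C l i)%N.
Proof.
move=> lr li ii'; have [d ->] : exists d, i' = (i + d)%N by exists (i' - i)%N; lia.
elim: d => [|d IH]; rewrite ?addn0 ?addnS // => idq.
by apply: leq_trans (IH _); [apply: (path_desc PC) => //; lia | exact: ltnW].
Qed.

(** Rows and columns joined by the cells of a path form a tree, so nonzero entries on it extend to a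
    rank-one matrix. Each new row shares just one column, [C l i0], with the earlier ones: it fixes
    a_i, and the new columns then fix b_j. *)
Lemma path_factor l (X : nat -> nat -> F) : (l < r)%N ->
  (forall i j, (i < q)%N -> on_path C l i j -> X i j != 0) ->
  exists a b : nat -> F, [/\ forall i, a i != 0, forall j, b j != 0 &
    forall i j, (i < q)%N -> on_path C l i j -> a i * b j = X i j].
Proof.
move=> lr XN0.
suff H m : (2 * l + m <= q)%N -> exists a b : nat -> F,
    [/\ forall i, a i != 0, forall j, b j != 0 &
      forall i j, (i < 2 * l + m)%N -> on_path C l i j -> a i * b j = X i j].
  have [|a [b [aN0 bN0 ab]]] := H (q - 2 * l)%N; first by lia.
  by exists a, b; split=> // i j iq; apply: ab; lia.
elim: m => [_|m IH lm].
  exists (fun=> 1), (fun=> 1); split=> [i|j|i j il /andP[li _]]; rewrite ?oner_neq0 //.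
  by rewrite addn0 ltnNge li in il.
have [|a [b [aN0 bN0 ab]]] := IH; first by lia.
pose i0 := (2 * l + m)%N.
have i0q : (i0 < q)%N by rewrite /i0; lia.
have desc : (C l i0.+1 <= C l i0)%N by apply: (path_desc PC) => //; rewrite /i0; lia.
have on0 j : (C l i0.+1 <= j <= C l i0)%N -> on_path C l i0 j.
  by rewrite /on_path => ->; rewrite /i0 leq_addr.
have X0 : X i0 (C l i0) != 0 by apply: XN0 => //; apply: on0; rewrite desc leqnn.
pose a' := X i0 (C l i0) / b (C l i0).
have a'N0 : a' != 0 by rewrite mulf_neq0 ?invr_eq0.
exists (fun i => if i == i0 then a' else a i),
  (fun j => if (C l i0.+1 <= j < C l i0)%N then X i0 j / a' else b j).
split=> [i|j|i j].
- by case: ifP.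
- case: ifP => // /andP[j1 j2]; rewrite mulf_neq0 ?invr_eq0 //.
  by apply: XN0 => //; apply: on0; rewrite j1 ltnW.
rewrite addnS ltnS leq_eqVlt => /orP[/eqP -> | ii0 onij].
  rewrite -/i0 eqxx => /and3P[_ j1 j2]; rewrite j1 /=.
  case: ltnP => [_|j3]; first by rewrite mulrC mulfVK.
  have -> : j = C l i0 by lia.
  by rewrite /a' mulfVK.
rewrite (ltn_eqF ii0); case: ifP => [/andP[_ j2]|_]; last exact: ab.
have /and3P[li j1 _] := onij.
by have := @path_mono l i.+1 i0 lr; rewrite /i0 in ii0 j2 *; lia.
Qed.

(** The excess of i * j over a function of i plus a function of j ([path_defectE]); it is zero
    exactly on the path. Scaling entry (i, j) by s ^ (i * j) thus contracts a suitably scaled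
    rank-one matrix onto the path. *)
Definition path_defect l i j :=
  (\sum_(2 * l <= k < i) (j - C l k.+1) + \sum_(i <= k < q.-1) (C l k.+1 - j))%N.
Definition row_shift l i := (\sum_(2 * l <= k < i) C l k.+1)%N.
Definition col_shift l j := (\sum_(2 * l <= k < q.-1) (C l k.+1 - j))%N.

Lemma path_defectE l i j : (2 * l <= i < q)%N ->
  (i * j + col_shift l j = row_shift l i + 2 * l * j + path_defect l i j)%N.
Proof.
move=> /andP[li iq]; rewrite /col_shift /path_defect (big_cat_nat li) /=; last by lia.
rewrite !addnA; congr (_ + _)%N.
have -> : (i * j = 2 * l * j + \sum_(2 * l <= k < i) j)%N.
  by rewrite sum_nat_const_nat; nia.
have : (\sum_(2 * l <= k < i) j + \sum_(2 * l <= k < i) (C l k.+1 - j) =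
    row_shift l i + \sum_(2 * l <= k < i) (j - C l k.+1))%N.
  by rewrite -!big_split /=; apply: eq_bigr => k _; lia.
lia.
Qed.

Lemma path_defect_eq0 l i j : (l < r)%N -> (2 * l <= i < q)%N -> (2 * l <= j < q)%N ->
  (path_defect l i j == 0%N) = on_path C l i j.
Proof.
move=> lr /andP[li iq] /andP[lj jq]; apply/eqP/idP => [d0|].
  rewrite /on_path li /=; apply/andP; split; rewrite leqNgt; apply/negP => lt.
    have iq' : (i < q.-1)%N.
      have [//|] := ltnP i q.-1; move=> qi; have ii : i.+1 = q by lia.
      by move: lt; rewrite ii (path_end PC) //; lia.
    by move: d0; rewrite /path_defect (big_ltn iq'); lia.
  case: i li iq lt d0 => [|i] li iq lt d0.
    by move: lt; rewrite (path_inactive PC) //; lia.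
  have [il|il] := ltnP i (2 * l).
    by move: lt; rewrite (path_inactive PC) //; lia.
  by move: d0; rewrite /path_defect big_nat_recr //=; lia.
move=> /and3P[_ j1 j2]; rewrite /path_defect big_nat_cond big1.
  rewrite big_nat_cond big1 // => k /andP[/andP[ik kq] _].
  by have := @path_mono l i.+1 k.+1 lr; lia.
move=> k /andP[/andP[lk ki] _].
by have := @path_mono l k.+1 i lr; lia.
Qed.

End PathLimits.

Section TriangularLimits.
Variables (F : fieldType) (r : nat).
Local Notation q := (2 * r)%N.
Local Notation n := ((r + r) * (r + r))%N.

Definition path_torus (x : 'rV[F]_n) : Prop := exists2 C, path_system r C &
  forall a b : 'I_q, (x 0 (spvar a b) != 0) = on_paths r C a b.

Lemma unposE (T : Type) (f : 'I_(r + r) -> T) a : f (unpos a) =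
  if odd a then f (rshift r (half_ord a)) else f (lshift r (half_ord a)).
Proof. by rewrite /unpos; case: ifP. Qed.

Lemma lo_hiE (a : 'I_q) : a = if odd a then hi (half_ord a) else lo (half_ord a).
Proof. by apply: ord_inj; case: ifP => /=; lia. Qed.

Definition cell_product : 'I_n -> nat :=
  let p := row_mx (\row_(k < r) (2 * k)%N) (\row_(k < r) (2 * k).+1) in
  mxvec (\matrix_(a, b) (p ord0 a * p ord0 b)%N) ord0.

Lemma cell_productE a b : cell_product (spvar a b) = (a * b)%N.
Proof.
rewrite /cell_product mxvecE mxE.
have pE (c : 'I_q) : row_mx (\row_(k < r) (2 * k)%N) (\row_(k < r) (2 * k).+1) ord0 (unpos c) = c.
  rewrite unposE {4}[c]lo_hiE.
  by case: ifP; rewrite ?row_mxEl ?row_mxEr mxE.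
by rewrite !pE.
Qed.

Lemma triangular_productE (A B : 'I_r -> 'I_q -> F) a b :
  let part (A : 'I_r -> 'I_q -> F) (f : 'I_r -> 'I_q) : 'M_r := \matrix_(k, l) A l (f k) in
  block_mx (part A (@lo r) *m (part B (@lo r))^T) (part A (@lo r) *m (part B (@hi r))^T)
    (part A (@hi r) *m (part B (@lo r))^T) (part A (@hi r) *m (part B (@hi r))^T)
    (unpos a) (unpos b) = \sum_l A l a * B l b.
Proof.
rewrite /unpos [in RHS](lo_hiE a) [in RHS](lo_hiE b).
by case: ifP => _; case: ifP => _;
  rewrite ?block_mxEul ?block_mxEur ?block_mxEdl ?block_mxEdr mxE;
  apply: eq_bigr => l _; rewrite !mxE.
Qed.

(** Path l gives the l-th columns of the triangular factors. Its cells lie in rows and columns from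
    2l on, which is lower triangularity of L, D, L', D' when positions alternate between the two
    halves. After scaling, the l-th product tends to the entries on path l. *)
Lemma triangular_limit x : path_torus x ->
  exists y : 'I_n -> {poly F}, (forall i, (y i).[0] = x 0 i) /\
    forall s, s != 0 -> triangular_products (\row_i ((s ^+ cell_product i)^-1 * (y i).[s])).
Proof.
move=> [C PC xC].
pose X i j : F := if insub i is Some a then
  if insub j is Some b then x 0 (spvar a b) else 0 else 0.
have XE (a b : 'I_q) : X a b = x 0 (spvar a b) by rewrite /X !valK.
have /choice[ab abP] (l : 'I_r) : exists ab : (nat -> F) * (nat -> F),
    [/\ forall i, ab.1 i != 0, forall j, ab.2 j != 0 &
      forall i j, (i < q)%N -> on_path C l i j -> ab.1 i * ab.2 j = X i j].
  have [|a [b H]] := path_factor PC (X := X) (ltn_ord l); last by exists (a, b).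
  move=> i1 j iq lij; have jq : (j < q)%N.
    have /and3P[_ _ j2] := lij.
    by apply: leq_ltn_trans j2 _; apply: (path_bound PC) => //; exact: ltnW.
  rewrite -[i1]/(val (Ordinal iq)) -[j]/(val (Ordinal jq)) XE xC.
  by apply/on_pathsP; exists l.
have [g gK Kg] := spvar_bij r.
pose act l (p : 'I_q * 'I_q) := (2 * l <= p.1)%N && (2 * l <= p.2)%N.
pose y v : {poly F} := \sum_(l < r | act l (g v))
  ((ab l).1 (g v).1 * (ab l).2 (g v).2)%:P * 'X^(path_defect r C l (g v).1 (g v).2).
exists y; split=> [v|s s0].
  rewrite -(Kg v) /y gK; move: (g v) => [a b] /=; rewrite horner_sum.
  have term (l : 'I_r) : act l (a, b) -> (((ab l).1 a * (ab l).2 b)%:P * 'X^(path_defect r C l a b)).[0] =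
      if on_path C l a b then x 0 (spvar a b) else 0.
    move=> /andP[/= la lb].
    rewrite hornerM hornerC hornerXn expr0n (path_defect_eq0 PC) ?ltn_ord ?la ?lb //.
    have [_ _ H] := abP l.
    by case: ifP => lab; rewrite ?mulr0 // mulr1 H ?XE.
  rewrite (eq_bigr _ term).
  have [/on_pathsP[l lr lab]|nab] := boolP (on_paths r C a b); last first.
    have -> : x 0 (spvar a b) = 0 by apply/eqP; rewrite -[_ == _]negbK xC.
    by rewrite big1 // => l _; case: ifP.
  have al : act (Ordinal lr) (a, b).
    have /and3P[la lb _] := lab; rewrite /act /= la /=; apply: leq_trans lb.
    by rewrite -(path_end PC lr); apply: (path_mono PC) => //; lia.
  rewrite (bigD1 (Ordinal lr)) //= lab big1 ?addr0 // => l' /andP[_ l'l].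
  case: ifP => // l'ab; case/eqP: l'l; apply: ord_inj.
  exact: (path_disjoint PC _ _ _ l'ab lab).
pose A (l : 'I_r) (a : 'I_q) : F :=
  if (2 * l <= a)%N then (ab l).1 a * s ^- (row_shift C l a) else 0.
pose B (l : 'I_r) (b : 'I_q) : F :=
  if (2 * l <= b)%N then (ab l).2 b * (s ^- (2 * l * b) * s ^+ (col_shift r C l b)) else 0.
exists (\matrix_(k, l) A l (lo k)), (\matrix_(k, l) A l (hi k)),
  (\matrix_(k, l) B l (lo k)), (\matrix_(k, l) B l (hi k)); split.
- split=> [i j ij|i]; rewrite mxE /A /=; first by case: ifP => //; lia.
  by rewrite leqnn mulf_neq0 ?invr_eq0 ?expf_neq0 //; have [] := abP i.
- by move=> i j ij; rewrite mxE /A /=; case: ifP => //; lia.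
- split=> [i j ij|i]; rewrite mxE /B /=; first by case: ifP => //; lia.
  rewrite leqnn !mulf_neq0 ?invr_eq0 ?expf_neq0 //; by have [] := abP i.
- by move=> i j ij; rewrite mxE /B /=; case: ifP => //; lia.
apply/rowP => v; rewrite mxE -(Kg v) /y gK; move: (g v) => [a b] /=.
rewrite spvarE (triangular_productE A B) cell_productE horner_sum mulr_sumr.
rewrite [RHS](bigID (fun l : 'I_r => act l (a, b))) /= [X in _ = _ + X]big1 ?addr0; last first.
  by move=> l; rewrite negb_and /A /B => /orP[] /negPf ->; rewrite ?mul0r ?mulr0.
apply: eq_bigr => l /andP[/= la lb]; rewrite /A /B la lb hornerM hornerC hornerXn.
have := @path_defectE r C l a b; rewrite la ltn_ord => /(_ isT).
move: (path_defect r C l a b) (row_shift C l a) (col_shift r C l b) => d rs cs E.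
have {}E : s ^+ (a * b) * s ^+ cs = s ^+ rs * s ^+ (2 * l * b) * s ^+ d.
  by rewrite -!exprD E.
have N0 e : s ^+ e != 0 by rewrite expf_neq0.
have -> : s ^+ d = s ^+ (a * b) * s ^+ cs * (s ^- rs * s ^- (2 * l * b)).
  by rewrite E mulrAC mulrACA !divff ?mul1r.
by rewrite -[RHS]mul1r -(mulVf (N0 (a * b)%N)); ring.
Qed.

End TriangularLimits.

(** * Unions of coordinate subspaces *)

Section CoordinateSubspaces.
Variables (C : numClosedFieldType) (n N : nat).
Implicit Types (sg : 'I_N -> 'I_n) (v : 'rV[C]_(n * N + N + n)).

(* The point of the coordinate subspace spanned by the e_(sg k) that satisfies
   x A = b is b \adj(A_sg) / \det A_sg, where A_sg consists of the rows sg k of A. *)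
Definition sub_rows sg v : 'M[C]_N := \matrix_(k, j) v 0 (idxA (sg k) j).
Definition numer sg v : 'rV[C]_N := (\row_j v 0 (idxb n j)) *m \adj (sub_rows sg v).
Definition num_form sg v : C := (numer sg v *m \col_k v 0 (idxc N (sg k))) 0 0.
Definition den sg v : C := \det (sub_rows sg v).

Lemma polyfun_sub_rows sg i j : polyfun (fun v => sub_rows sg v i j).
Proof.
apply: (eq_polyfun (f := fun v => v 0 (idxA (sg i) j))); last exact: polyfun_coord.
by move=> v; rewrite mxE.
Qed.

Lemma polyfun_den sg : polyfun (den sg).
Proof. by apply: polyfun_det; apply: polyfun_sub_rows. Qed.

Lemma polyfun_numer sg k : polyfun (fun v => numer sg v 0 k).
Proof.
apply: polyfun_mulmx; last by apply: polyfun_adj; apply: polyfun_sub_rows.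
move=> i j; apply: (eq_polyfun (f := fun v => v 0 (idxb n j))); last exact: polyfun_coord.
by move=> v; rewrite mxE.
Qed.

Lemma polyfun_num_form sg : polyfun (num_form sg).
Proof.
apply: polyfun_mulmx => [i j|i j]; first by rewrite ord1; exact: polyfun_numer.
apply: (eq_polyfun (f := fun v => v 0 (idxc N (sg i)))); last exact: polyfun_coord.
by move=> v; rewrite mxE.
Qed.

Definition embed sg (z : 'rV[C]_N) : 'rV[C]_n := \row_i \sum_(k | sg k == i) z 0 k.

Lemma embedE sg z k : injective sg -> embed sg z 0 (sg k) = z 0 k.
Proof.
move=> sgI; rewrite mxE (bigD1 k) //= big1 ?addr0 // => l /andP[/eqP/sgI ->].
by rewrite eqxx.
Qed.

Lemma embed_out sg z i : (forall k, sg k != i) -> embed sg z 0 i = 0.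
Proof. by move=> H; rewrite mxE big_pred0 // => k; rewrite (negPf (H k)). Qed.

Lemma embed_mul sg z m (A : 'M[C]_(n, m)) :
  embed sg z *m A = z *m \matrix_(k, j) A (sg k) j.
Proof.
apply/rowP => j; rewrite !mxE (eq_bigr (fun i => \sum_(k | sg k == i) z 0 k * A i j)).
  rewrite (exchange_big_dep predT) //=; apply: eq_bigr => k _.
  by rewrite mxE (big_pred1 (sg k)) // => i; rewrite eq_sym.
by move=> i _; rewrite mxE mulr_suml.
Qed.

Lemma embed_solution sg A b c : den sg (pt A b c) != 0 ->
  let x := embed sg ((den sg (pt A b c))^-1 *: numer sg (pt A b c)) in
  x *m A = b /\ (x *m c^T) 0 0 = num_form sg (pt A b c) / den sg (pt A b c).
Proof.
set v := pt A b c => dN0 x.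
have subE : sub_rows sg v = \matrix_(k, j) A (sg k) j.
  by apply/matrixP => k j; rewrite [LHS]mxE [RHS]mxE /v ptA.
have bE : \row_j v 0 (idxb n j) = b by apply/rowP => j; rewrite [LHS]mxE /v ptb.
split; rewrite /x embed_mul -scalemxAl.
  rewrite /numer -subE -mulmxA mul_adj_mx bE mul_mx_scalar scalerA mulVf //.
  by rewrite scale1r.
rewrite mxE mulrC /num_form; congr (_ * _); congr ((_ *m _) 0 0).
by apply/matrixP => k j; rewrite [RHS]mxE /v ptc [LHS]mxE [LHS]mxE ord1.
Qed.

Lemma den_numer_nonzero sg : injective sg ->
  exists v, den sg v != 0 /\ forall k, numer sg v 0 k != 0.
Proof.
move=> sgI; exists (pt (\matrix_(i, j) (i == sg j)%:R) (const_mx 1) 0).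
have subE : sub_rows sg (pt (\matrix_(i, j) (i == sg j)%:R) (const_mx 1) 0) = 1%:M.
  by apply/matrixP => k j; rewrite [LHS]mxE ptA [LHS]mxE [RHS]mxE (inj_eq sgI).
rewrite /den /numer subE det1 oner_neq0; split=> // k.
by rewrite adj1 mulmx1 [X in X != _]mxE ptb mxE oner_neq0.
Qed.

(** If c is the coordinate at an index of [sg] missed by [sg'], the form of [sg'] vanishes and that
    of [sg] is a numerator, nonzero for generic A and b. *)
Lemma num_form_separates sg sg' : injective sg -> injective sg' ->
  (exists k, forall l, sg' l != sg k) ->
  exists v, num_form sg v * den sg' v - num_form sg' v * den sg v != 0.
Proof.
move=> sgI sgI' [k nk].
have [v fv] : exists v, forall b : bool, (if b then den sg' v else numer sg v 0 k) != 0.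
  apply: polyfun_avoid_fin => [[]|[]].
  - exact: polyfun_den.
  - exact: polyfun_numer.
  - by have [v [dv _]] := den_numer_nonzero sgI'; exists v.
  by have [v [_ nv]] := den_numer_nonzero sgI; exists v.
have [A [b [c vE]]] := ptE v; rewrite vE in fv.
exists (pt A b (delta_mx 0 (sg k))).
have subE s c' : sub_rows s (pt A b c') = sub_rows s (pt A b c).
  by apply/matrixP => i j; rewrite [LHS]mxE [RHS]mxE !ptA.
have numE s c' : numer s (pt A b c') = numer s (pt A b c).
  by rewrite /numer subE; congr (_ *m _); apply/rowP => j; rewrite [LHS]mxE [RHS]mxE !ptb.
have -> : num_form sg' (pt A b (delta_mx 0 (sg k))) = 0.
  rewrite /num_form mxE big1 // => l _; rewrite [X in _ * X]mxE ptc [delta_mx _ _ _ _]mxE eqxx /=.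
  by rewrite (negPf (nk l)) mulr0.
rewrite mul0r subr0 mulf_neq0 //; last by rewrite /den subE; exact: (fv true).
rewrite /num_form numE mxE (bigD1 k) //= big1 => [|l lk].
  by rewrite addr0 [X in _ * X]mxE ptc [delta_mx _ _ _ _]mxE !eqxx mulr1; exact: (fv false).
by rewrite [X in _ * X]mxE ptc [delta_mx _ _ _ _]mxE eqxx (inj_eq sgI) (negPf lk) mulr0.
Qed.

Lemma coordinate_lower_bound (I : finType) (sg : I -> 'I_N -> 'I_n)
    (X : set 'rV[C]_n) (P : {poly {mpoly C[n * N + N + n]}}) :
  (forall t, injective (sg t)) ->
  (forall t t', t != t' -> exists k, forall l, sg t' l != sg t k) ->
  (forall t (x : 'rV[C]_n), (forall k, x 0 (sg t k) != 0) -> (forall i, (forall k, sg t k != i) -> x 0 i = 0) ->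
    X x) ->
  P != 0 -> Rel X P -> (#|I| < size P)%N.
Proof.
move=> sgI sgD XX PN0 RP.
(* All conditions on the parameters in one family: [P] keeps its degree, the systems are solvable,
   the solutions have no zero coordinate on their subspace, and the roots differ. The value 1 for t
   = t' makes the last condition void there. *)
pose f (o : unit + (I + (I * 'I_N + I * I))) v := match o with
  | inl _ => (lead_coef P).@[v 0]
  | inr (inl t) => den (sg t) v
  | inr (inr (inl (t, k))) => numer (sg t) v 0 k
  | inr (inr (inr (t, t'))) => if t == t' then 1 else
     num_form (sg t) v * den (sg t') v - num_form (sg t') v * den (sg t) v
  end.
have [v fv] : exists v, forall o, f o v != 0.
  apply: polyfun_avoid_fin => [[[]|[t|[[t k]|[t t']]]]|[[]|[t|[[t k]|[t t']]]]]; rewrite /f.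
  - exact: polyfun_meval.
  - exact: polyfun_den.
  - exact: polyfun_numer.
  - case: eqP => _; first exact: polyfun_cst.
    by apply: polyfunD; [|apply: polyfunN]; apply: polyfunM;
      [exact: polyfun_num_form|exact: polyfun_den..|exact: polyfun_num_form|exact: polyfun_den].
  - by apply: mpoly_nonvanishing; rewrite lead_coef_eq0.
  - by have [v [dv _]] := den_numer_nonzero (sgI t); exists v.
  - by have [v [_ nv]] := den_numer_nonzero (sgI t); exists v.
  have [tt'|tt'] := eqVneq t t'; first by exists 0; rewrite oner_neq0.
  exact: num_form_separates (sgD _ _ tt').
have [A [b [c vE]]] := ptE v; rewrite {}vE in fv.
set w := pt A b c in fv.
have dN0 t : den (sg t) w != 0 := fv (inr (inl t)).
pose T t := num_form (sg t) w / den (sg t) w.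
have evN0 : ev w P != 0.
  have /= lN0 := fv (inl tt); apply: contraNneq lN0 => ev0.
  have := congr1 (fun p : {poly C} => p`_(size P).-1) ev0.
  by rewrite coef_map_id0 ?meval0 // coef0 => /eqP.
have rootT t : root (ev w P) (T t).
  have [xA xc] := embed_solution (dN0 t).
  rewrite /root /T -xc /w -{1}xA; apply/eqP; apply: RP; apply: (XX t) => [k|i H].
    rewrite embedE // mxE mulf_neq0 ?invr_eq0 //.
    exact: fv (inr (inr (inl (t, k)))).
  exact: embed_out.
have T_inj : injective T.
  move=> t t' E; apply/eqP; apply: contraT => tt'.
  have := fv (inr (inr (inr (t, t')))); rewrite /= (negPf tt').
  rewrite subr_eq0 => /eqP[]; apply/eqP; rewrite -eqr_div ?dN0 //.
  exact/eqP.
have := max_poly_roots evN0 (rs := [seq T t | t <- enum I]).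
rewrite size_map -cardE map_inj_uniq // enum_uniq => H.
apply: leq_trans (size_poly _ _); apply: H => //.
by apply/allP => _ /mapP[t _ ->]; exact: rootT.
Qed.

End CoordinateSubspaces.

(** * The degree of Sp(r) *)

Section SymplecticDegree.
Variables (C : numClosedFieldType) (r : nat).
Local Notation q := (2 * r)%N.
Local Notation n := ((r + r) * (r + r))%N.
Local Notation N := (r * (2 * r).+1)%N.

Lemma path_torus_lower_bound (P : {poly {mpoly C[n * N + N + n]}}) :
  P != 0 -> Rel (@path_torus C r) P -> (size (path_families r) < size P)%N.
Proof.
have cardT (t : seq_sub (path_families r)) :
    #|[set p : 'I_q * 'I_q | on_paths r (cols r (ssval t)) p.1 p.2]| = N.
  exact/card_on_paths/path_families_system/ssvalP.
pose sg t k := let p := enum_val (cast_ord (esym (cardT t)) k) in spvar p.1 p.2.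
have sgP t (a b : 'I_q) : (exists k, sg t k = spvar a b) <->
    on_paths r (cols r (ssval t)) a b.
  split=> [[k E]|ab].
    have := enum_valP (cast_ord (esym (cardT t)) k).
    by rewrite (@bij_inj _ _ _ (spvar_bij r) _ (a, b) E) inE.
  have abP : (a, b) \in [set p : 'I_q * 'I_q | on_paths r (cols r (ssval t)) p.1 p.2].
    by rewrite inE.
  exists (cast_ord (cardT t) (enum_rank_in abP (a, b))).
  by rewrite /sg cast_ordK enum_rankK_in.
have sgE t k : exists a b, sg t k = spvar a b by rewrite /sg; eexists; eexists.
move=> PN0 RP.
rewrite -[size _](card_seq_sub (_ : uniq (path_families r))); last first.
  exact/families_uniq/size_last_state.
apply: (@coordinate_lower_bound _ _ _ _ sg _ P _ _ _ PN0 RP) => [t k k' E|t t' tt'|t x xN0 x0].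
- apply/(@cast_ord_inj _ _ (esym (cardT t)))/enum_val_inj.
  exact: (@bij_inj _ _ _ (spvar_bij r)) E.
- apply: contrapT => H; case/eqP: tt'; apply: val_inj => /=.
  have sub (a b : 'I_q) : on_paths r (cols r (ssval t)) a b -> on_paths r (cols r (ssval t')) a b.
    move=> /sgP[k kE]; apply/sgP; apply: contrapT => nk; apply: H; exists k => l.
    by apply/eqP => lk; apply: nk; exists l; rewrite lk.
  have PS (s : seq_sub (path_families r)) : path_system r (cols r (ssval s)).
    exact/path_families_system/ssvalP.
  apply: (path_families_inj (ssvalP t) (ssvalP t')).
  apply: (on_paths_inj (PS t) (PS t')) => i j iq jq.
  (* Both unions have N cells, so inclusion forces equality. *)
  have := subset_leqif_cards (_ : [set p : 'I_q * 'I_q | on_paths r (cols r (ssval t)) p.1 p.2]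
    \subset [set p : 'I_q * 'I_q | on_paths r (cols r (ssval t')) p.1 p.2]).
  case=> [|_]; first by apply/fintype.subsetP => -[a b]; rewrite !inE; exact: sub.
  rewrite !cardT eqxx => /esym/eqP/setP/(_ (Ordinal iq, Ordinal jq)).
  by rewrite !inE.
exists (cols r (ssval t)); first exact/path_families_system/ssvalP.
move=> a b; apply/idP/idP => [xab|/sgP[k <-]]; last exact: xN0.
apply/sgP; apply: contrapT => nk; case/eqP: xab; apply: x0 => k.
by apply/eqP => kE; apply: nk; exists k.
Qed.

Lemma Sp_lower_bound (P : {poly {mpoly C[n * N + N + n]}}) :
  Rel (Sp_variety C r) P -> P != 0 -> (size (path_families r) < size P)%N.
Proof.
move=> RP PN0.
have [P1 [P1N0 sz1 RP1]] := Rel_degenerate (@Sp_limit C r) PN0 RP.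
have [P2 [P2N0 sz2 RP2]] := Rel_degenerate (@triangular_limit C r) P1N0 RP1.
by apply: leq_trans (path_torus_lower_bound P2N0 RP2) (leq_trans sz2 sz1).
Qed.

Local Notation Z a b := ('X_(mxvec_index a b) : {mpoly C[n]}).

Definition Sp_equation (p : 'I_(r + r) * 'I_(r + r)) : {mpoly C[n]} :=
  \sum_u (Z (lshift r u) p.1 * Z (rshift r u) p.2 - Z (rshift r u) p.1 * Z (lshift r u) p.2)
  - (symp_form C r p.1 p.2)%:MP.

Lemma Sp_equations (x : 'rV[C]_n) : Sp_variety C r x <->
  forall G, G \in [seq Sp_equation p | p <- enum {: 'I_(r + r) * 'I_(r + r)}] -> G.@[x 0] = 0.
Proof.
have eqE (M : 'M[C]_(r + r)) p : (Sp_equation p).@[mxvec M 0] =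
    (M^T *m symp_form C r *m M) p.1 p.2 - symp_form C r p.1 p.2.
  rewrite mevalB mevalC symp_formE raddf_sum /=; congr (_ - _); apply: eq_bigr => u _.
  by rewrite mevalB !mevalM !mevalXU !mxvecE !mxE.
split=> [[M SpM <-] _ /mapP[p _ ->]|H].
  by rewrite eqE SpM subrr.
exists (vec_mx x); last exact: vec_mxK.
apply/matrixP => a b; apply/eqP; rewrite -subr_eq0.
have := eqE (vec_mx x) (a, b); rewrite vec_mxK /= => <-; apply/eqP; apply: H.
by apply: map_f; rewrite mem_enum.
Qed.

Lemma Sp_degree : (0 < r)%N -> has_degree (Sp_variety C r) (size (path_families r)).
Proof.
move=> r0; apply: (has_degree_of_hilbert_bounds (N := N)
  (K := #|{set 'I_q * 'I_q}|) _ (path_families_gt0 r) Sp_equations).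
- by apply/andP; split; nia.
- exact: Sp_spanned.
- by exists (@sp_chart C r); exact: Sp_alg_indep.
exact: Sp_lower_bound.
Qed.

End SymplecticDegree.

Theorem theorem3p4 (R : realType) (r : nat) (r_gt0 : (0 < r)%N) :
  exists2 D : nat, has_degree (Sp_variety (complex R) r) D &
    D%:Z = \det (\matrix_(i < r, j < r)
      ('C(2 * i.+1 + 2 * j.+1 - 2, 2 * i.+1 - 1))%:Z).
Proof.
exists (size (path_families r)); last exact: path_families_det.
exact: Sp_degree r_gt0.
Qed.
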